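(* Assume $g$ satisfies A1, A2, A1* and A3w, and that $u\in C^0(\overline\Omega)$ is locally $g$-convex in a domain $\Omega\subset\mathbb R^n$. Assume also: (i) $\Omega$ is $g$-convex with respect to $(y,z)$ for all $y\in\Sigma_u(\Omega)$ and all $z\in g^*(\cdot,y,u)(\overline\Omega)=\{g^*(x,y,u(x)):x\in\overline\Omega\}$; (ii) $\Sigma_u(\Omega)$ is sub $g^*$-convex with respect to $u$ on $\Omega$. Then $u$ is $g$-convex in $\Omega$.
   Context: Setting. $\Gamma\subset\mathbb R^n\times\mathbb R^n\times\mathbb R$ is a domain whose projections $I(x,y)=\{z\in\mathbb R: (x,y,z)\in\Gamma\}$ are open intervals. The generating function is $g=g(x,y,z)\in C^2(\Gamma)$ with $g_z<0$ in $\Gamma$. Subscripts denote partial derivatives. Set $\mathcal U=\{(x,g(x,y,z),g_x(x,y,z)) : (x,y,z)\in\Gamma\}$ and $\mathcal U(x,u)=\{p\in\mathbb R^n:(x,u,p)\in\mathcal U\}$. A1: for each $(x,u,p)\in\mathcal U$ there is a unique point $(x,y,z)\in\Gamma$ with $g(x,y,z)=u$, $g_x(x,y,z)=p$. One writes $Y(x,u,p)=y$, $Z(x,u,p)=z$. A2: $\det E\ne0$ in $\Gamma$, where $E=g_{x,y}-(g_z)^{-1}g_{x,z}\otimes g_y$. A1*: with $Q:=-g_y/g_z$, for all $(y,z)$ the map $x\mapsto Q(x,y,z)$ is one-to-one on $\{x:(x,y,z)\in\Gamma\}$. A3w: with $A(x,u,p)=g_{xx}(x,Y(x,u,p),Z(x,u,p))$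 on $\mathcal U$, for every $\xi\in\mathbb R^n$ and every $(x,u)\in\mathbb R^n\times\mathbb R$ the function $p\mapsto (A(x,u,p)\xi,\xi)$ is convex along line segments in $\mathcal U(x,u)$ orthogonal to $\xi$. Dual function: $g^*$ is defined on $\Gamma^*=\{(x,y,g(x,y,z)):(x,y,z)\in\Gamma\}$ by $g(x,y,g^*(x,y,u))=u$. Set $P(x,y,u)=g_x(x,y,g^*(x,y,u))$ on $\Gamma^*$. A set $\Omega\subset\mathbb R^n$ is $g$-convex with respect to $(y,z)$ if $\Omega\times\{y\}\times\{z\}\subset\Gamma$ and $Q(\cdot,y,z)(\Omega)$ is convex in $\mathbb R^n$. A function $u\in C^0(\Omega)$ is $g$-convex in $\Omega$ if for each $x_0\in\Omega$ there is $(y_0,z_0)$ with $\Omega\times\{y_0\}\times\{z_0\}\subset\Gamma$, $u(x_0)=g(x_0,y_0,z_0)$ and $u(x)\ge g(x,y_0,z_0)$ for all $x\in\Omega$; then $g(\cdot,y_0,z_0)$ is a $g$-support to $u$ at $x_0$ in $\Omega$. The function $u$ is locally $g$-convex in $\Omega$ if at each $x_0\in\Omega$, $u$ has a $g$-support in some neighbourhood $\mathcal N_0$ of $x_0$ (i.e. the preceding holds with $\Omega$ replaced by $\mathcal N_0$). For such $u$ (which is locally semi-convex), $\partial u(x_0)=\{p: u(x)\ge u(x_0)+p\cdot(x-x_0)+o(|x-x_0|)\text{ as }x\to x_0\}$ is the subdifferential, $\Sigma_u(x_0)=Y(x_0,u(x_0),\partial u(x_0))$, and $\Sigma_u(\Omega)=\bigcup_{x\in\Omega}\Sigma_u(x)$.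 It is understood that $\{x_0\}\times\{u(x_0)\}\times\partial u(x_0)\subset\mathcal U$ for $x_0\in\Omega$, so that $\Sigma_u$ is defined, and that $(x,y,u(x))\in\Gamma^*$ for all $x\in\overline\Omega$, $y\in\Sigma_u(\Omega)$, so that (i) makes sense. A set $V\subset\mathbb R^n$ is sub $g^*$-convex with respect to $u$ on $\Omega$ if for every $x\in\Omega$ one has $\{x\}\times V\times\{u(x)\}\subset\Gamma^*$ and the convex hull of $P(x,V,u(x))=\{P(x,y,u(x)):y\in V\}$ is contained in $\mathcal U(x,u(x))$. *)

(* Defs.v *)
From mathcomp Require Import all_boot all_order all_algebra.
From mathcomp Require Import all_classical all_reals all_analysis.
Import Order.TTheory GRing.Theory Num.Theory.
Import numFieldNormedType.Exports.

Set Implicit Arguments.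
Unset Strict Implicit.
Unset Printing Implicit Defensive.

Local Open Scope classical_set_scope.
Local Open Scope ring_scope.

Definition domain (T : topologicalType) (D : set T) : Prop :=
  [/\ open D, connected D & D !=set0].

Section Calculus.
Context {R : realType} {V : normedModType R}.

(* [C1_on] and [C2_on] are meant for open [D]; the values of [f] outside [D]
   are then irrelevant. *)
Definition C1_on (D : set V) (f : V -> R) : Prop :=
  {in D, continuous f} /\
  forall v, {in D, forall p, derivable f p v} /\ {in D, continuous ('D_v f)}.

Definition C2_on (D : set V) (f : V -> R) : Prop :=
  C1_on D f /\ forall v, C1_on D ('D_v f).

End Calculus.

Section Euclidean.
Context {R : realType} {n : nat}.
Local Notation X := 'rV[R]_n.

Definition dotp (a b : X) : R := (a *m b^T) 0 0.

Definition segment (p q : X) : set X :=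
  [set (1 - t) *: p + t *: q | t in `[0, 1]%classic].

Definition convex_hull (S : set X) : set X := smallest (@convex_set R X) S.

(* Only the values of [u] near [x0] matter.  The remainder is measured with the
   sup norm of ['rV_n], equivalent to the Euclidean one. *)
Definition subdifferential (u : X -> R) (x0 : X) : set X :=
  [set p | exists2 r : X -> R,
     r =o_x0 (fun x => x - x0) &
     \forall x \near x0, u x0 + dotp p (x - x0) + r x <= u x].

End Euclidean.

Section GeneratingFunction.
Context {R : realType} {n : nat}.
Local Notation X := 'rV[R]_n.
(* Triples [(x, y, z)]: [Gamma] is a set of such triples, and [g] is a total
   function of which only the restriction to [Gamma] is meaningful. *)
Local Notation XYZ := (X * X * R)%type.
Implicit Types (Gamma : set XYZ) (g : XYZ -> R) (w : XYZ).
Implicit Types (x y p xi : X) (z t : R) (Omega V : set X) (u : X -> R).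

Definition dir_x (i : 'I_n) : XYZ := (delta_mx 0 i, 0, 0).
Definition dir_y (i : 'I_n) : XYZ := (0, delta_mx 0 i, 0).
Definition dir_z : XYZ := (0, 0, 1).

Definition g_x g w : X := \row_i 'D_(dir_x i) g w.
Definition g_y g w : X := \row_i 'D_(dir_y i) g w.
Definition g_z g w : R := 'D_dir_z g w.
Definition g_xx g w : 'M[R]_n :=
  \matrix_(i, j) 'D_(dir_x j) ('D_(dir_x i) g) w.
Definition g_xy g w : 'M[R]_n :=
  \matrix_(i, j) 'D_(dir_y j) ('D_(dir_x i) g) w.
Definition g_xz g w : X := \row_i 'D_dir_z ('D_(dir_x i) g) w.

Definition generating_function Gamma g : Prop :=
  [/\ domain Gamma,
      forall x y, open [set z | Gamma (x, y, z)] /\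
                  is_interval [set z | Gamma (x, y, z)],
      C2_on Gamma g
    & forall w, Gamma w -> g_z g w < 0].

Definition UU Gamma g (x : X) (t : R) : set X :=
  [set p | exists y z, [/\ Gamma (x, y, z), g (x, y, z) = t
                                          & g_x g (x, y, z) = p]].

Definition YZ_spec Gamma g x t p : set (X * R) :=
  [set yz | [/\ Gamma (x, yz.1, yz.2), g (x, yz.1, yz.2) = t
              & g_x g (x, yz.1, yz.2) = p]].

(* [YZ], [Y], [Z] and, below, [gstar] take a junk value where no point satisfies
   their defining equations. *)
Definition YZ Gamma g x t p : X * R := xget (0, 0) (YZ_spec Gamma g x t p).
Definition Y Gamma g x t p : X := (YZ Gamma g x t p).1.
Definition Z Gamma g x t p : R := (YZ Gamma g x t p).2.

Definition Emx g w : 'M[R]_n :=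
  g_xy g w - (g_z g w)^-1 *: ((g_xz g w)^T *m g_y g w).

Definition Q g w : X := - (g_z g w)^-1 *: g_y g w.

Definition A Gamma g x t p : 'M[R]_n :=
  g_xx g (x, Y Gamma g x t p, Z Gamma g x t p).

Definition condA1 Gamma g : Prop :=
  forall x t p, UU Gamma g x t p -> exists! yz, YZ_spec Gamma g x t p yz.

Definition condA2 Gamma g : Prop :=
  forall w, Gamma w -> \det (Emx g w) != 0.

Definition condA1star Gamma g : Prop :=
  forall y z, {in [set x | Gamma (x, y, z)] &, injective
                 (fun x => Q g (x, y, z))}.

Definition condA3w Gamma g : Prop :=
  forall xi x t p q,
    segment p q `<=` UU Gamma g x t -> dotp (q - p) xi = 0 ->
    convex_function (segment p q)
      (fun r => dotp (xi *m A Gamma g x t r) xi).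

Definition Gamma_star Gamma g : set XYZ :=
  [set (w.1, g w) | w in Gamma].

Definition gstar Gamma g x y t : R :=
  xget 0 [set z | Gamma (x, y, z) /\ g (x, y, z) = t].

Definition P Gamma g x y t : X := g_x g (x, y, gstar Gamma g x y t).

Definition g_convex_set Gamma g Omega y z : Prop :=
  (forall x, Omega x -> Gamma (x, y, z)) /\
  @convex_set R X [set Q g (x, y, z) | x in Omega].

Definition has_g_support Gamma g u Omega x0 : Prop :=
  exists y0 z0,
    [/\ forall x, Omega x -> Gamma (x, y0, z0),
        u x0 = g (x0, y0, z0)
      & forall x, Omega x -> g (x, y0, z0) <= u x].

Definition g_convex Gamma g u Omega : Prop :=
  {within Omega, continuous u} /\
  forall x0, Omega x0 -> has_g_support Gamma g u Omega x0.

Definition locally_g_convex Gamma g u Omega : Prop :=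
  {within Omega, continuous u} /\
  forall x0, Omega x0 -> exists N0 : set X,
    [/\ nbhs x0 N0, N0 `<=` Omega & has_g_support Gamma g u N0 x0].

Definition Sigma_pt Gamma g u x0 : set X :=
  Y Gamma g x0 (u x0) @` subdifferential u x0.

Definition Sigma Gamma g u Omega : set X :=
  \bigcup_(x in Omega) Sigma_pt Gamma g u x.

Definition sub_gstar_convex Gamma g u Omega V : Prop :=
  forall x, Omega x ->
    (forall y, V y -> Gamma_star Gamma g (x, y, u x)) /\
    convex_hull [set P Gamma g x y (u x) | y in V] `<=` UU Gamma g x (u x).

End GeneratingFunction.

(* Main.v *)
Require Import Defs.
From mathcomp Require Import all_boot all_order all_algebra.
From mathcomp Require Import all_classical all_reals all_analysis.
From mathcomp Require Import ring lra.
Import Order.TTheory GRing.Theory Num.Theory.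
Import numFieldNormedType.Exports.

(** Fix a point [x0] with a local support [g(., y0, z0)], and let [phi x] be the
    height with [g(x, y0, phi x) = u x]; the claim is [phi <= z0] on [Omega].
    A g-segment of height [z] is the preimage under [Q(., y0, z)] of a segment.

    The key fact is that if [phi >= z] on a g-segment of height [z], with
    equality at an interior point, then equality holds at its end.  At the last
    contact [x*] take a local support [g(., y1, z1)] of [u]: it lies below
    [g(., y0, z)] on the segment near [x*], so the difference of the gradients
    is orthogonal to the segment.  As [g] is only C^2, A3w cannot be
    differentiated along the segment.  Instead, move from [x*] along a curve
    [c] with [c'' = - v], where [v] is a subgradient of the convex function
    [eta |-> A(c, g, g_x + eta) c' . c'] on the hyperplane orthogonal to [c'];
    an Euler scheme gives such curves up to an arbitrarily small error.  A second order
    touching argument shows [g(c t, y', z') >= g(c t, y0, z)], in the limit of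
    zero error, for every [(y', z')] near [(y0, z)] or [(y1, z1)] having the
    value of [g(., y0, z)] at [x*] and a gradient difference orthogonal to
    [c' 0].  Differentiating in [(y', z')] at [(y0, z)] forces
    [Q(c t, y0, z) - Q(x*, y0, z)] to be parallel to the segment, so [c] runs
    along it, and [(y', z') = (y1, z1)] yields a contact beyond [x*].

    Suppose now that [phi x1 > z0], and let [m <= z0] be the minimum of [phi]
    on the g-segment of height [z0] from [x0] to [x1].  If [phi x2 < m] for some
    [x2], then [phi > z] on the g-segment from [x0] of height [z] when
    [z = phi x2], first with its end moved from [x0] to [x1] along the g-segment
    of height [z0], and then with [z] raised to [z0]: by the key fact no contact
    can appear in the interior.  In the limit [phi >= z0] on the g-segment of
    height [z0], with contact near [x0], so [phi x1 = z0].  Otherwise [m] is the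
    minimum of [phi] on [Omega], and the key fact on g-segments through a
    minimum point makes [phi] constant. *)

Set Implicit Arguments.
Unset Strict Implicit.
Unset Printing Implicit Defensive.

Local Open Scope classical_set_scope.
Local Open Scope ring_scope.

(** * Functions of class C^1 and C^2 *)

Section Normed.
Context {R : realType}.

(** A subgradient of [eta |-> A c' . c'] is available at each position and velocity, but it depends
    on them in no continuous way and lives on a hyperplane that turns with [c']. So there is no
    differential equation to solve; the curves only satisfy the subgradient inequality up to [del].
    That inequality is not strict, so by itself it cannot contradict a touching. The gain comes from
    A2: [(y', z')] is embedded in a family [z = z' + q.(y - y') + K |y - y'|^2 + a], and at a
    touching point [y] varies along with [x]. The mixed term [tau E b] is of first order in the
    variation [b], everything else is of second order or bounded by [del]. The order of the
    constants matters: the length of the curves and the neighbourhood of [(y', z')] are fixed before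
    the allowed defect [m], while [K] and then [del] depend on [m]. Hence [del] can tend to 0 at a
    fixed time, and a cluster point of the positions is all that is kept of the curves. Hypothesis
    (i) supplies the g-segments at every height taken by [phi]; (ii) places the segment between the
    gradients of two supports in [UU], and compactness thickens it to a tube in which A3w
    applies. *)

Lemma near_normP (V : normedModType R) (p : V) (P : set V) :
  (\forall x \near p, P x) <->
  exists2 d : R, 0 < d & forall x, `|x - p| < d -> P x.
Proof.
split.
  move=> /nbhs_ballP[d /= d0 dP]; exists d => // x xp; apply: dP.
  by rewrite -ball_normE /= distrC.
move=> [d d0 dP]; apply/nbhs_ballP; exists d => //= x.
by rewrite -ball_normE /= distrC => /dP.
Qed.

Lemma cvg_normP (V W : normedModType R) (f : V -> W) (p : V) :
  {for p, continuous f} <->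
  forall e : R, 0 < e -> exists2 d : R, 0 < d & forall x, `|x - p| < d -> `|f x - f p| < e.
Proof.
split.
  move=> /cvgrPdist_lt fp e /fp /near_normP[d d0 dP]; exists d => // x /dP.
  by rewrite distrC.
move=> H; apply/cvgrPdist_lt => e /H[d d0 dP]; apply/near_normP; exists d => // x /dP.
by rewrite distrC.
Qed.

Lemma derivable_line (V : normedModType R) (f : V -> R) (p v : V) (s : R) :
  derivable f (p + s *: v) v ->
  is_derive s 1 (fun t : R => f (p + t *: v)) ('D_v f (p + s *: v)).
Proof.
move=> df.
have E : (fun h : R => h^-1 *: (((fun t : R => f (p + t *: v)) \o shift s) (h *: (1 : R)) - f (p + s *: v)))
  = (fun h : R => h^-1 *: ((f \o shift (p + s *: v)) (h *: v) - f (p + s *: v))).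
  apply/funext => h /=; congr (_ *: (f _ - _)).
  by rewrite [h *: 1]mulr1 scalerDl addrCA.
by split; rewrite /derivable /derive E.
Qed.

Lemma mvt_line (V : normedModType R) (f : V -> R) (p v : V) (c : R) :
  (forall s, `|s| <= `|c| -> derivable f (p + s *: v) v) ->
  exists2 s : R, `|s| <= `|c| & f (p + c *: v) - f p = c * 'D_v f (p + s *: v).
Proof.
move=> df; pose F t := f (p + t *: v).
have dF (s : R) : `|s| <= `|c| -> is_derive s 1 F ('D_v f (p + s *: v)).
  by move=> /df; exact: derivable_line.
have cF (a b : R) : (forall s, s \in `[a, b] -> `|s| <= `|c|) -> {within `[a, b], continuous F}.
  move=> ab; apply: derivable_within_continuous => x /ab /dF dFx; exact: ex_derive.
have [c0|c0] := leP 0 c.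
  have ab (s : R) : s \in `[0, c] -> `|s| <= `|c|.
    by rewrite in_itv /= => /andP[s0 sc]; rewrite !ger0_norm.
  have [||s sc] := @MVT_segment R F (fun s => 'D_v f (p + s *: v)) 0 c c0.
  - move=> x xc; apply: dF; apply: ab; move: xc; rewrite !in_itv /= => /andP[/ltW -> /ltW ->] //.
  - exact: cF.
  rewrite /F scale0r addr0 subr0 mulrC => E; exists s => //; exact: ab.
have ab (s : R) : s \in `[c, 0] -> `|s| <= `|c|.
  by rewrite in_itv /= => /andP[s0 sc]; rewrite (ltr0_norm c0) ler0_norm// lerN2.
have [||s sc] := @MVT_segment R F (fun s => 'D_v f (p + s *: v)) c 0 (ltW c0).
- move=> x xc; apply: dF; apply: ab; move: xc; rewrite !in_itv /= => /andP[/ltW -> /ltW ->] //.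
- exact: cF.
rewrite /F scale0r addr0 sub0r => E; exists s; first exact: ab.
by rewrite -opprB E mulrN opprK mulrC.
Qed.

Lemma C1_on_cts (V : normedModType R) (D : set V) (f : V -> R) p v e : C1_on D f -> D p -> 0 < e ->
  exists2 d, 0 < d & forall x, `|x - p| < d -> `|'D_v f x - 'D_v f p| < e.
Proof.
move=> [_ /(_ v)[_ h]] Dp e0; have := h p; rewrite inE => /(_ Dp) /cvg_normP; exact.
Qed.

Lemma C1_on_drv (V : normedModType R) (D : set V) (f : V -> R) p v : C1_on D f -> D p ->
  derivable f p v.
Proof. by move=> [_ /(_ v)[h _]] Dp; apply: h; rewrite inE. Qed.

Lemma open_norm (V : normedModType R) (D : set V) p : open D -> D p ->
  exists2 d : R, 0 < d & forall x, `|x - p| < d -> D x.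
Proof. by rewrite openE => h /h /near_normP. Qed.

Lemma quotient_limit_close (q k A B e : R) : 0 < k ->
  `|q - k * A| <= e / 2 * k -> `|q - k * B| <= e / 2 * k -> `|B - A| <= e.
Proof.
move=> k0; rewrite !ler_norml -[X in _ -> _ -> X && _](ler_pM2l k0) -[X in _ -> _ -> _ && X](ler_pM2l k0).
by move=> /andP[a1 a2] /andP[b1 b2]; apply/andP; split; lra.
Qed.

(** The second difference over the parallelogram spanned by [h v] and [h w] is symmetric in [v] and
    [w]. Two mean value theorems turn it into [h^2] times a mixed derivative at a nearby point, and
    continuity at [p] gives the limit in either order. *)
Lemma schwarz (V : normedModType R) (D : set V) (f : V -> R) p v w :
  open D -> C2_on D f -> D p -> 'D_v ('D_w f) p = 'D_w ('D_v f) p.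
Proof.
move=> oD [C1f C2f] Dp.
have key : forall (v w : V) (e : R), 0 < e -> exists2 d : R, 0 < d & forall h, 0 < h < d ->
   `|f (p + h *: v + h *: w) - f (p + h *: v) - (f (p + h *: w) - f p) - h * h * 'D_w ('D_v f) p| <= e * (h * h).
  move=> {}v {}w e e0.
  have [d1 d10 D1] := open_norm oD Dp.
  have [d2 d20 D2] := C1_on_cts w (C2f v) Dp e0.
  pose d := Num.min d1 d2; have d0 : 0 < d by rewrite lt_min d10.
  pose M := `|v| + `|w| + 1; have M0 : 0 < M by rewrite /M ltr_wpDl// addr_ge0.
  exists (d / M); first by rewrite divr_gt0.
  move=> h /andP[h0 hd].
  have small s t : `|s| <= h -> `|t| <= h -> `|p + s *: v + t *: w - p| < d.
    move=> sh th.
    have -> : p + s *: v + t *: w - p = s *: v + t *: w by rewrite -(addrA p) [p + _]addrC addrK.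
    apply: (le_lt_trans (ler_normD _ _)); rewrite !normrZ.
    have : `|s| * `|v| + `|t| * `|w| <= h * M.
      have := ler_wpM2r (normr_ge0 v) sh; have := ler_wpM2r (normr_ge0 w) th.
      rewrite /M; nra.
    move=> /le_lt_trans; apply; by rewrite -ltr_pdivlMr.
  have sD s t : `|s| <= h -> `|t| <= h -> D (p + s *: v + t *: w).
    by move=> sh th; apply: D1; apply: lt_le_trans (small _ _ sh th) _; rewrite ge_min lexx.
  have s2 s t : `|s| <= h -> `|t| <= h -> `|'D_w ('D_v f) (p + s *: v + t *: w) - 'D_w ('D_v f) p| <= e.
    by move=> sh th; apply/ltW/D2; apply: lt_le_trans (small _ _ sh th) _; rewrite ge_min lexx orbT.
  have hh : `|h| = h by rewrite gtr0_norm.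
  pose F x := f (x + h *: w) - f x.
  have dF (s : R) : `|s| <= h -> is_derive s 1 (fun t : R => F (p + t *: v)) ('D_v f (p + s *: v + h *: w) - 'D_v f (p + s *: v)).
    move=> sh; rewrite /F.
    have d1' : is_derive s 1 (fun t : R => f (p + t *: v + h *: w)) ('D_v f (p + s *: v + h *: w)).
      have -> : (fun t : R => f (p + t *: v + h *: w)) = (fun t => f ((p + h *: w) + t *: v)).
        by apply/funext => t; rewrite addrAC.
      rewrite [p + s *: v + _]addrAC; apply: derivable_line.
      by rewrite addrAC; apply: C1_on_drv C1f _; apply: sD => //; rewrite hh.
    have d2' : is_derive s 1 (fun t : R => f (p + t *: v)) ('D_v f (p + s *: v)).
      apply: derivable_line; apply: C1_on_drv C1f _.
      have := @sD s 0 sh; rewrite scale0r addr0; apply; rewrite normr0; exact: ltW.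
    exact: is_deriveB.
  have [||s sI E] := @MVT_segment R (fun t => F (p + t *: v)) (fun s => 'D_v f (p + s *: v + h *: w) - 'D_v f (p + s *: v)) 0 h (ltW h0).
  - move=> x; rewrite in_itv /= => /andP[x0 xh]; apply: dF; rewrite gtr0_norm//; exact: ltW.
  - apply: derivable_within_continuous => x; rewrite in_itv /= => /andP[x0 xh].
    have /dF dFx : `|x| <= h by rewrite ger0_norm.
    exact: ex_derive.
  have sh : `|s| <= h by move: sI; rewrite in_itv /= => /andP[s0 ?]; rewrite ger0_norm.
  have [t th E2] := @mvt_line V ('D_v f) (p + s *: v) w h
    (fun t th => C1_on_drv (C2f v) (sD s t sh (eq_rect _ (fun z => `|t| <= z) th _ hh))).
  rewrite hh in th.
  move: E; rewrite /F scale0r addr0 subr0 E2 => ->.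
  have -> : h * 'D_w ('D_v f) (p + s *: v + t *: w) * h - h * h * 'D_w ('D_v f) p =
   (h * h) * ('D_w ('D_v f) (p + s *: v + t *: w) - 'D_w ('D_v f) p) by rewrite mulrBr mulrAC.
  have hh0 : 0 < h * h by rewrite mulr_gt0.
  rewrite normrM (ger0_norm (ltW hh0)) [leRHS]mulrC ler_pM2l//.
  exact: s2.
apply/eqP; rewrite -subr_eq0 -normr_le0; apply/ler_addgt0Pl => e e0; rewrite addr0.
have e20 : 0 < e / 2 by rewrite divr_gt0.
have [d1 d10 K1] := key v w _ e20.
have [d2 d20 K2] := key w v _ e20.
pose h := Num.min d1 d2 / 2.
have m0 : 0 < Num.min d1 d2 by rewrite lt_min d10.
have h0 : 0 < h by rewrite divr_gt0.
have hm : h < Num.min d1 d2 by rewrite /h; lra.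
have h1 : 0 < h < d1 by rewrite h0 (lt_le_trans hm)// ge_min lexx.
have h2 : 0 < h < d2 by rewrite h0 (lt_le_trans hm)// ge_min lexx orbT.
have := K1 _ h1; have := K2 _ h2.
rewrite (addrAC p (h *: w)).
have -> : f (p + h *: v + h *: w) - f (p + h *: w) - (f (p + h *: v) - f p) =
  f (p + h *: v + h *: w) - f (p + h *: v) - (f (p + h *: w) - f p).
  by rewrite !opprB !addrA addrAC [in RHS]addrAC; congr (_ + _); rewrite addrAC.
have hh : 0 < h * h by rewrite mulr_gt0.
move=> k2 k1; exact: quotient_limit_close hh k1 k2.
Qed.

Lemma is_derive_quad (a b t : R) :
  is_derive t 1 (fun t : R => t * a + t * t * b) (a + t * b *+ 2).
Proof.
have h1 : is_derive t 1 (fun t : R => t * a) a.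
  have := @is_deriveM R _ (@id R) (cst a) t 1 1 0 _ _ => h.
  by apply: is_derive_eq; rewrite /= scaler0 add0r [_ *: _]mulr1.
have h2 : is_derive t 1 (fun t : R => t * t * b) (t * b *+ 2).
  have h : is_derive t 1 (fun t : R => t * t) (t + t).
    have := @is_deriveM R _ (@id R) (@id R) t 1 1 1 _ _ => h.
    by apply: is_derive_eq; rewrite /= [_ *: _]mulr1.
  have := @is_deriveM R _ (fun t : R => t * t) (cst b) t 1 _ 0 h _ => h'.
  by apply: is_derive_eq; rewrite /= scaler0 add0r [_ *: _]mulrC mulrDl mulr2n.
exact: is_deriveD.
Qed.

Lemma taylor2_arith (s t A B C X2 X3 Y0 Y1 Y2 Z e : R) : 0 <= s -> `|t| <= s ->
  Y2 - Y1 = s * s * X2 -> Y1 - s * A - s * s * (B / 2) - Y0 = (Z - A - t * B) * s ->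
  Z - A = t * X3 -> `|X2 - C| < e / 3 -> `|X3 - B| < e / 3 ->
  `|Y2 - Y0 - s * A - s * s * (C + B / 2)| <= e * (s * s).
Proof.
move=> s0 ts E2 E1 E3 h2 h3.
have -> : Y2 - Y0 - s * A - s * s * (C + B / 2) = s * s * (X2 - C) + s * t * (X3 - B).
  transitivity ((Y2 - Y1) + (Y1 - s * A - s * s * (B / 2) - Y0) - s * s * C); first by ring.
  rewrite E2 E1 E3; ring.
apply: le_trans (ler_normD _ _) _; rewrite !normrM (ger0_norm s0).
have e0 : 0 <= e / 3 := ltW (le_lt_trans (normr_ge0 _) h2).
have : s * s * `|X2 - C| <= s * s * (e / 3) by rewrite ler_wpM2l ?mulr_ge0// ltW.
have : s * `|t| * `|X3 - B| <= s * s * (e / 3).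
  by apply: ler_pM; rewrite ?mulr_ge0// ?ler_wpM2l// ltW.
have : 0 <= e / 3 * (s * s) := mulr_ge0 e0 (mulr_ge0 s0 s0).
lra.
Qed.

(** The point moves along a parabola because the later tests follow curves with an acceleration. The
    [v2] displacement is already of size [s^2] and costs one mean value theorem; the remaining
    function [F] has derivative [o(t)]. *)
Lemma taylor2 (V : normedModType R) (D : set V) (f : V -> R) p v1 v2 (e : R) :
  open D -> C2_on D f -> D p -> 0 < e ->
  exists2 d, 0 < d & forall s, 0 <= s < d ->
   `|f (p + s *: v1 + (s * s) *: v2) - f p - s * 'D_v1 f p
      - (s * s) * ('D_v2 f p + 'D_v1 ('D_v1 f) p / 2)| <= e * (s * s).
Proof.
move=> oD [C1f C2f] Dp e0.
have e30 : 0 < e / 3 by rewrite divr_gt0.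
have [d1 d10 D1] := open_norm oD Dp.
have [d2 d20 D2] := C1_on_cts v2 C1f Dp e30.
have [d3 d30 D3] := C1_on_cts v1 (C2f v1) Dp e30.
pose d := Num.min d1 (Num.min d2 d3); have d0 : 0 < d by rewrite !lt_min d10 d20.
pose M := `|v1| + `|v2| + 1; have M0 : 0 < M by rewrite /M ltr_wpDl// addr_ge0.
exists (Num.min 1 (d / M)); first by rewrite lt_min ltr01 divr_gt0.
move=> s /andP[s0]; rewrite lt_min => /andP[s1 sd].
have small a b : `|a| <= s -> `|b| <= s * s -> `|p + a *: v1 + b *: v2 - p| < d.
  move=> sh th.
  have -> : p + a *: v1 + b *: v2 - p = a *: v1 + b *: v2 by rewrite -(addrA p) [p + _]addrC addrK.
  apply: (le_lt_trans (ler_normD _ _)); rewrite !normrZ.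
  have : `|a| * `|v1| + `|b| * `|v2| <= s * M.
    have := ler_wpM2r (normr_ge0 v1) sh; have bs : `|b| <= s by nra.
    have := ler_wpM2r (normr_ge0 v2) bs.
    rewrite /M; nra.
  move=> /le_lt_trans; apply; by rewrite -ltr_pdivlMr.
have sm1 a b : `|a| <= s -> `|b| <= s * s -> D (p + a *: v1 + b *: v2).
  by move=> sh th; apply: D1; apply: lt_le_trans (small _ _ sh th) _; rewrite ge_min lexx.
have sm2 a b : `|a| <= s -> `|b| <= s * s -> `|'D_v2 f (p + a *: v1 + b *: v2) - 'D_v2 f p| < e / 3.
  by move=> sh th; apply: D2; apply: lt_le_trans (small _ _ sh th) _; rewrite !ge_min lexx orbT.
have sm3 a : `|a| <= s -> `|'D_v1 ('D_v1 f) (p + a *: v1) - 'D_v1 ('D_v1 f) p| < e / 3.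
  move=> sh; apply: D3; have := @small a 0 sh; rewrite scale0r addr0 normr0 mulr_ge0// => /(_ isT) /lt_le_trans; apply.
  by rewrite !ge_min lexx !orbT.
have sm4 a : `|a| <= s -> D (p + a *: v1).
  by move=> sh; have := @sm1 a 0 sh; rewrite scale0r addr0 normr0 mulr_ge0// => /(_ isT).
have ss0 : 0 <= s * s by rewrite mulr_ge0.
have ns : `|s| = s by rewrite ger0_norm.
have nss : `|s * s| = s * s by rewrite ger0_norm.
have [b] := @mvt_line V f (p + s *: v1) v2 (s * s)
  (fun b bs => C1_on_drv C1f (sm1 s b (eq_ind_r (fun z => z <= s) (lexx s) ns) (eq_rect _ (fun z => `|b| <= z) bs _ nss))).
rewrite nss => bs E2.
pose A := 'D_v1 f p; pose B := 'D_v1 ('D_v1 f) p.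
pose F t := f (p + t *: v1) - t * A - t * t * (B / 2).
have dF (t : R) : `|t| <= s -> is_derive t 1 F ('D_v1 f (p + t *: v1) - A - t * B).
  move=> ts; have h := derivable_line (C1_on_drv C1f (sm4 _ ts)).
  have -> : F = (fun t => f (p + t *: v1)) - (fun t => t * A + t * t * (B / 2)).
    by apply/funext => x; rewrite /F -addrA -opprD.
  apply: is_derive_eq (is_deriveB h (is_derive_quad _ _ _)) _.
  by rewrite opprD addrA mulrA -mulr_natr mulfVK ?pnatr_eq0.
have ab (t : R) : t \in `[0, s] -> `|t| <= s.
  by rewrite in_itv /= => /andP[? ?]; rewrite ger0_norm.
have [||t /ab ts] := @MVT_segment R F (fun t => 'D_v1 f (p + t *: v1) - A - t * B) 0 s s0.
- move=> x; rewrite in_itv /= => /andP[x0 xs]; apply: dF; rewrite gtr0_norm//; exact: ltW.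
- apply: derivable_within_continuous => x /ab /dF dFx; exact: ex_derive.
rewrite /F scale0r !mul0r !addr0 !subr0 => E1.
have [c] := @mvt_line V ('D_v1 f) p v1 t (fun c ct => C1_on_drv (C2f v1) (sm4 c (le_trans ct ts))).
move=> ct Ec.
have h3 := sm3 c (le_trans ct ts).
have h2 := sm2 s b (eq_ind_r (fun z => z <= s) (lexx s) ns) bs.
exact: taylor2_arith s0 ts E2 E1 Ec h2 h3.
Qed.

End Normed.

(** * Dot product and sup norm *)

Section Vectors.
Context {R : realType} {n : nat}.
Local Notation X := 'rV[R]_n.
Implicit Types a b c : X.

Lemma dotpE a b : dotp a b = \sum_i a 0 i * b 0 i.
Proof. by rewrite /dotp mxE; apply: eq_bigr => i _; rewrite mxE. Qed.

Lemma dotpC a b : dotp a b = dotp b a.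
Proof. by rewrite !dotpE; apply: eq_bigr => i _; rewrite mulrC. Qed.

Lemma dotpDl a b c : dotp (a + b) c = dotp a c + dotp b c.
Proof. by rewrite /dotp mulmxDl mxE. Qed.
Lemma dotpZl k a b : dotp (k *: a) b = k * dotp a b.
Proof. by rewrite /dotp -scalemxAl mxE. Qed.
Lemma dotpNl a b : dotp (- a) b = - dotp a b.
Proof. by rewrite /dotp mulNmx mxE. Qed.
Lemma dotpBl a b c : dotp (a - b) c = dotp a c - dotp b c.
Proof. by rewrite dotpDl dotpNl. Qed.
Lemma dotpDr a b c : dotp c (a + b) = dotp c a + dotp c b.
Proof. by rewrite dotpC dotpDl !(dotpC c). Qed.
Lemma dotpZr k a b : dotp b (k *: a) = k * dotp b a.
Proof. by rewrite dotpC dotpZl (dotpC b). Qed.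
Lemma dotpNr a b : dotp b (- a) = - dotp b a.
Proof. by rewrite dotpC dotpNl (dotpC b). Qed.
Lemma dotpBr a b c : dotp c (a - b) = dotp c a - dotp c b.
Proof. by rewrite dotpDr dotpNr. Qed.
Lemma dotp0l a : dotp 0 a = 0.
Proof. by rewrite /dotp mul0mx mxE. Qed.
Lemma dotp0r a : dotp a 0 = 0.
Proof. by rewrite dotpC dotp0l. Qed.

Lemma dotp_mulmx (M : 'M[R]_n) a b : dotp (a *m M) b = dotp a (b *m M^T).
Proof. by rewrite /dotp trmx_mul trmxK mulmxA. Qed.

Lemma coord_le_norm a i : `|a 0 i| <= `|a|.
Proof.
rewrite [leRHS]/Num.norm /= mx_normrE; apply/bigmax_geP; right.
by exists (0, i).
Qed.

Lemma norm_le_coord a (e : R) : 0 <= e -> (forall i, `|a 0 i| <= e) -> `|a| <= e.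
Proof.
move=> e0 h; rewrite /Num.norm /= mx_normrE; apply/bigmax_leP; split => //.
by move=> [i j] _ /=; rewrite ord1.
Qed.

Lemma dotp_le a b : `|dotp a b| <= n%:R * `|a| * `|b|.
Proof.
rewrite dotpE; apply: le_trans (ler_norm_sum _ _ _) _.
apply: le_trans (ler_sum _ (_ : forall i, true -> _ <= `|a| * `|b|)) _.
  by move=> i _; rewrite normrM; apply: ler_pM => //; exact: coord_le_norm.
by rewrite sumr_const card_ord -[leLHS]mulr_natl mulrA.
Qed.

Lemma dotp_ge0 a : 0 <= dotp a a.
Proof. by rewrite dotpE; apply: sumr_ge0 => i _; rewrite -expr2 sqr_ge0. Qed.

Lemma norm_le_dotp a : `|a| * `|a| <= dotp a a.
Proof.
have h i : `|a 0 i| * `|a 0 i| <= dotp a a.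
  rewrite dotpE (bigD1 i) //= -normrM ger0_norm -?expr2 ?sqr_ge0// lerDl.
  by apply: sumr_ge0 => j _; rewrite -expr2 sqr_ge0.
have : `|a| <= Num.sqrt (dotp a a).
  apply: norm_le_coord; first exact: sqrtr_ge0.
  move=> i; rewrite -[leLHS]ger0_norm// -sqrtr_sqr ler_sqrt ?dotp_ge0//.
  by rewrite expr2 h.
move=> h2; apply: le_trans (ler_pM _ _ h2 h2) _ => //.
by rewrite -expr2 sqr_sqrtr// dotp_ge0.
Qed.

Lemma dotp_eq0 a : dotp a a = 0 -> a = 0.
Proof.
move=> h; apply/eqP; rewrite -normr_le0.
by have := norm_le_dotp a; rewrite h -expr2 => h2; rewrite normr_le0 -normr_eq0 -sqrf_eq0 eq_le h2 sqr_ge0.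
Qed.

Lemma dotp_gt0 a : a != 0 -> 0 < dotp a a.
Proof. by move=> a0; rewrite lt_neqAle dotp_ge0 eq_sym andbT; apply: contra_neq a0 => /dotp_eq0. Qed.

Lemma dotp_orth_span a b : (forall c, dotp c b = 0 -> dotp a c = 0) ->
  exists k : R, a = k *: b.
Proof.
have [->|b0] := eqVneq b 0.
  move=> h; exists 0; rewrite scaler0; apply: dotp_eq0; apply: h; exact: dotp0r.
move=> h; exists (dotp a b / dotp b b); set k := _ / _; set c := a - k *: b.
have bb : dotp b b != 0 by rewrite gt_eqF// dotp_gt0.
have cb : dotp c b = 0 by rewrite dotpBl dotpZl divfK// subrr.
apply/eqP; rewrite -subr_eq0; apply/eqP; apply: dotp_eq0; rewrite -/c.
by rewrite {1}/c dotpBl (h _ cb) dotpZl dotpC cb mulr0 subr0.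
Qed.

End Vectors.

(** * Strict differentiability in the variables (x, y, z) *)

Section Triples.
Context {R : realType} {n : nat}.
Local Notation X := 'rV[R]_n.
Local Notation XYZ := (X * X * R)%type.
Implicit Types (w k v : XYZ).

Lemma norm2E (V W : normedModType R) (w : V * W) : `|w| = Num.max `|w.1| `|w.2|.
Proof. exact: prod_normE. Qed.

Lemma norm3E w : `|w| = Num.max (Num.max `|w.1.1| `|w.1.2|) `|w.2|.
Proof. exact (etrans (norm2E w) (congr1 (fun z => Num.max z `|w.2|) (norm2E w.1))). Qed.

Lemma norm3_le w (e : R) : `|w| <= e <-> [/\ `|w.1.1| <= e, `|w.1.2| <= e & `|w.2| <= e].
Proof.
rewrite norm3E !ge_max; split.
  by move=> /andP[/andP[]].
by move=> [-> -> ->].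
Qed.

Lemma norm3_lt w (e : R) : `|w| < e <-> [/\ `|w.1.1| < e, `|w.1.2| < e & `|w.2| < e].
Proof.
rewrite norm3E !gt_max; split.
  by move=> /andP[/andP[]].
by move=> [-> -> ->].
Qed.

Definition lin3 (a b : X) (c : R) k : R := dotp a k.1.1 + dotp b k.1.2 + c * k.2.

Lemma lin3Z a b c s k : lin3 a b c (s *: k) = s * lin3 a b c k.
Proof.
rewrite /lin3 (_ : (s *: k).1.1 = s *: k.1.1)// (_ : (s *: k).1.2 = s *: k.1.2)//.
by rewrite (_ : (s *: k).2 = s * k.2)// !dotpZr [c * _]mulrCA !mulrDr.
Qed.

Definition grad_lin (f : XYZ -> R) w : XYZ -> R := lin3 (g_x f w) (g_y f w) (g_z f w).

Lemma telescope_increment (y0 y1 y2 s a z z0 : R) : y1 - y0 = a * z ->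
  y2 - y0 - (a * z0 + s) = (y2 - y1 - s) + a * (z - z0).
Proof. by rewrite mulrBr => <-; ring. Qed.

(** Continuous partial derivatives give strict differentiability: the increment is made along one
    direction of the list at a time, each by the mean value theorem. The base point [p] is left free
    so that the induction can start from the point already displaced. *)
Lemma strict_diff_seq (V : normedModType R) (D : set V) (f : V -> R) (p0 : V)
    (I : Type) (r : seq I) (v : I -> V) (phi : I -> V -> R) :
  open D -> C1_on D f -> D p0 -> (forall i (k : V), `|phi i k| <= `|k|) ->
  forall e : R, 0 < e -> exists2 d : R, 0 < d & forall p (k : V), `|p - p0| < d -> `|k| < d ->
   `|f (p + \sum_(i <- r) phi i k *: v i) - f p
      - \sum_(i <- r) phi i k * 'D_(v i) f p0| <= e * `|k|.
Proof.
move=> oD C1f Dp0 phik; elim: r => [|i0 r IH] e e0.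
  exists 1 => // p k _ _; rewrite !big_nil addr0 subrr subr0 normr0 mulr_ge0 //; exact: ltW.
have e20 : 0 < e / 2 by rewrite divr_gt0.
have [d1 d10 D1] := IH _ e20.
have [d2 d20 D2] := open_norm oD Dp0.
have [d3 d30 D3] := C1_on_cts (v i0) C1f Dp0 e20.
pose d := Num.min d1 (Num.min d2 d3); have d0 : 0 < d by rewrite !lt_min d10 d20.
pose M := 2 + `|v i0|; have M0 : 0 < M by rewrite /M ltr_wpDr.
exists (d / M); first by rewrite divr_gt0.
move=> p k pd kd; rewrite !big_cons /=.
have small (s : R) : `|s| <= `|k| -> `|p + s *: v i0 - p0| < d.
  move=> sk; rewrite addrAC; apply: (le_lt_trans (ler_normD _ _)); rewrite normrZ.
  have h1 := ler_wpM2r (normr_ge0 (v i0)) sk.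
  have : `|k| * M < d by rewrite -ltr_pdivlMr.
  have : `|p - p0| * M < d by rewrite -ltr_pdivlMr.
  rewrite /M; move: h1 (normr_ge0 (v i0)) (normr_ge0 (p - p0)) (normr_ge0 k).
  clear; move: `|s| `|v i0| `|p - p0| `|k| => a1 a2 a3 a4; nra.
have kd1 : `|k| < d.
  apply: lt_le_trans kd _; rewrite ler_pdivrMr// /M.
  by move: (normr_ge0 (v i0)) d0; clear; move: `|v i0| d => a b; nra.
have smd s : `|s| <= `|k| -> [/\ `|p + s *: v i0 - p0| < d1, `|p + s *: v i0 - p0| < d2 & `|p + s *: v i0 - p0| < d3].
  by move=> /small; rewrite !lt_min => /and3P[].
have smD s : `|s| <= `|phi i0 k| -> D (p + s *: v i0).
  by move=> /le_trans/(_ (phik _ _))/smd[_ /D2].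
have [s sk Es] := @mvt_line R V f p (v i0) (phi i0 k) (fun s sk => C1_on_drv C1f (smD s sk)).
have [_ _ /D3 h3] := smd _ (le_trans sk (phik _ _)).
have [h4 _ _] := smd _ (phik i0 k).
have kd1' : `|k| < d1 by move: kd1; rewrite lt_min => /andP[].
have := D1 _ _ h4 kd1'.
rewrite [p + (_ + _)]addrA.
move: Es h3; set Y1 := f (p + phi i0 k *: v i0); set Y2 := f (_ + _).
set S := \sum_(j <- r) _ * _; set Z := 'D_(v i0) f (_ + _); set Z0 := 'D_(v i0) f p0.
move=> Es h3 h5.
have -> : Y2 - f p - (phi i0 k * Z0 + S) = (Y2 - Y1 - S) + phi i0 k * (Z - Z0).
  exact: telescope_increment Es.
apply: le_trans (ler_normD _ _) _; rewrite [e](splitr e) mulrDl; apply: lerD => //.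
by rewrite normrM mulrC; apply: ler_pM => //; exact: ltW.
Qed.

Let ndir := ('I_n + 'I_n + unit)%type.
Let vdir (i : ndir) : XYZ := match i with inl (inl i) => dir_x i | inl (inr i) => dir_y i | inr _ => dir_z end.
Let cdir (i : ndir) (k : XYZ) : R := match i with inl (inl i) => k.1.1 0 i | inl (inr i) => k.1.2 0 i | inr _ => k.2 end.
Let rdir : seq ndir := [seq inl (inl i) | i <- index_enum 'I_n] ++ [seq inl (inr i) | i <- index_enum 'I_n] ++ [:: inr tt].

Lemma sum3 k : k = \sum_i k.1.1 0 i *: dir_x i + (\sum_i k.1.2 0 i *: dir_y i + k.2 *: dir_z).
Proof.
have Sx (a : X) : \sum_i a 0 i *: dir_x i = (a, 0, 0) :> XYZ.
  rewrite {2}(row_sum_delta a) (big_morph (fun x : X => (x, 0, 0) : XYZ) (id1 := 0) (op1 := +%R)) //.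
    by apply: eq_bigr => i _; congr (_, _, _); rewrite /= ?scaler0 ?mulr0.
  by move=> x y; congr (_, _, _); rewrite /= addr0.
have Sy (a : X) : \sum_i a 0 i *: dir_y i = (0, a, 0) :> XYZ.
  rewrite {2}(row_sum_delta a) (big_morph (fun x : X => (0, x, 0) : XYZ) (id1 := 0) (op1 := +%R)) //.
    by apply: eq_bigr => i _; congr (_, _, _); rewrite /= ?scaler0 ?mulr0.
  by move=> x y; congr (_, _, _); rewrite /= addr0.
rewrite Sx Sy; case: k => [[a b] c] /=; congr (_, _, _) => /=.
- by rewrite scaler0 !addr0.
- by rewrite scaler0 addr0 add0r.
- by rewrite [c *: 1]mulr1 !add0r.
Qed.

Let sum_dlin (D : ndir -> R) k : \sum_(i <- rdir) cdir i k * D i =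
  lin3 (\row_i D (inl (inl i))) (\row_i D (inl (inr i))) (D (inr tt)) k.
Proof.
rewrite /rdir !big_cat !big_map big_seq1 /= addrA /lin3 !dotpE.
congr (_ + _ + _); last by rewrite mulrC.
  by apply: eq_bigr => i _; rewrite mxE mulrC.
by apply: eq_bigr => i _; rewrite mxE mulrC.
Qed.

Lemma strict_diff (D : set XYZ) (f : XYZ -> R) w0 :
  open D -> C1_on D f -> D w0 ->
  forall e : R, 0 < e -> exists2 d : R, 0 < d & forall w w', `|w - w0| < d -> `|w' - w0| < d ->
   `|f w - f w' - grad_lin f w0 (w - w')| <= e * `|w - w'|.
Proof.
move=> oD C1f Dp e e0.
have ck i k : `|cdir i k| <= `|k|.
  have /norm3_le[h1 h2 h3] := lexx `|k|.
  case: i => [[i|i]|[]] //=; apply: le_trans (coord_le_norm _ _) _ => //.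
have [d d0 H] := strict_diff_seq rdir vdir oD C1f Dp ck e0.
exists (d / 2); first by rewrite divr_gt0.
move=> w w' wd wd'.
have wd'2 : `|w' - w0| < d by lra.
have ww : `|w - w'| < d.
  by rewrite -(subrKA w0); apply: le_lt_trans (ler_normD _ _) _; rewrite (distrC w0); lra.
have := H w' (w - w') wd'2 ww.
have -> : \sum_(i <- rdir) cdir i (w - w') *: vdir i = w - w'.
  rewrite /rdir !big_cat !big_map big_seq1 /=; idtac. 
  exact/esym/sum3.
rewrite (sum_dlin (fun i => 'D_(vdir i) f w0)).
by rewrite [w' + _]addrC subrK.
Qed.

(** Reduces every directional derivative to the coordinate ones, which are the only ones recorded in
    the jets. *)
Lemma deriveE3 (D : set XYZ) (f : XYZ -> R) w0 v :
  open D -> C1_on D f -> D w0 -> 'D_v f w0 = grad_lin f w0 v.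
Proof.
move=> oD C1f Dw.
suff : h^-1 *: ((f \o shift w0) (h *: v) - f w0) @[h --> 0^'] --> grad_lin f w0 v by exact: cvg_lim.
apply/cvgrPdist_le => e e0.
pose M := 1 + `|v|; have M0 : 0 < M by rewrite /M ltr_wpDr.
have [d d0 H] := strict_diff oD C1f Dw (divr_gt0 e0 M0).
have dM : 0 < d / M by rewrite divr_gt0.
near=> h.
have h0 : h != 0 by near: h; exact: nbhs_dnbhs_neq.
have hd : `|h| < d / M by near: h; exact: dnbhs0_lt.
have hv : `|h *: v| < d.
  rewrite normrZ; move: hd; rewrite ltr_pdivlMr// /M.
  by apply: le_lt_trans; rewrite ler_wpM2l// lerDr.
have := H (h *: v + w0) w0; rewrite addrK subrr normr0 => /(_ hv d0).
rewrite {1}/grad_lin lin3Z -/(grad_lin f w0 v) => H1.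
have -> : grad_lin f w0 v - h^-1 *: ((f \o shift w0) (h *: v) - f w0) =
    - (h^-1 * (f (h *: v + w0) - f w0 - h * grad_lin f w0 v)).
  by rewrite mulrBr mulKf// opprB.
rewrite normrN normrM normfV ler_pdivrMl ?normr_gt0//; apply: le_trans H1 _.
rewrite normrZ mulrCA ler_wpM2l// mulrAC ler_pdivrMr// /M.
by move: (ltW e0) (normr_ge0 v); move: `|v| => a ? ?; rewrite ler_wpM2l// lerDr.
Unshelve. all: by end_near. Qed.
End Triples.

Section Strict.
Context {R : realType}.

(** Strict differentiability: both points vary near [w0]. Differentiability at [w0] alone would give
    neither the Lipschitz bounds nor the closeness to the identity used for inversion. *)
Definition strict_deriv (V W : normedModType R) (f : V -> W) (L : V -> W) (w0 : V) : Prop :=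
  forall e : R, 0 < e -> exists2 d : R, 0 < d & forall w w', `|w - w0| < d -> `|w' - w0| < d ->
   `|f w - f w' - L (w - w')| <= e * `|w - w'|.

Lemma strict_deriv_rV (V : normedModType R) m (f L : V -> 'rV[R]_m) w0 :
  (forall i, strict_deriv (fun w => f w 0 i) (fun w => L w 0 i) w0) -> strict_deriv f L w0.
Proof.
move=> H e e0.
have /(_ _) := fun i => cid2 (H i e e0); move=> D.
have : \forall w \near w0, forall i, `|w - w0| < projT1 (D i).
  apply: filter_forall => i; apply/near_normP; exists (projT1 (D i)) => //; exact: (projT2 (D i)).1.
move=> /near_normP[d d0 dP]; exists d => // w w' wd wd'.
apply: norm_le_coord; first by rewrite mulr_ge0// ltW.
move=> i; rewrite !mxE; apply: (projT2 (D i)).2; exact: dP.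
Qed.

Lemma cts_mx (V : normedModType R) m p (f : V -> 'M[R]_(m, p)) w0 :
  (forall i j e, 0 < e -> exists2 d : R, 0 < d & forall w, `|w - w0| < d -> `|f w i j - f w0 i j| < e) ->
  {for w0, continuous f}.
Proof.
move=> H; apply/cvg_normP => e e0.
have : \forall w \near w0, forall ij : 'I_m * 'I_p, `|f w ij.1 ij.2 - f w0 ij.1 ij.2| < e / 2.
  apply: filter_forall => ij; apply/near_normP; apply: H; exact: divr_gt0.
move=> /near_normP[d d0 dP]; exists d => // w /dP h.
have : `|f w - f w0| <= e / 2.
  rewrite /Num.norm /= mx_normrE; apply/bigmax_leP; split; first by rewrite divr_ge0// ltW.
  by move=> [i j] _ /=; rewrite !mxE ltW// (h (i, j)).
lra.
Qed.

End Strict.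

(** * Second order jets of g *)

Section Data.
Context {R : realType} {n : nat}.
Local Notation X := 'rV[R]_n.
Local Notation XYZ := (X * X * R)%type.
Implicit Types (w k v : XYZ).

Definition dvec (a b : 'M[R]_n) (c : X) k : X := k.1.1 *m a + k.1.2 *m b + k.2 *: c.

(* Second order jets, abstracted from ['D_v g] so that conversion never unfolds
   a derivative. *)
Record jet (Gamma : set XYZ) (g : XYZ -> R) (gx gy : XYZ -> X) (gz : XYZ -> R)
    (gxx gxy gyy : XYZ -> 'M[R]_n) (gxz gyz : XYZ -> X) (gzz : XYZ -> R) : Prop := Jet {
  jet_open : open Gamma;
  jet_g : forall w, Gamma w -> strict_deriv g (lin3 (gx w) (gy w) (gz w)) w;
  jet_gx : forall w, Gamma w -> strict_deriv gx (dvec (gxx w)^T (gxy w)^T (gxz w)) w;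
  jet_gy : forall w, Gamma w -> strict_deriv gy (dvec (gxy w) (gyy w)^T (gyz w)) w;
  jet_gz : forall w, Gamma w -> strict_deriv gz (lin3 (gxz w) (gyz w) (gzz w)) w;
  jet_taylor : forall w v1 v2 (e : R), Gamma w -> 0 < e ->
    exists2 d, 0 < d & forall s, 0 <= s < d ->
     `|g (w + s *: v1 + (s * s) *: v2) - g w - s * lin3 (gx w) (gy w) (gz w) v1
       - (s * s) * (lin3 (gx w) (gy w) (gz w) v2 +
          lin3 (dvec (gxx w)^T (gxy w)^T (gxz w) v1) (dvec (gxy w) (gyy w)^T (gyz w) v1)
             (lin3 (gxz w) (gyz w) (gzz w) v1) v1 / 2)| <= e * (s * s);
  jet_cxx : forall w, Gamma w -> {for w, continuous gxx};
  jet_cxy : forall w, Gamma w -> {for w, continuous gxy};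
  jet_cyy : forall w, Gamma w -> {for w, continuous gyy};
  jet_cxz : forall w, Gamma w -> {for w, continuous gxz};
  jet_cyz : forall w, Gamma w -> {for w, continuous gyz};
  jet_czz : forall w, Gamma w -> {for w, continuous gzz} }.

Definition g_yy (g : XYZ -> R) w : 'M[R]_n := \matrix_(i, j) 'D_(dir_y j) ('D_(dir_y i) g) w.
Definition g_yz (g : XYZ -> R) w : X := \row_i 'D_dir_z ('D_(dir_y i) g) w.
Definition g_zz (g : XYZ -> R) w : R := 'D_dir_z ('D_dir_z g) w.

Lemma dvec_coord (a b : 'M[R]_n) (c : X) k i :
  (dvec a b c k) 0 i = lin3 (\row_j a j i) (\row_j b j i) (c 0 i) k.
Proof.
rewrite /dvec /lin3 !dotpE !mxE; congr (_ + _ + _); last by rewrite mulrC.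
  by apply: eq_bigr => j _; rewrite !mxE mulrC.
by apply: eq_bigr => j _; rewrite !mxE mulrC.
Qed.

Lemma lin3_eq (a a' b b' : X) (c c' : R) k : a = a' -> b = b' -> c = c' ->
  lin3 a b c k = lin3 a' b' c' k.
Proof. by move=> -> -> ->. Qed.

Lemma dist_eq (a a' b b' e : R) : a = a' -> b = b' -> `|a' - b'| < e -> `|a - b| < e.
Proof. by move=> -> ->. Qed.

Section Concrete.
Variables (Gamma : set XYZ) (g : XYZ -> R).
Hypotheses (oG : open Gamma) (Cg : C2_on Gamma g).

Let sch w v1 v2 : Gamma w -> 'D_v1 ('D_v2 g) w = 'D_v2 ('D_v1 g) w.
Proof. by move=> Gw; exact: schwarz oG Cg Gw. Qed.

Let lin_x w i : Gamma w -> grad_lin ('D_(dir_x i) g) w =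
  (fun k => (dvec (g_xx g w)^T (g_xy g w)^T (g_xz g w) k) 0 i).
Proof.
move=> Gw; apply/funext => k; rewrite dvec_coord /grad_lin; congr (lin3 _ _ _ _).
- by apply/rowP => j; rewrite !mxE.
- by apply/rowP => j; rewrite !mxE.
- by rewrite !mxE.
Qed.

Let lin_y w i : Gamma w -> grad_lin ('D_(dir_y i) g) w =
  (fun k => (dvec (g_xy g w) (g_yy g w)^T (g_yz g w) k) 0 i).
Proof.
move=> Gw; apply/funext => k; rewrite dvec_coord /grad_lin; congr (lin3 _ _ _ _).
- by apply/rowP => j; rewrite !mxE; exact (sch (dir_x j) (dir_y i) Gw).
- by apply/rowP => j; rewrite !mxE.
- by rewrite !mxE.
Qed.

Let lin_z w : Gamma w -> grad_lin ('D_dir_z g) w = lin3 (g_xz g w) (g_yz g w) (g_zz g w).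
Proof.
move=> Gw; rewrite /grad_lin.
have e1 : g_x ('D_dir_z g) w = g_xz g w.
  by apply/rowP => j; rewrite [LHS]mxE [RHS]mxE; exact (sch (dir_x j) dir_z Gw).
have e2 : g_y ('D_dir_z g) w = g_yz g w.
  by apply/rowP => j; rewrite [LHS]mxE [RHS]mxE; exact (sch (dir_y j) dir_z Gw).
exact (f_equal2 (fun a b => lin3 a b (g_zz g w)) e1 e2).
Qed.

(** By Schwarz's theorem one matrix [g_xy] serves in the derivatives of both [g_x] and [g_y], and
    the same for the derivatives involving z; this is what lets the jet be a symmetric quadratic
    form. *)
Lemma concrete_jet :
  jet Gamma g (g_x g) (g_y g) (g_z g) (g_xx g) (g_xy g) (g_yy g) (g_xz g) (g_yz g) (g_zz g).
Proof.
have [C1g C2g] := Cg.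
have c2 w v1 v2 (e : R) : Gamma w -> 0 < e ->
    exists2 d, 0 < d & forall x, `|x - w| < d -> `|'D_v1 ('D_v2 g) x - 'D_v1 ('D_v2 g) w| < e.
  by move=> Gw e0; exact: C1_on_cts (C2g v2) Gw e0.
split; first exact: oG.
- by move=> w Gw; exact: strict_diff oG C1g Gw.
- move=> w Gw; apply: strict_deriv_rV => i; rewrite -lin_x//.
  have -> : (fun w => g_x g w 0 i) = 'D_(dir_x i) g by apply/funext => v; rewrite mxE.
  exact: strict_diff oG (C2g (dir_x i)) Gw.
- move=> w Gw; apply: strict_deriv_rV => i; rewrite -lin_y//.
  have -> : (fun w => g_y g w 0 i) = 'D_(dir_y i) g by apply/funext => v; rewrite mxE.
  exact: strict_diff oG (C2g (dir_y i)) Gw.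
- by move=> w Gw; rewrite -lin_z//; exact: strict_diff oG (C2g dir_z) Gw.
- move=> w v1 v2 e Gw e0.
  have [d d0 H] := taylor2 v1 v2 oG Cg Gw e0; exists d => // s /H.
  rewrite (deriveE3 v1 oG C1g Gw) (deriveE3 v2 oG C1g Gw) (deriveE3 v1 oG (C2g v1) Gw).
  have -> // : grad_lin ('D_v1 g) w v1 = lin3 (dvec (g_xx g w)^T (g_xy g w)^T (g_xz g w) v1)
       (dvec (g_xy g w) (g_yy g w)^T (g_yz g w) v1) (lin3 (g_xz g w) (g_yz g w) (g_zz g w) v1) v1.
  apply: lin3_eq.
  + apply/rowP => i; rewrite [LHS]mxE (sch (dir_x i) v1 Gw) (deriveE3 _ oG (C2g (dir_x i)) Gw).
    by rewrite (congr1 (fun f => f v1) (lin_x i Gw)).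
  + apply/rowP => i; rewrite [LHS]mxE (sch (dir_y i) v1 Gw) (deriveE3 _ oG (C2g (dir_y i)) Gw).
    by rewrite (congr1 (fun f => f v1) (lin_y i Gw)).
  + rewrite /g_z (sch dir_z v1 Gw) (deriveE3 _ oG (C2g dir_z) Gw).
    by rewrite (congr1 (fun f => f v1) (lin_z Gw)).
- move=> w Gw; apply: cts_mx => i j e e0; have [d d0 H] := c2 w (dir_x j) (dir_x i) e Gw e0.
  have E y : g_xx g y i j = 'D_(dir_x j) ('D_(dir_x i) g) y by rewrite [LHS]mxE.
  by exists d; [exact: d0 | move=> x xd; exact (dist_eq (E x) (E w) (H x xd))].
- move=> w Gw; apply: cts_mx => i j e e0; have [d d0 H] := c2 w (dir_y j) (dir_x i) e Gw e0.
  have E y : g_xy g y i j = 'D_(dir_y j) ('D_(dir_x i) g) y by rewrite [LHS]mxE.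
  by exists d; [exact: d0 | move=> x xd; exact (dist_eq (E x) (E w) (H x xd))].
- move=> w Gw; apply: cts_mx => i j e e0; have [d d0 H] := c2 w (dir_y j) (dir_y i) e Gw e0.
  have E y : g_yy g y i j = 'D_(dir_y j) ('D_(dir_y i) g) y by rewrite [LHS]mxE.
  by exists d; [exact: d0 | move=> x xd; exact (dist_eq (E x) (E w) (H x xd))].
- move=> w Gw; apply: cts_mx => i j e e0; have [d d0 H] := c2 w dir_z (dir_x j) e Gw e0.
  have E y : g_xz g y i j = 'D_dir_z ('D_(dir_x j) g) y by rewrite [LHS]mxE.
  by exists d; [exact: d0 | move=> x xd; exact (dist_eq (E x) (E w) (H x xd))].
- move=> w Gw; apply: cts_mx => i j e e0; have [d d0 H] := c2 w dir_z (dir_y j) e Gw e0.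
  have E y : g_yz g y i j = 'D_dir_z ('D_(dir_y j) g) y by rewrite [LHS]mxE.
  by exists d; [exact: d0 | move=> x xd; exact (dist_eq (E x) (E w) (H x xd))].
- by move=> w Gw; apply/cvg_normP => e e0; exact: c2.
Qed.

End Concrete.
End Data.

(** * Local inversion *)

Section Topo.
Context {R : realType}.

Lemma within_normP (V W : normedModType R) (A : set V) (f : V -> W) :
  (forall a, A a -> forall e : R, 0 < e -> exists2 d : R, 0 < d &
     forall x, A x -> `|x - a| < d -> `|f x - f a| < e) ->
  {within A, continuous f}.
Proof.
move=> H; apply/subspace_continuousP => a Aa; apply/cvgrPdist_lt => e /(H _ Aa)[d d0 D].
rewrite near_withinE; apply/near_normP; exists d => // x xd Ax.
by rewrite distrC; apply: D.
Qed.

Lemma compact_min (V : normedModType R) (A : set V) (f : V -> R) :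
  A !=set0 -> compact A ->
  (forall a, A a -> forall e : R, 0 < e -> exists2 d : R, 0 < d &
     forall x, A x -> `|x - a| < d -> `|f x - f a| < e) ->
  exists2 c, A c & forall x, A x -> f c <= f x.
Proof.
move=> A0 cA H; have [c cA' cmin] := compact_EVT_min A0 cA (within_normP H).
exists c; first by rewrite inE in cA'.
by move=> x Ax; apply: cmin; rewrite inE.
Qed.

(** A quantitative inverse function theorem, obtained by minimising [|Psi v - q|] over the compact
    ball: a positive minimum could be lowered by a step towards [q]. *)
Lemma surj_ball (W : normedModType R) (Psi : W -> W) (v0 : W) (r : R) :
  0 < r -> compact [set v | `|v - v0| <= r] ->
  (forall v v', `|v - v0| <= r -> `|v' - v0| <= r -> `|Psi v - Psi v' - (v - v')| <= `|v - v'| / 2) ->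
  forall q, `|q - Psi v0| <= r / 8 -> exists2 v, `|v - v0| <= r & Psi v = q.
Proof.
move=> r0 cB H q qr.
have rv0 : `|v0 - v0| <= r by rewrite subrr normr0 ltW.
pose m v := `|Psi v - q|.
have lip v v' : `|v - v0| <= r -> `|v' - v0| <= r -> `|m v - m v'| <= 2 * `|v - v'|.
  move=> h h'; apply: le_trans (ler_dist_dist _ _) _.
  have -> : Psi v - q - (Psi v' - q) = (Psi v - Psi v' - (v - v')) + (v - v').
    by rewrite subrK opprB subrKA.
  apply: le_trans (ler_normD _ _) _; have := H _ _ h h'.
  by have := normr_ge0 (v - v'); lra.
have [||v vr vmin] := @compact_min W _ m _ cB.
- by exists v0.
- move=> a ar e e0; exists (e / 2); first by rewrite divr_gt0.
  move=> x xr xa; apply: le_lt_trans (lip _ _ xr ar) _; lra.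
exists v => //; apply/eqP; rewrite -subr_eq0 -normr_le0 leNgt; apply/negP => mv.
have mv0 : m v <= r / 8.
  by apply: le_trans (vmin _ rv0) _; rewrite /m distrC.
(* The minimiser stays at half the radius: half of [|v - v0|] is absorbed by the closeness to the
   identity, and the two terms [r / 8] bound the rest. This leaves room for the step below. *)
have vr2 : `|v - v0| <= r / 2.
  have h1 := H _ _ vr rv0.
  have h2 : `|v - v0| <= `|Psi v - Psi v0 - (v - v0)| + `|Psi v - Psi v0|.
    by rewrite -[leLHS]normrN -{1}[- (v - v0)](addrK (Psi v - Psi v0)) [- _ + _]addrC; apply: ler_normB.
  have h3 : `|Psi v - Psi v0| <= m v + r / 8.
    by rewrite -(subrKA q); apply: le_trans (ler_normD _ _) _; rewrite lerD2l.
  lra.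
(* A damped Newton step: it multiplies the residual by at most [1 - s / 2], and the bound on [s]
   keeps it inside the ball. *)
pose s := Num.min 1 (r / 2 / m v).
have s0 : 0 < s by rewrite lt_min ltr01 !divr_gt0.
have s1 : s <= 1 by rewrite ge_min lexx.
have sm : s * m v <= r / 2.
  by rewrite -ler_pdivlMr// ge_min lexx orbT.
pose v' := v - s *: (Psi v - q).
have v'v : v' - v = - (s *: (Psi v - q)) by rewrite /v' addrAC subrr add0r.
have nv'v : `|v' - v| = s * m v by rewrite v'v normrN normrZ gtr0_norm.
have v'r : `|v' - v0| <= r.
  by rewrite -(subrKA v); apply: le_trans (ler_normD _ _) _; rewrite nv'v; lra.
have := vmin _ v'r; rewrite leNgt => /negP; apply.
have h := H _ _ v'r vr; rewrite nv'v in h.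
have -> : m v' = `|(Psi v' - Psi v - (v' - v)) + (1 - s) *: (Psi v - q)|.
  rewrite /m v'v opprK scalerBl scale1r; congr `|_|.
  by rewrite -[RHS]addrA [s *: _ + _]addrCA subrr addr0 subrKA.
apply: le_lt_trans (ler_normD _ _) _; rewrite normrZ ger0_norm ?subr_ge0//.
have : 0 < s * m v by rewrite mulr_gt0.
rewrite -/(m v) mulrBl mul1r; lra.
Qed.

Lemma compact_rV_ball n (a : 'rV[R]_n) (r : R) : compact [set v | `|v - a| <= r].
Proof.
apply: bounded_closed_compact.
- exists (r + `|a|); split; first exact: num_real.
  move=> M rM v /= vr; apply: le_trans (ltW rM).
  by rewrite -[v](subrK a); apply: le_trans (ler_normD _ _) _; rewrite lerD2r.
- have -> : [set v | `|v - a| <= r] = (fun v : 'rV[R]_n => `|v - a|) @^-1` [set x | x <= r] by [].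
  apply: preimage_closed; last exact: closed_le.
  move=> v _; apply/cvg_normP => e e0; exists e => // x; apply: le_lt_trans.
  by apply: le_trans (ler_dist_dist _ _) _; rewrite opprB subrKA.
Qed.

Lemma compact_pair_ball n (a : 'rV[R]_n * R) (r : R) : compact [set v | `|v - a| <= r].
Proof.
have -> : [set v : 'rV[R]_n * R | `|v - a| <= r] = [set v | `|v - a.1| <= r] `*` [set v | `|v - a.2| <= r].
  by apply/seteqP; split => v /=; rewrite norm2E ge_max => /andP.
apply: compact_setX; first exact: compact_rV_ball.
have -> : [set v : R | `|v - a.2| <= r] = `[a.2 - r, a.2 + r]%classic.
  by apply/seteqP; split => v /=; rewrite in_itv /= ler_distl.
exact: segment_compact.
Qed.

Lemma mulmx_norm n (a : 'rV[R]_n) (M : 'M[R]_n) : `|a *m M| <= n%:R * `|a| * `|M|.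
Proof.
apply: norm_le_coord; first by rewrite !mulr_ge0.
move=> i; rewrite mxE; apply: le_trans (ler_norm_sum _ _ _) _.
apply: le_trans (ler_sum _ (_ : forall i, true -> _ <= `|a| * `|M|)) _.
  move=> j _; rewrite normrM; apply: ler_pM => //; first exact: coord_le_norm.
  by rewrite [leRHS]/Num.norm /= mx_normrE; apply/bigmax_geP; right; exists (j, i).
by rewrite sumr_const card_ord -[leLHS]mulr_natl mulrA.
Qed.

End Topo.

(** * Abstract generating data and inversion of Q *)

Section Gen.
Context {R : realType} {n : nat}.
Local Notation X := 'rV[R]_n.
Local Notation XYZ := (X * X * R)%type.

(* [w = (x, Y(x,t,p), Z(x,t,p))] *)
Definition Sol (D : set XYZ) (g : XYZ -> R) (gx : XYZ -> X) x t p (w : XYZ) : Prop :=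
  [/\ D w, w.1.1 = x, g w = t & gx w = p].

(** The conditions are phrased through solutions [w] rather than through the functions [Y] and [Z],
    so that no junk value can occur and A3w becomes a plain inequality between three solutions. *)
Record gdata := GData {
  dom : set XYZ;
  gf : XYZ -> R;
  gfx : XYZ -> X;
  gfy : XYZ -> X;
  gfz : XYZ -> R;
  gfxx : XYZ -> 'M[R]_n;
  gfxy : XYZ -> 'M[R]_n;
  gfyy : XYZ -> 'M[R]_n;
  gfxz : XYZ -> X;
  gfyz : XYZ -> X;
  gfzz : XYZ -> R;
  gjet : jet dom gf gfx gfy gfz gfxx gfxy gfyy gfxz gfyz gfzz;
  gfz_lt0 : forall w, dom w -> gfz w < 0;
  gE_unit : forall w, dom w -> gfxy w - (gfz w)^-1 *: ((gfxz w)^T *m gfy w) \in unitmx;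
  gsol_unique : forall x t p w w', Sol dom gf gfx x t p w -> Sol dom gf gfx x t p w' -> w = w';
  gQ_inj : forall x x' y z, dom (x, y, z) -> dom (x', y, z) ->
    - (gfz (x, y, z))^-1 *: gfy (x, y, z) = - (gfz (x', y, z))^-1 *: gfy (x', y, z) -> x = x';
  gA3w : forall (xi x : X) (t : R) (p q : X),
    (forall s : R, 0 <= s <= 1 -> exists w, Sol dom gf gfx x t ((1 - s) *: p + s *: q) w) ->
    dotp (q - p) xi = 0 ->
    forall (s : R) wp wq ws, 0 <= s <= 1 -> Sol dom gf gfx x t p wp ->
      Sol dom gf gfx x t q wq -> Sol dom gf gfx x t ((1 - s) *: p + s *: q) ws ->
      dotp (xi *m gfxx ws) xi <=
        (1 - s) * dotp (xi *m gfxx wp) xi + s * dotp (xi *m gfxx wq) xi }.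

Variable G : gdata.
Implicit Types (x y p q : X) (t z : R) (w : XYZ).

Definition gE w : 'M[R]_n := gfxy G w - (gfz G w)^-1 *: ((gfxz G w)^T *m gfy G w).
Definition gQ w : X := - (gfz G w)^-1 *: gfy G w.
Definition gsol x t p w : Prop := Sol (dom G) (gf G) (gfx G) x t p w.
(** A denominator-free form of the equation Q(w) = q. Its derivative in x at a point where Q = q is
    exactly E. *)
Definition gPhi q w : X := gfy G w + gfz G w *: q.

Lemma gfz_neq0 w : dom G w -> gfz G w != 0.
Proof. by move=> /gfz_lt0; case: ltgtP. Qed.

Lemma gPhi_eq0 q w : dom G w -> (gPhi q w = 0) <-> (gQ w = q).
Proof.
move=> Gw; have z0 := gfz_neq0 Gw; rewrite /gPhi /gQ; split.
  move=> /eqP; rewrite addrC addr_eq0 => /eqP h; apply: (scalerI z0).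
  by rewrite h scaleNr scalerN scalerA divff// scale1r.
by move=> <-; rewrite scaleNr scalerN scalerA divff// scale1r subrr.
Qed.

Lemma gQP w : dom G w -> gfy G w = - (gfz G w) *: gQ w.
Proof.
move=> Gw; have := (gPhi_eq0 (gQ w) Gw).2 erefl; rewrite /gPhi => /eqP.
by rewrite addr_eq0 => /eqP ->; rewrite scaleNr.
Qed.

Lemma vec_gE a w : dom G w ->
  a *m gE w = a *m gfxy G w + dotp (gfxz G w) a *: gQ w.
Proof.
move=> Gw; rewrite /gE mulmxBr -scalemxAr mulmxA /gQ.
have -> : a *m (gfxz G w)^T = (dotp (gfxz G w) a)%:M.
  by apply/matrixP => i j; rewrite !ord1 dotpC /dotp !mxE eqxx mulr1n; apply: eq_bigr => k _; rewrite mxE.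
by rewrite mul_scalar_mx scaleNr scalerN !scalerA mulrC.
Qed.

Definition same_yz w w' := w.1.2 = w'.1.2 /\ w.2 = w'.2.

Lemma same_yz_sub w w' : same_yz w w' -> w - w' = (w.1.1 - w'.1.1, 0, 0).
Proof.
case: w w' => [[x y] z] [[x' y'] z'] [/= -> ->].
by apply/pair_equal_spec; split; [apply/pair_equal_spec; split|] => //=; exact: subrr.
Qed.

Lemma norm_x (a : X) : `|(a, 0, 0) : XYZ| = `|a|.
Proof. by rewrite norm3E /= !normr0 !max_l. Qed.

Lemma gPhi_increment (Y1 Y2 M q Q : X) (z1 z2 b : R) :
  Y1 + z1 *: q - (Y2 + z2 *: q) - (M + b *: Q) =
  (Y1 - Y2 - M) + ((z1 - z2 - b) *: q + b *: (q - Q)).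
Proof. by apply/rowP => i; rewrite !mxE; ring. Qed.

Lemma lin3_bound (a b : X) (c : R) (k : XYZ) :
  `|lin3 a b c k| <= (n%:R * `|a| + n%:R * `|b| + `|c|) * `|k|.
Proof.
have /norm3_le[h1 h2 h3] := lexx `|k|; rewrite /lin3.
apply: le_trans (ler_normD _ _) _; apply: le_trans (lerD (ler_normD _ _) (lexx _)) _.
rewrite !mulrDl normrM; apply: lerD; [apply: lerD|].
- by apply: le_trans (dotp_le _ _) _; rewrite ler_wpM2l// mulr_ge0.
- by apply: le_trans (dotp_le _ _) _; rewrite ler_wpM2l// mulr_ge0.
- by rewrite ler_wpM2l.
Qed.

Lemma dvec_bound (a b : 'M[R]_n) (c : X) (k : XYZ) :
  `|dvec a b c k| <= (n%:R * `|a| + n%:R * `|b| + `|c|) * `|k|.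
Proof.
have /norm3_le[h1 h2 h3] := lexx `|k|; rewrite /dvec.
apply: le_trans (ler_normD _ _) _; apply: le_trans (lerD (ler_normD _ _) (lexx _)) _.
rewrite !mulrDl normrZ [`|k.2| * _]mulrC; apply: lerD; [apply: lerD|].
- by apply: le_trans (mulmx_norm _ _) _; rewrite mulrAC ler_wpM2l// mulr_ge0.
- by apply: le_trans (mulmx_norm _ _) _; rewrite mulrAC ler_wpM2l// mulr_ge0.
- by rewrite ler_wpM2l.
Qed.

Definition lip_near (W : normedModType R) (f : XYZ -> W) w0 : Prop :=
  exists2 C : R, 0 < C & exists2 d : R, 0 < d & forall w w', `|w - w0| < d -> `|w' - w0| < d ->
    `|f w - f w'| <= C * `|w - w'|.

Lemma strict_lip (W : normedModType R) (f L : XYZ -> W) w0 (c : R) :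
  strict_deriv f L w0 -> (forall k, `|L k| <= c * `|k|) -> 0 <= c -> lip_near f w0.
Proof.
move=> sd hL c0; exists (1 + c); first by rewrite ltr_wpDr.
have [d d0 D] := sd 1 ltr01; exists d => // w w' wd wd'.
rewrite -(subrK (L (w - w')) (f w - f w')); apply: le_trans (ler_normD _ _) _.
by rewrite mulrDl; apply: lerD; [exact: D|exact: hL].
Qed.

Lemma lip_near_cts (W : normedModType R) (f : XYZ -> W) w0 : lip_near f w0 ->
  forall e : R, 0 < e -> exists2 d : R, 0 < d & forall w, `|w - w0| < d -> `|f w - f w0| < e.
Proof.
move=> [C C0 [d d0 D]] e e0; exists (Num.min d (e / C)); first by rewrite lt_min d0 divr_gt0.
move=> w; rewrite lt_min => /andP[wd we].
have := D w w0 wd; rewrite subrr normr0 => /(_ d0) /le_lt_trans; apply.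
by rewrite mulrC -ltr_pdivlMr.
Qed.

Lemma gf_lip w : dom G w -> lip_near (gf G) w.
Proof. by move=> Gw; apply: strict_lip (jet_g (gjet G) Gw) (lin3_bound _ _ _) _; rewrite !addr_ge0// mulr_ge0. Qed.
Lemma gfx_lip w : dom G w -> lip_near (gfx G) w.
Proof. by move=> Gw; apply: strict_lip (jet_gx (gjet G) Gw) (dvec_bound _ _ _) _; rewrite !addr_ge0// mulr_ge0. Qed.
Lemma gfy_lip w : dom G w -> lip_near (gfy G) w.
Proof. by move=> Gw; apply: strict_lip (jet_gy (gjet G) Gw) (dvec_bound _ _ _) _; rewrite !addr_ge0// mulr_ge0. Qed.
Lemma gfz_lip w : dom G w -> lip_near (gfz G) w.
Proof. by move=> Gw; apply: strict_lip (jet_gz (gjet G) Gw) (lin3_bound _ _ _) _; rewrite !addr_ge0// mulr_ge0. Qed.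

Lemma gPhi_small w0 : dom G w0 -> forall e : R, 0 < e -> exists2 d : R, 0 < d &
  forall w q, `|w - w0| < d -> `|q - gQ w0| < d -> `|gPhi q w| < e.
Proof.
move=> Gw e e0.
have [C1 C10 [d1 d10 D1]] := gfy_lip Gw; have [C2 C20 [d2 d20 D2]] := gfz_lip Gw.
pose K := C1 + C2 * (`|gQ w0| + 1) + `|gfz G w0|.
have K0 : 0 < K by rewrite /K ltr_wpDr// addr_gt0// mulr_gt0// ltr_wpDl.
pose d := Num.min 1 (Num.min (e / K) (Num.min d1 d2)).
have d0 : 0 < d by rewrite !lt_min ltr01 d10 d20 divr_gt0.
exists d => // w q wd qd.
have -> : gPhi q w = (gfy G w - gfy G w0) + ((gfz G w - gfz G w0) *: q + gfz G w0 *: (q - gQ w0)).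
  have := (gPhi_eq0 (gQ w0) Gw).2 erefl; rewrite /gPhi => h.
  rewrite -[LHS]subr0 -h; move: (gfy G w) (gfy G w0) (gfz G w) (gfz G w0) (gQ w0).
  by clear=> *; apply/rowP => i; rewrite !mxE; ring.
have [wd1 wd2] : `|w - w0| < d1 /\ `|w - w0| < d2.
  by move: wd; rewrite !lt_min => /and4P[].
have q1 : `|q| <= `|gQ w0| + 1.
  rewrite -[q](subrK (gQ w0)); apply: le_trans (ler_normD _ _) _; rewrite addrC lerD2l ltW//.
  by move: qd; rewrite !lt_min => /andP[].
have z0 : `|w0 - w0| = 0 by rewrite subrr normr0.
have h1 := D1 w w0 wd1; rewrite z0 in h1; have {}h1 := h1 d10.
have h2 := D2 w w0 wd2; rewrite z0 in h2; have {}h2 := h2 d20.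
apply: le_lt_trans (ler_normD _ _) _; apply: le_lt_trans (lerD h1 (ler_normD _ _)) _.
rewrite !normrZ.
apply: (@le_lt_trans _ _ (C1 * `|w - w0| + (C2 * `|w - w0| * (`|gQ w0| + 1) + `|gfz G w0| * `|q - gQ w0|))).
  by rewrite lerD2l lerD2r; apply: ler_pM.
apply: (@lt_le_trans _ _ (d * K)); last first.
  by rewrite -ler_pdivlMr// !ge_min lexx !orbT.
rewrite addrA (_ : d * K = d * C1 + d * (C2 * (`|gQ w0| + 1)) + d * `|gfz G w0|); last first.
  by rewrite -!mulrDr.
apply: ltr_leD; first apply: ltrD.
- by rewrite mulrC ltr_pM2r.
- by rewrite mulrAC [d * _]mulrC ltr_pM2l// mulr_gt0// ltr_wpDl.
- by rewrite mulrC ler_wpM2r// ltW.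
Qed.

(** Uniform in [q] near Q(w0) and in the common (y, z) of the two points, because Q is inverted
    later at heights that vary. *)
Lemma gPhi_strict w0 : dom G w0 -> forall e : R, 0 < e -> exists2 d : R, 0 < d &
  forall w w' q, `|w - w0| < d -> `|w' - w0| < d -> same_yz w w' -> `|q - gQ w0| < d ->
   `|gPhi q w - gPhi q w' - (w.1.1 - w'.1.1) *m gE w0| <= e * `|w.1.1 - w'.1.1|.
Proof.
move=> Gw e e0; have J := gjet G.
pose C := `|gQ w0| + 2 + n%:R * `|gfxz G w0|.
have C0 : 0 < C by rewrite /C ltr_wpDr ?mulr_ge0// ltr_wpDl.
pose e1 := e / (2 * C); have e10 : 0 < e1 by rewrite divr_gt0// mulr_gt0.
have [d1 d10 D1] := jet_gy J Gw e10.
have [d2 d20 D2] := jet_gz J Gw e10.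
exists (Num.min 1 (Num.min e1 (Num.min d1 d2))); first by rewrite !lt_min ltr01 e10 d10.
move=> w w' q; rewrite !lt_min => /and4P[_ _ w1 w2] /and4P[_ _ w1' w2'] sw /and4P[q1 q2 _ _].
have := D1 _ _ w1 w1'; have := D2 _ _ w2 w2'.
rewrite (same_yz_sub sw) norm_x; set a := w.1.1 - w'.1.1.
rewrite /dvec /lin3 /= mul0mx scale0r !dotp0r mulr0 !addr0 => h2 h1.
rewrite vec_gE// /gPhi.
set Y1 := gfy G w; set Y2 := gfy G w'; set z1 := gfz G w; set z2 := gfz G w'.
set M := a *m _; set b := dotp _ _.
have -> : Y1 + z1 *: q - (Y2 + z2 *: q) - (M + b *: gQ w0) =
  (Y1 - Y2 - M) + ((z1 - z2 - b) *: q + b *: (q - gQ w0)).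
  exact: gPhi_increment.
apply: le_trans (ler_normD _ _) _; apply: le_trans (lerD h1 (ler_normD _ _)) _.
rewrite !normrZ.
have hq : `|q| <= `|gQ w0| + 1.
  by rewrite -[q](subrK (gQ w0)); apply: le_trans (ler_normD _ _) _; rewrite addrC lerD2l ltW.
have hb : `|b| <= n%:R * `|gfxz G w0| * `|a| by exact: dotp_le.
have t1 : `|z1 - z2 - b| * `|q| <= (e1 * `|a|) * (`|gQ w0| + 1) by exact: ler_pM.
have t2 : `|b| * `|q - gQ w0| <= (n%:R * `|gfxz G w0| * `|a|) * e1 by apply: ler_pM => //; exact: ltW.
apply: le_trans (lerD (lexx _) (lerD t1 t2)) _.
have -> : e1 * `|a| + (e1 * `|a| * (`|gQ w0| + 1) + n%:R * `|gfxz G w0| * `|a| * e1) = (e1 * C) * `|a|.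
  by rewrite /C; ring.
rewrite ler_wpM2r// /e1 invfM mulrA divfK ?gt_eqF//; lra.
Qed.

(** After multiplication by the inverse of E, which exists by A2, the map [gPhi q] is close to the
    identity in x and [surj_ball] solves [gPhi q = 0]. The height [z] moves together with [q], which
    later gives the joint continuity of g-segments. *)
Lemma gQ_open w0 : dom G w0 -> forall e : R, 0 < e -> exists2 d : R, 0 < d &
  forall z q, `|z - w0.2| < d -> `|q - gQ w0| < d -> exists x,
    [/\ `|x - w0.1.1| < e, dom G (x, w0.1.2, z) & gQ (x, w0.1.2, z) = q].
Proof.
case: w0 => [[x0 y0] z0] Gw e e0; set w0 := (x0, y0, z0) in Gw *; rewrite /=.
have J := gjet G.
have Eu : gE w0 \in unitmx by exact: gE_unit.
pose N := invmx (gE w0); pose C := n%:R * `|N| + 1.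
have C0 : 0 < C by rewrite /C ltr_wpDl// mulr_ge0.
have e1 : 0 < (2 * C)^-1 by rewrite invr_gt0 mulr_gt0.
have [d1 d10 D1] := gPhi_strict Gw e1.
have [d2 d20 D2] := open_norm (jet_open J) Gw.
pose r := Num.min (e / 2) (Num.min (d1 / 2) (d2 / 2)).
have r0 : 0 < r by rewrite !lt_min !divr_gt0.
have r8 : 0 < r / 8 / C by rewrite !divr_gt0.
have rd1 : r < d1 by apply: le_lt_trans (_ : r <= d1 / 2) _; [rewrite !ge_min lexx !orbT|lra].
have rd2 : r < d2 by apply: le_lt_trans (_ : r <= d2 / 2) _; [rewrite !ge_min lexx !orbT|lra].
have re : r < e by apply: le_lt_trans (_ : r <= e / 2) _; [rewrite !ge_min lexx |lra].
have [d3 d30 D3] := gPhi_small Gw r8.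
exists (Num.min d1 (Num.min d2 (Num.min d3 (d1 / 2)))).
  by rewrite !lt_min d10 d20 d30 divr_gt0.
move=> z q; rewrite !lt_min => /and4P[z1 z2 z3 z4] /and4P[q1 _ q3 _].
have nz x : `|(x, y0, z) - w0| = Num.max `|x - x0| `|z - z0|.
  by rewrite norm3E /= subrr normr0 [Num.max _ 0]max_l.
have NC (a : X) : `|a *m N| <= C * `|a|.
  apply: le_trans (mulmx_norm _ _) _; rewrite mulrAC ler_wpM2r// /C lerDl//.
pose Psi x := gPhi q (x, y0, z) *m N.
have near1 x : `|x - x0| <= r -> `|(x, y0, z) - w0| < d1.
  by move=> xr; rewrite nz gt_max z1 (le_lt_trans xr).
have [||x xr Px] := @surj_ball R X Psi x0 r r0 (@compact_rV_ball R n x0 r) _ 0 _.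
- move=> x x' xr xr'; rewrite /Psi -mulmxBl -[x - x'](mulmxK Eu) -/N -mulmxBl.
  have := D1 _ _ q (near1 _ xr) (near1 _ xr') (conj erefl erefl) q1.
  rewrite /= mulmxK// => h; apply: le_trans (NC _) _.
  apply: le_trans (ler_wpM2l (ltW C0) h) _.
  by rewrite mulrA invfM mulrCA divff ?gt_eqF// mulr1 mulrC.
- rewrite sub0r normrN; apply: le_trans (NC _) _.
  have -> : r / 8 = C * (r / 8 / C) by rewrite [RHS]mulrC divfK// gt_eqF.
  rewrite ler_pM2l//; apply/ltW/D3 => //.
  by rewrite nz subrr normr0 gt_max d30.
have Gx : dom G (x, y0, z) by apply: D2; rewrite nz gt_max z2 (le_lt_trans xr).
exists x; split => //; first exact: le_lt_trans xr re.
apply/(gPhi_eq0 q Gx).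
by rewrite -[LHS](mulmxK (_ : N \in unitmx)) ?unitmx_inv// -/(Psi x) Px mul0mx.
Qed.

End Gen.

(** * Solving for (y, z) with prescribed value and gradient *)

Section Gen2.
Context {R : realType} {n : nat}.
Local Notation X := 'rV[R]_n.
Local Notation XYZ := (X * X * R)%type.
Variable G : @gdata R n.
Implicit Types (x y p q : X) (t z : R) (w : XYZ).

(* Inverse of the derivative of (y, z) |-> (g_x, g) at [w0]. *)
Let L w0 (u : X * R) : X * R :=
  let dy := (u.1 - (u.2 / gfz G w0) *: gfxz G w0) *m invmx (gE G w0)^T in
  (dy, (u.2 - dotp (gfy G w0) dy) / gfz G w0).

Let LB w0 (u v : X * R) : L w0 (u - v) = L w0 u - L w0 v.
Proof.
rewrite /L; set N := invmx _.
have E : ((u - v).1 - ((u - v).2 / gfz G w0) *: gfxz G w0) *m N =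
  (u.1 - (u.2 / gfz G w0) *: gfxz G w0) *m N - (v.1 - (v.2 / gfz G w0) *: gfxz G w0) *m N.
  rewrite -mulmxBl; congr (_ *m _); rewrite (_ : (u - v).1 = u.1 - v.1)// (_ : (u - v).2 = u.2 - v.2)//.
  by move: u.1 u.2 v.1 v.2 => a b c d; apply/rowP => i; rewrite !mxE; ring.
rewrite E; apply/pair_equal_spec; split => //=.
rewrite dotpBr -mulrBl; congr (_ / _).
by do 2!move: (dotp _ _) => ?; move: u.2 v.2 => ? ?; ring.
Qed.

Let Lbound w0 : dom G w0 -> exists2 C : R, 0 < C & forall u, `|L w0 u| <= C * `|u|.
Proof.
move=> Gw; have z0 := gfz_neq0 Gw.
set N := invmx (gE G w0)^T.
pose C1 := n%:R * `|N| * (1 + `|(gfz G w0)^-1| * `|gfxz G w0|).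
have C10 : 0 <= C1 by rewrite /C1 !mulr_ge0// addr_ge0// mulr_ge0.
pose C2 := (1 + n%:R * `|gfy G w0| * C1) * `|(gfz G w0)^-1|.
have C20 : 0 <= C2 by rewrite /C2 mulr_ge0// addr_ge0// !mulr_ge0.
exists (C1 + C2 + 1); first by rewrite ltr_wpDl// addr_ge0.
move=> u; have : `|u| <= `|u| by []. rewrite {1}norm2E ge_max => /andP[u1 u2].
have b1 : `|(L w0 u).1| <= C1 * `|u|.
  rewrite /L /=; apply: le_trans (mulmx_norm _ _) _; rewrite /C1 -!mulrA ler_wpM2l// [leLHS]mulrC.
  rewrite ler_wpM2l// mulrDl mul1r; apply: le_trans (ler_normB _ _) _.
  apply: lerD => //; rewrite normrZ normrM -[leLHS]mulrA [leLHS]mulrC.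
  by rewrite ler_wpM2l// mulr_ge0.
have b2 : `|(L w0 u).2| <= C2 * `|u|.
  rewrite /L /= normrM /C2 [leRHS]mulrAC ler_wpM2r// mulrDl mul1r.
  apply: le_trans (ler_normB _ _) _; apply: lerD => //.
  apply: le_trans (dotp_le _ _) _; rewrite -!mulrA ler_wpM2l// ler_wpM2l//.
  by apply: le_trans b1 _; rewrite /C1 -!mulrA.
rewrite norm2E ge_max; apply/andP; split.
  by apply: le_trans b1 _; rewrite ler_wpM2r// -addrA lerDl addr_ge0.
by apply: le_trans b2 _; rewrite ler_wpM2r// [C1 + _]addrC -addrA lerDl addr_ge0.
Qed.

Let Linv w0 y z : dom G w0 ->
  L w0 (y *m (gfxy G w0)^T + z *: gfxz G w0, dotp (gfy G w0) y + gfz G w0 * z) = (y, z).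
Proof.
move=> Gw; have z0 := gfz_neq0 Gw; have Eu := gE_unit Gw.
have h1 : (L w0 (y *m (gfxy G w0)^T + z *: gfxz G w0, dotp (gfy G w0) y + gfz G w0 * z)).1 = y.
  rewrite /L /= -[RHS](mulmxK (_ : (gE G w0)^T \in unitmx)) ?unitmx_tr//; congr (_ *m _).
  have -> : (gE G w0)^T = (gfxy G w0)^T - (gfz G w0)^-1 *: ((gfy G w0)^T *m gfxz G w0).
    apply/matrixP => i j; rewrite !mxE; congr (_ - _ * _).
    by apply: eq_bigr => k _; rewrite !mxE mulrC.
  rewrite mulmxBr -scalemxAr mulmxA.
  have -> : y *m (gfy G w0)^T = (dotp (gfy G w0) y)%:M.
    by apply/matrixP => i j; rewrite !ord1 dotpC /dotp !mxE eqxx mulr1n; apply: eq_bigr => k _; rewrite mxE.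
  rewrite mul_scalar_mx scalerA mulrDl mulrAC divff// mul1r scalerDl opprD addrACA subrr addr0.
  by rewrite mulrC.
apply/pair_equal_spec; split => //.
move: h1; rewrite /L /= => ->.
by rewrite addrC addKr mulrAC divff// mul1r.
Qed.

Let Linj w0 u v : dom G w0 -> L w0 u = L w0 v -> u = v.
Proof.
move=> Gw e; have z0 := gfz_neq0 Gw; have Eu := gE_unit Gw.
have H0 : L w0 (u - v) = 0 by rewrite LB e subrr.
apply/eqP; rewrite -subr_eq0; apply/eqP; move: H0.
move: (u - v) => {e} k; rewrite /L => h.
have h1 := congr1 fst h; have h2 := congr1 snd h; rewrite /= in h1 h2.
rewrite h1 dotp0r subr0 in h2.
have k2 : k.2 = 0.
  by have /eqP := h2; rewrite mulf_eq0 invr_eq0 (negbTE z0) orbF => /eqP.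
have k1 : k.1 = 0.
  move: h1; rewrite k2 mul0r scale0r subr0 => h1.
  by rewrite -[k.1](mulmxKV (_ : (gE G w0)^T \in unitmx)) ?unitmx_tr// h1 mul0mx.
by rewrite (surjective_pairing k) k1 k2.
Qed.

(** E is, up to transposition, the Schur complement of [g_z] in the derivative of (y, z) |-> (g_x,
    g), so A2 makes that derivative invertible and [surj_ball] applies. Together with uniqueness
    this is the continuity of (x, u, p) |-> (Y, Z). *)
Lemma gsol_open w0 : dom G w0 -> forall e : R, 0 < e -> exists2 d : R, 0 < d &
  forall x t p, `|x - w0.1.1| < d -> `|t - gf G w0| < d -> `|p - gfx G w0| < d ->
   exists2 w, gsol G x t p w & `|w - w0| < e.
Proof.
case: w0 => [[x0 y0] z0] Gw e e0; set w0 := (x0, y0, z0) in Gw *; rewrite /=.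
have J := gjet G.
have [C C0 HC] := Lbound Gw.
have e1 : 0 < (2 * C)^-1 by rewrite invr_gt0 mulr_gt0.
have [d1 d10 D1] := jet_g J Gw e1.
have [d2 d20 D2] := jet_gx J Gw e1.
have [d3 d30 D3] := open_norm (jet_open J) Gw.
pose m := Num.min (Num.min e d1) (Num.min d2 d3).
have m0 : 0 < m by rewrite !lt_min e0 d10 d20.
pose r := m / 2; have r0 : 0 < r by rewrite divr_gt0.
have rm : r < m by rewrite /r; lra.
have [re rd1 rd2 rd3] : [/\ r < e, r < d1, r < d2 & r < d3].
  by move: rm; rewrite /m !lt_min => /andP[/andP[-> ->] /andP[-> ->]].
have r8 : 0 < r / 8 / C / 2 by rewrite !divr_gt0.
have [d4 d40 D4] := lip_near_cts (gf_lip Gw) r8.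
have [d5 d50 D5] := lip_near_cts (gfx_lip Gw) r8.
exists (Num.min r (Num.min (r / 8 / C / 2) (Num.min d4 d5))).
  by rewrite !lt_min r0 r8 d40.
move=> x t p; rewrite !lt_min => /and4P[x1 _ x3 x4] /and4P[_ t2 _ _] /and4P[_ p2 _ _].
pose W (v : X * R) : XYZ := (x, v.1, v.2).
pose v0 : X * R := (y0, z0).
have nW v : `|W v - w0| = Num.max `|x - x0| `|v - v0| by rewrite norm3E norm2E /= maxA.
have nWW v v' : `|W v - W v'| = `|v - v'|.
  by rewrite norm3E norm2E /= subrr normr0 (max_r (normr_ge0 _)).
have Wr v : `|v - v0| <= r -> `|W v - w0| <= r.
  by move=> vr; rewrite nW ge_max (ltW x1).
pose F v := (gfx G (W v), gf G (W v)).
pose Psi v := L w0 (F v).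
have [||v vr Pv] := @surj_ball R _ Psi v0 r r0 (@compact_pair_ball R n v0 r) _ (L w0 (p, t)) _.
- move=> v v' vr vr'.
  have h1 := D1 _ _ (le_lt_trans (Wr _ vr) rd1) (le_lt_trans (Wr _ vr') rd1).
  have h2 := D2 _ _ (le_lt_trans (Wr _ vr) rd2) (le_lt_trans (Wr _ vr') rd2).
  rewrite nWW in h1 h2.
  rewrite /Psi -{1}[v - v']/((v - v').1, (v - v').2) -(Linv _ _ Gw) -!LB.
  set k := (X in L w0 X); apply: le_trans (HC k) _; rewrite {}/k.
  have -> : `|v - v'| / 2 = C * ((2 * C)^-1 * `|v - v'|).
    by rewrite invfM; move: (gt_eqF C0) => /negbT ? ; field.
  rewrite ler_pM2l// norm2E ge_max; apply/andP; split.
    by move: h2; rewrite /dvec /= subrr mul0mx add0r.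
  by move: h1; rewrite /lin3 /= subrr dotp0r add0r.
- rewrite /Psi -LB; apply: le_trans (HC _) _.
  have -> : r / 8 = C * (r / 8 / C) by rewrite [RHS]mulrC divfK// gt_eqF.
  have xx : `|W v0 - w0| = `|x - x0| by rewrite nW subrr normr0 max_l.
  rewrite ler_pM2l// norm2E ge_max /=; apply/andP; split.
    rewrite -(subrKA (gfx G w0)); apply: le_trans (ler_normD _ _) _.
    have := D5 (W v0); rewrite xx => /(_ x4); rewrite distrC; lra.
  rewrite -(subrKA (gf G w0)); apply: le_trans (ler_normD _ _) _.
  by have := D4 (W v0); rewrite xx => /(_ x3); rewrite distrC; lra.
have /(Linj Gw)[Fx Ft] := Pv.
exists (W v); last by apply: le_lt_trans (Wr _ vr) re.
by split => //; apply: D3; apply: le_lt_trans (Wr _ vr) rd3.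
Qed.

(* Quantitative injectivity of the derivative of (y, z) |-> (g_x, g). *)
Lemma yz_deriv_bound w0 : dom G w0 -> exists2 C : R, 0 < C & forall (b : X) (zeta e : R),
  `|b *m (gfxy G w0)^T + zeta *: gfxz G w0| <= e -> `|dotp (gfy G w0) b + gfz G w0 * zeta| <= e ->
  `|b| <= C * e /\ `|zeta| <= C * e.
Proof.
move=> Gw; have [C C0 HC] := Lbound Gw; exists C => // b zeta e h1 h2.
have := HC (b *m (gfxy G w0)^T + zeta *: gfxz G w0, dotp (gfy G w0) b + gfz G w0 * zeta).
rewrite Linv// !norm2E /= ge_max => /andP[k1 k2].
have hm : C * Num.max `|b *m (gfxy G w0)^T + zeta *: gfxz G w0| `|dotp (gfy G w0) b + gfz G w0 * zeta| <= C * e.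
  by rewrite ler_pM2l// ge_max h1.
by split; [exact: le_trans k1 hm|exact: le_trans k2 hm].
Qed.

End Gen2.

(** * Second order comparison at a contact *)

Section Test.
Context {R : realType} {n : nat}.
Local Notation X := 'rV[R]_n.
Local Notation XYZ := (X * X * R)%type.
Variable G : @gdata R n.
Implicit Types (x y p q b tau v : X) (t z : R) (w : XYZ).

Definition jet1 w : XYZ -> R := lin3 (gfx G w) (gfy G w) (gfz G w).
Definition jet2 w (k : XYZ) : R :=
  lin3 (dvec (gfxx G w)^T (gfxy G w)^T (gfxz G w) k) (dvec (gfxy G w) (gfyy G w)^T (gfyz G w) k)
    (lin3 (gfxz G w) (gfyz G w) (gfzz G w) k) k.

(** As the values and the first order terms agree, the comparison survives division by [s^2];
    one-sided parameters are therefore enough. *)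
Lemma second_order_le w w' (v1 v2 u1 u2 : XYZ) (s0 : R) :
  dom G w -> dom G w' -> 0 < s0 -> gf G w = gf G w' -> jet1 w v1 = jet1 w' u1 ->
  (forall s, 0 <= s < s0 -> gf G (w + s *: v1 + (s * s) *: v2) <= gf G (w' + s *: u1 + (s * s) *: u2)) ->
  jet1 w v2 + jet2 w v1 / 2 <= jet1 w' u2 + jet2 w' u1 / 2.
Proof.
move=> Gw Gw' s00 e0 e1 H; apply/ler_addgt0Pl => e ep.
have e2 : 0 < e / 2 by rewrite divr_gt0.
have [d d0 D] := jet_taylor (gjet G) v1 v2 Gw e2.
have [d' d'0 D'] := jet_taylor (gjet G) u1 u2 Gw' e2.
pose m := Num.min s0 (Num.min d d'); have m0 : 0 < m by rewrite !lt_min s00 d0.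
pose s := m / 2; have sp : 0 < s by rewrite divr_gt0.
have sm : s < m by rewrite /s; lra.
have [s1 s2 s3] : [/\ 0 <= s < s0, 0 <= s < d & 0 <= s < d'].
  by move: sm; rewrite /m !lt_min (ltW sp) => /and3P[].
move: (D s s2) (D' s s3) (H s s1); rewrite -!/(jet1 _ _) -!/(jet2 _ _) e0 e1.
have ss : 0 < s * s by rewrite mulr_gt0.
move: (gf G w') (gf G (w + _ + _)) (gf G (w' + _ + _)) (jet1 w' u1) (jet1 w v2) (jet1 w' u2) (jet2 w v1) (jet2 w' u1).
move=> a a1 a2 b c c' h h'; rewrite !ler_norml => /andP[k1 _] /andP[_ k2] k3.
rewrite -(ler_pM2l ss); lra.
Qed.

Lemma jet1E w tau b (zeta : R) : jet1 w (tau, b, zeta) = dotp (gfx G w) tau + dotp (gfy G w) b + gfz G w * zeta.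
Proof. by []. Qed.

Lemma jet2_x w tau : jet2 w (tau, 0, 0) = dotp (tau *m gfxx G w) tau.
Proof.
rewrite /jet2 /dvec /lin3 /= !mul0mx !scale0r !addr0 !dotp0r !mulr0 !addr0.
by rewrite dotpC [RHS]dotp_mulmx.
Qed.

Lemma jet2_full w tau b (zeta : R) : jet2 w (tau, b, zeta) =
  dotp (tau *m gfxx G w) tau + 2 * (dotp (tau *m gfxy G w) b + zeta * dotp (gfxz G w) tau)
  + (dotp (b *m (gfyy G w)^T + zeta *: gfyz G w) b + (dotp (gfyz G w) b + gfzz G w * zeta) * zeta).
Proof.
rewrite /jet2 /dvec /lin3 /= !dotpDl !dotpZl.
have -> : dotp (tau *m (gfxx G w)^T) tau = dotp (tau *m gfxx G w) tau.
  by rewrite dotp_mulmx trmxK dotpC.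
have -> : dotp (b *m (gfxy G w)^T) tau = dotp (tau *m gfxy G w) b.
  by rewrite dotp_mulmx trmxK dotpC.
move: (dotp (tau *m gfxx G w) tau) (dotp (tau *m gfxy G w) b) (dotp (gfxz G w) tau).
move: (dotp (b *m _) b) (dotp (gfyz G w) b) (gfzz G w) => *; ring.
Qed.

(** The increment [zeta = Q . b] makes (b, zeta) tangent to the level of g at fixed x, so [b] does
    not enter at first order. At second order it meets [tau] only through [tau E b], the other terms
    in [b] being quadratic. *)
Lemma second_order_test (xt yt yb : X) (zt zb : R) tau v b (K s0 : R) :
  let w := (xt, yt, zt) in let w' := (xt, yb, zb) in
  let zeta := dotp (gQ G w) b in
  dom G w -> dom G w' -> 0 < s0 -> gf G w = gf G w' -> dotp (gfx G w - gfx G w') tau = 0 ->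
  (forall s, 0 <= s < s0 ->
     gf G (xt + s *: tau - (s * s / 2) *: v, yt + s *: b, zt + s * zeta + s * s * (K * dotp b b))
     <= gf G (xt + s *: tau - (s * s / 2) *: v, yb, zb)) ->
  2 * dotp (tau *m gE G w) b <=
    - (dotp (tau *m gfxx G w) tau - dotp (tau *m gfxx G w') tau - dotp v (gfx G w - gfx G w'))
    - 2 * gfz G w * K * dotp b b
    - (dotp (b *m (gfyy G w)^T + zeta *: gfyz G w) b + (dotp (gfyz G w) b + gfzz G w * zeta) * zeta).
Proof.
move=> w w' zeta Gw Gw' s00 e0 e1 H.
pose v1 : XYZ := (tau, b, zeta); pose v2 : XYZ := (- (2^-1 *: v), 0, K * dotp b b).
pose u1 : XYZ := (tau, 0, 0); pose u2 : XYZ := (- (2^-1 *: v), 0, 0).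
have E1 : jet1 w v1 = jet1 w' u1.
  rewrite !jet1E dotp0r mulr0 !addr0 (gQP Gw) dotpZl mulNr -addrA addNr addr0.
  by apply/eqP; rewrite -subr_eq0 -dotpBl e1.
have := @second_order_le w w' v1 v2 u1 u2 s0 Gw Gw' s00 e0 E1.
have P1 s : w + s *: v1 + (s * s) *: v2 = (xt + s *: tau - (s * s / 2) *: v, yt + s *: b, zt + s * zeta + s * s * (K * dotp b b)).
  congr (_, _, _) => /=.
  - by rewrite scalerN scalerA.
  - by rewrite scaler0 addr0.
have P2 s : w' + s *: u1 + (s * s) *: u2 = (xt + s *: tau - (s * s / 2) *: v, yb, zb).
  congr (_, _, _) => /=.
  - by rewrite scalerN scalerA.
  - by rewrite !scaler0 !addr0.
  - by rewrite !scaler0 !addr0.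
have H' s : 0 <= s < s0 -> gf G (w + s *: v1 + (s * s) *: v2) <= gf G (w' + s *: u1 + (s * s) *: u2).
  by move=> /H; rewrite P1 P2.
move=> /(_ H'); rewrite !jet1E jet2_x jet2_full !dotp0r !mulr0 !addr0.
rewrite vec_gE// (dotpDl (tau *m _)) (dotpZl (dotp (gfxz G w) tau)) -/zeta (dotpBr _ _ v).
rewrite !dotpNr !dotpZr [dotp (gfx G w) v]dotpC [dotp (gfx G w') v]dotpC.
set r1 := dotp (b *m _ + _) b + _; move: r1 => r1.
move: (dotp (tau *m gfxx G w) tau) (dotp (tau *m gfxy G w) b) (dotp (gfxz G w) tau).
move: (dotp (tau *m gfxx G w') tau) (dotp v (gfx G w)) (dotp v (gfx G w')) (dotp b b) (gfz G w).
move=> r2 r3 r4 r5 r6 r7 r8 r9; move: (zeta) => ? h; have := h; clear; lra.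
Qed.

End Test.

Section Mvt.
Context {R : realType} {n : nat}.
Local Notation X := 'rV[R]_n.
Local Notation XYZ := (X * X * R)%type.
Variable G : @gdata R n.
Implicit Types (x y p q b tau v : X) (t z : R) (w : XYZ).

Lemma jet1Z w (a : R) k : jet1 G w (a *: k) = a * jet1 G w k.
Proof. exact: lin3Z. Qed.

Lemma gf_deriv w k (s : R) : dom G (w + s *: k) ->
  is_derive s 1 (fun s : R => gf G (w + s *: k)) (jet1 G (w + s *: k) k).
Proof.
move=> Gw; set w0 := w + s *: k in Gw *.
have H : h^-1 *: (((fun s : R => gf G (w + s *: k)) \o shift s) (h *: (1 : R)) - gf G w0) @[h --> 0^'] --> jet1 G w0 k.
  apply/cvgrPdist_le => e e0.
  pose M := 1 + `|k|; have M0 : 0 < M by rewrite /M ltr_wpDr.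
  have [d d0 D] := jet_g (gjet G) Gw (divr_gt0 e0 M0).
  have dM : 0 < d / M by rewrite divr_gt0.
  near=> h.
  have h0 : h != 0 by near: h; exact: nbhs_dnbhs_neq.
  have hd : `|h| < d / M by near: h; exact: dnbhs0_lt.
  have hv : `|h *: k| < d.
    rewrite normrZ; move: hd; rewrite ltr_pdivlMr// /M.
    by apply: le_lt_trans; rewrite ler_wpM2l// lerDr.
  have Eh : w + (h *: (1 : R) + s) *: k = h *: k + w0.
    by rewrite [h *: 1]mulr1 scalerDl addrCA.
  have := D (h *: k + w0) w0; rewrite addrK subrr normr0 => /(_ hv d0).
  rewrite -/(jet1 G w0 _) jet1Z /= Eh => H1.
  have -> : jet1 G w0 k - h^-1 *: (gf G (h *: k + w0) - gf G w0) =
    - (h^-1 * (gf G (h *: k + w0) - gf G w0 - h * jet1 G w0 k)).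
    by rewrite mulrBr mulKf// opprB.
  rewrite normrN normrM normfV ler_pdivrMl ?normr_gt0//; apply: le_trans H1 _.
  rewrite normrZ mulrCA ler_wpM2l// mulrAC ler_pdivrMr// /M.
  by rewrite ler_wpM2l ?lerDr// ltW.
split; first by apply/cvg_ex; exists (jet1 G w0 k); exact: H.
exact: cvg_lim H.
Unshelve. all: by end_near. Qed.

Lemma gf_mvt w k : (forall s : R, 0 <= s <= 1 -> dom G (w + s *: k)) ->
  exists2 s : R, 0 <= s <= 1 & gf G (w + k) - gf G w = jet1 G (w + s *: k) k.
Proof.
move=> H; have dF (s : R) : 0 <= s <= 1 -> is_derive s 1 (fun s : R => gf G (w + s *: k)) (jet1 G (w + s *: k) k).
  by move=> /H; exact: gf_deriv.
have [||s sI] := @MVT_segment R (fun s : R => gf G (w + s *: k)) (fun s => jet1 G (w + s *: k) k) 0 1 ler01.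
- by move=> x; rewrite in_itv /= => /andP[x0 x1]; apply: dF; rewrite !ltW.
- apply: derivable_within_continuous => x; rewrite in_itv /= => /dF dFx; exact: ex_derive.
rewrite scale1r scale0r addr0 subr0 mulr1 => E; by exists s.
Qed.

Lemma first_order_arith (a a1 a2 b b1 A B s e : R) : 0 < s -> s * (2 + `|A| + `|B|) < e ->
  `|a1 - a - s * b1 - s * s * A| <= 1 * (s * s) ->
  `|a2 - a - s * b - s * s * B| <= 1 * (s * s) -> a1 <= a2 -> b1 <= e + b.
Proof.
move=> sp se; have := ler_norm (- A); have := ler_norm B.
rewrite !normrN; move: `|A| `|B| se => nA nB s2 h1 h2.
rewrite !mul1r !ler_norml => /andP[k1 _] /andP[_ k2] k3.
have : s * b1 <= s * (e + b); last by rewrite ler_pM2l.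
have j1 : s * s * - A <= s * s * nA by rewrite ler_pM2l ?mulr_gt0.
have j2 : s * s * B <= s * s * nB by rewrite ler_pM2l ?mulr_gt0.
have j3 : s * (s * (2 + nA + nB)) <= s * e by rewrite ler_pM2l// ltW.
lra.
Qed.

Lemma first_order_le w w' (v1 v2 u1 u2 : XYZ) (s0 : R) :
  dom G w -> dom G w' -> 0 < s0 -> gf G w = gf G w' ->
  (forall s, 0 <= s < s0 -> gf G (w + s *: v1 + (s * s) *: v2) <= gf G (w' + s *: u1 + (s * s) *: u2)) ->
  jet1 G w v1 <= jet1 G w' u1.
Proof.
move=> Gw Gw' s00 e0 H; apply/ler_addgt0Pl => e ep.
have [d d0 D] := jet_taylor (gjet G) v1 v2 Gw ltr01.
have [d' d'0 D'] := jet_taylor (gjet G) u1 u2 Gw' ltr01.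
set A := jet1 G w v2 + jet2 G w v1 / 2 in D; set B := jet1 G w' u2 + jet2 G w' u1 / 2 in D'.
pose C := 2 + `|A| + `|B|; have C0 : 0 < C by rewrite /C !ltr_wpDr.
pose m := Num.min (Num.min s0 (e / C)) (Num.min d d'); have m0 : 0 < m by rewrite !lt_min s00 d0 d'0 divr_gt0.
pose s := m / 2; have sp : 0 < s by rewrite divr_gt0.
have sm : s < m by rewrite /s; lra.
have [s1 s2 s3 s4] : [/\ 0 <= s < s0, s < e / C, 0 <= s < d & 0 <= s < d'].
  by move: sm; rewrite /m !lt_min (ltW sp) /= => /andP[/andP[-> ->] /andP[-> ->]].
rewrite ltr_pdivlMr// in s2.
move: (D s s3) (D' s s4) (H s s1); rewrite -!/(jet1 _ _ _) -!/(jet2 _ _ _) e0 -/A -/B.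
exact: first_order_arith.
Qed.

Lemma coord_le_mx (m' p' : nat) (M : 'M[R]_(m', p')) i j : `|M i j| <= `|M|.
Proof. by rewrite [leRHS]/Num.norm /= mx_normrE; apply/bigmax_geP; right; exists (i, j). Qed.

Lemma gE_cts w : dom G w -> {for w, continuous (gE G)}.
Proof.
move=> Gw; apply: cts_mx => i j.
have cc (m' p' : nat) (f : XYZ -> 'M[R]_(m', p')) i' j' : {for w, continuous f} -> {for w, continuous (fun w => f w i' j')}.
  move=> /cvg_normP h; apply/cvg_normP => e /h[d d0 D]; exists d => // x /D; apply: le_lt_trans.
  by have := coord_le_mx (f x - f w) i' j'; rewrite !mxE.
have cy : {for w, continuous (gfy G)} by apply/cvg_normP; exact: lip_near_cts (gfy_lip Gw).
have cz : {for w, continuous (gfz G)} by apply/cvg_normP; exact: lip_near_cts (gfz_lip Gw).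
have c1 := cc _ _ _ i j (jet_cxy (gjet G) Gw).
have c2 := cc _ _ _ 0 i (jet_cxz (gjet G) Gw).
have c3 := cc _ _ _ 0 j cy.
have : {for w, continuous (fun w => gfxy G w i j - (gfz G w)^-1 * (gfxz G w 0 i * gfy G w 0 j))}.
  apply: cvgB => //; apply: cvgM; last exact: cvgM.
  by apply: cvgV => //; exact: gfz_neq0.
move=> /cvg_normP h e /h[d d0 D]; exists d => // x /D.
by rewrite /gE !mxE !big_ord_recl !big_ord0 !addr0 !mxE.
Qed.

End Mvt.

(** * Impossibility of a second order touching *)

Section Contra.
Context {R : realType} {n : nat}.
Local Notation X := 'rV[R]_n.
Local Notation XYZ := (X * X * R)%type.
Variable G : @gdata R n.
Implicit Types (x y p q b tau v : X) (t z : R) (w : XYZ).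

Lemma near_bound (V W : normedModType R) (f : V -> W) (w : V) : {for w, continuous f} ->
  \forall x \near w, `|f x| <= `|f w| + 1.
Proof.
move=> /cvg_normP/(_ 1 ltr01)[d d0 D]; apply/near_normP; exists d => // x /D h.
by rewrite -[f x](subrK (f w)) addrC; apply: le_trans (ler_normD _ _) _; rewrite lerD2l ltW.
Qed.

Lemma near_close (V W : normedModType R) (f : V -> W) (w : V) (e : R) : {for w, continuous f} -> 0 < e ->
  \forall x \near w, `|f x - f w| <= e.
Proof. by move=> /cvg_normP h /h[d d0 D]; apply/near_normP; exists d => // x /D /ltW. Qed.

Lemma norm_trmx (M : 'M[R]_n) : `|M^T| <= `|M|.
Proof.
rewrite [leLHS]/Num.norm /= mx_normrE; apply/bigmax_leP; split => //.
by move=> [i j] _ /=; rewrite mxE; exact: coord_le_mx.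
Qed.

Lemma cts_gfy w : dom G w -> {for w, continuous (gfy G)}.
Proof. by move=> Gw; apply/cvg_normP; exact: lip_near_cts (gfy_lip Gw). Qed.
Lemma cts_gfz w : dom G w -> {for w, continuous (gfz G)}.
Proof. by move=> Gw; apply/cvg_normP; exact: lip_near_cts (gfz_lip Gw). Qed.
Lemma cts_gfx w : dom G w -> {for w, continuous (gfx G)}.
Proof. by move=> Gw; apply/cvg_normP; exact: lip_near_cts (gfx_lip Gw). Qed.
Lemma cts_gf w : dom G w -> {for w, continuous (gf G)}.
Proof. by move=> Gw; apply/cvg_normP; exact: lip_near_cts (gf_lip Gw). Qed.

Lemma near_dom w : dom G w -> \forall x \near w, dom G x.
Proof. by move=> Gw; have := jet_open (gjet G); rewrite openE => /(_ _ Gw). Qed.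

Lemma cts_gQ w : dom G w -> {for w, continuous (gQ G)}.
Proof.
move=> Gw; apply: cvgZ; last exact: cts_gfy.
by apply: cvgN; apply: cvgV; [exact: gfz_neq0|exact: cts_gfz].
Qed.

Definition quad3 w b (zeta : R) : R :=
  dotp (b *m (gfyy G w)^T + zeta *: gfyz G w) b + (dotp (gfyz G w) b + gfzz G w * zeta) * zeta.

Lemma quad3_bound w b (zeta B Z Y : R) : `|b| <= B -> `|zeta| <= Z ->
  `|gfyy G w| <= Y -> `|gfyz G w| <= Y -> `|gfzz G w| <= Y ->
  `|quad3 w b zeta| <= n%:R * (n%:R * B * Y + Z * Y) * B + (n%:R * Y * B + Y * Z) * Z.
Proof.
move=> bB zZ h1 h2 h3.
have B0 : 0 <= B := le_trans (normr_ge0 _) bB.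
have Z0 : 0 <= Z := le_trans (normr_ge0 _) zZ.
have Y0 : 0 <= Y := le_trans (normr_ge0 _) h1.
apply: le_trans (ler_normD _ _) _; apply: lerD.
  apply: le_trans (dotp_le _ _) _; apply: ler_pM => //.
  rewrite ler_wpM2l//; apply: le_trans (ler_normD _ _) _; apply: lerD.
    apply: le_trans (mulmx_norm _ _) _; apply: ler_pM; rewrite ?mulr_ge0// ?ler_wpM2l//.
    exact: le_trans (norm_trmx _) h1.
  by rewrite normrZ; apply: ler_pM.
rewrite normrM; apply: ler_pM => //; apply: le_trans (ler_normD _ _) _; apply: lerD.
  by apply: le_trans (dotp_le _ _) _; apply: ler_pM; rewrite ?mulr_ge0// ?ler_wpM2l.
by rewrite normrM; apply: ler_pM.
Qed.

Lemma quad3Z w b (zeta e : R) : quad3 w (e *: b) (e * zeta) = e * e * quad3 w b zeta.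
Proof.
rewrite /quad3 -scalemxAl -scalerA -scalerDr dotpZl !dotpZr.
by move: (dotp (b *m _ + _) b) (dotp (gfyz G w) b) (gfzz G w) => *; ring.
Qed.

Lemma small_step_contra (e0 kap K M A B N del gz : R) : 0 < kap -> 0 <= M -> 1 <= K ->
  e0 = kap / (4 * (M * K + 1)) -> del = e0 * kap / 8 -> kap / 4 <= A ->
  N - gz * K * B <= M * K ->
  2 * (e0 * A) <= del + e0 * e0 * (N - gz * K * B) -> False.
Proof.
move=> k0 M0 K1 ee de kA NM H.
have D0 : 0 < M * K + 1 by rewrite ltr_wpDl// mulr_ge0// (le_trans ler01).
have e00 : 0 < e0 by rewrite ee divr_gt0// mulr_gt0.
have h1 : e0 * (M * K) <= kap / 4.
  rewrite ee mulrAC ler_pdivrMr ?mulr_gt0//.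
  have -> : kap / 4 * (4 * (M * K + 1)) = kap * (M * K + 1) by field.
  by rewrite ler_pM2l// lerDl.
have h2 : e0 * (e0 * (N - gz * K * B)) <= e0 * (kap / 4).
  by rewrite ler_pM2l//; apply: le_trans h1; rewrite ler_pM2l.
have h3 : e0 * (kap / 4) <= e0 * A by rewrite ler_pM2l.
have h4 : 0 < e0 * kap by rewrite mulr_gt0.
rewrite -mulrA in H; rewrite de in H; lra.
Qed.

Lemma quadratic_bound_ge0 (m B Z Y : R) : 0 <= m -> 0 <= B -> 0 <= Z -> 0 <= Y ->
  0 <= m * (m * B * Y + Z * Y) * B + (m * Y * B + Y * Z) * Z.
Proof. by move=> m0 B0 Z0 Y0; rewrite !(addr_ge0, mulr_ge0). Qed.

(** For [b] small along [tau E^-T] the mixed term wins over both [del] and the quadratic terms. The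
    radius [r0] does not depend on [K]; only the tolerance [del] does. *)
Lemma local_contra (xs yb yc tau0 : X) (zb zc : R) :
  dom G (xs, yc, zc) -> tau0 != 0 ->
  exists2 r0 : R, 0 < r0 & forall K : R, 1 <= K -> exists2 del : R, 0 < del &
   forall (xt yt tau v : X) (zt : R),
    let w := (xt, yt, zt) in let w' := (xt, yb, zb) in
    `|w - (xs, yc, zc)| < r0 -> dom G w' -> `|tau - tau0| < r0 ->
    gf G w = gf G w' -> dotp (gfx G w - gfx G w') tau = 0 ->
    - del <= dotp (tau *m gfxx G w) tau - dotp (tau *m gfxx G w') tau - dotp v (gfx G w - gfx G w') ->
    (forall b, exists2 s0 : R, 0 < s0 & forall s, 0 <= s < s0 ->
       gf G (xt + s *: tau - (s * s / 2) *: v, yt + s *: b,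
             zt + s * dotp (gQ G w) b + s * s * (K * dotp b b))
       <= gf G (xt + s *: tau - (s * s / 2) *: v, yb, zb)) -> False.
Proof.
set wc := (xs, yc, zc) => Gc tau00.
have nn : 0 <= n%:R :> R := ler0n _ _.
pose kap := dotp tau0 tau0; have kap0 : 0 < kap by exact: dotp_gt0.
(* With [b1 = tau N0], the product [tau E . b1] equals [|tau|^2] when E is taken at [wc]; [rt] and
   [eE0] bound what is lost by moving away from [tau0] and [wc]. *)
pose N0 := (invmx (gE G wc))^T.
pose T1 := `|tau0| + 1; have T10 : 0 < T1 by rewrite /T1 ltr_wpDl.
pose Bb := n%:R * T1 * `|N0|; have Bb0 : 0 <= Bb := mulr_ge0 (mulr_ge0 nn (ltW T10)) (normr_ge0 N0).
pose Qm := `|gQ G wc| + 1; have Qm0 : 0 <= Qm by rewrite /Qm addr_ge0.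
pose Zz := n%:R * Qm * Bb; have Zz0 : 0 <= Zz := mulr_ge0 (mulr_ge0 nn Qm0) Bb0.
pose Y := Num.max (`|gfyy G wc| + 1) (Num.max (`|gfyz G wc| + 1) (`|gfzz G wc| + 1)).
pose g1 := `|gfz G wc| + 1; have g10 : 0 <= g1 by rewrite /g1 addr_ge0.
have Y0 : 0 <= Y by rewrite /Y le_max addr_ge0.
pose M2 := n%:R * (n%:R * Bb * Y + Zz * Y) * Bb + (n%:R * Y * Bb + Y * Zz) * Zz.
have M20 : 0 <= M2 := quadratic_bound_ge0 nn Bb0 Zz0 Y0.
pose M := 2 * g1 * (n%:R * Bb * Bb) + M2.
have M0 : 0 <= M.
  by apply: addr_ge0 => //; rewrite mulr_ge0//; [rewrite mulr_ge0|exact: mulr_ge0 (mulr_ge0 nn Bb0) Bb0].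
pose cE := n%:R * (n%:R * T1) * Bb + 1; have cE0 : 0 < cE.
  by rewrite ltr_wpDl//; exact: mulr_ge0 (mulr_ge0 nn (mulr_ge0 nn (ltW T10))) Bb0.
have eE0 : 0 < kap / 4 / cE by rewrite !divr_gt0.
have J := gjet G.
have [d1 d10 D1] := (near_normP _ _).1 (filterI (near_dom Gc) (filterI (near_bound (cts_gfz Gc))
  (filterI (near_bound (cts_gQ Gc)) (filterI (near_bound (jet_cyy J Gc))
  (filterI (near_bound (jet_cyz J Gc)) (filterI (near_bound (jet_czz J Gc))
    (near_close (gE_cts Gc) eE0))))))).
pose rt := kap / 2 / (n%:R * (2 * `|tau0| + 1) + 1).
have rt0 : 0 < rt by rewrite !divr_gt0// ltr_wpDl// mulr_ge0// addr_ge0// mulr_ge0.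
exists (Num.min d1 (Num.min 1 rt)); first by rewrite !lt_min d10 ltr01.
(* For [b = e0 b1] the left side of the test is at least [e0 kap / 2]. This [e0] makes the quadratic
   terms at most [e0 kap / 4], and [del] adds [e0 kap / 8]. *)
move=> K K1; pose e0 := kap / (4 * (M * K + 1)); pose del := e0 * kap / 8.
have K0 : 0 <= K by rewrite (le_trans ler01).
have e00 : 0 < e0 by rewrite divr_gt0// mulr_gt0// ltr_wpDl// mulr_ge0.
exists del; first by rewrite divr_gt0// mulr_gt0.
move=> xt yt tau v zt w w'; rewrite !lt_min => /and3P[wd _ _] Gw' /and3P[_ t1 t2] ew eta0 sub H.
have [Gw [bz [bQ [byy [byz [bzz bE]]]]]] := D1 _ wd.
have tT : `|tau| <= T1.
  rewrite /T1 -[tau](subrK tau0) addrC; apply: le_trans (ler_normD _ _) _.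
  by rewrite lerD2l ltW.
pose b1 := tau *m N0.
have b1B : `|b1| <= Bb.
  apply: le_trans (mulmx_norm _ _) _; rewrite /Bb ler_wpM2r// ler_wpM2l//.
pose zeta1 := dotp (gQ G w) b1.
have z1Z : `|zeta1| <= Zz.
  apply: le_trans (dotp_le _ _) _; apply: ler_pM; rewrite ?mulr_ge0// ?ler_wpM2l//.
have [s0 s00 Hs] := H (e0 *: b1).
have := second_order_test Gw Gw' s00 ew eta0 Hs.
rewrite -/w (dotpZr e0 b1 (gQ G w)) -/zeta1 -/(quad3 w _ _) quad3Z !dotpZl !dotpZr.
set A := dotp (tau *m gE G w) b1; set BB := dotp b1 b1.
set SS := _ - _ - dotp v _ in sub *; move=> h.
have BB0 : 0 <= BB by exact: dotp_ge0.
apply: (@small_step_contra e0 kap K M A BB (- quad3 w b1 zeta1) del (2 * gfz G w)) => //.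
- (* dotp (tau E) b1 = |tau|^2 + error *)
  have Eu : gE G wc \in unitmx by exact: gE_unit.
  have -> : A = dotp tau tau + dotp (tau *m (gE G w - gE G wc)) b1.
    rewrite mulmxBr dotpBl addrCA; rewrite -[LHS]addr0; congr (_ + _).
    apply/eqP; rewrite eq_sym subr_eq0 /b1 /N0 -dotp_mulmx -mulmxA mulmxV// mulmx1//.
  have k1 : kap / 2 <= dotp tau tau.
    have -> : dotp tau tau = kap - (dotp (tau0 - tau) tau0 + dotp (tau0 - tau) tau).
      by rewrite /kap !dotpBl (dotpC tau0 tau); ring.
    have : `|dotp (tau0 - tau) tau0 + dotp (tau0 - tau) tau| <= kap / 2.
      apply: le_trans (ler_normD _ _) _; apply: le_trans (lerD (dotp_le _ _) (dotp_le _ _)) _.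
      rewrite -mulrDr distrC mulrAC.
      have q0 : 0 < n%:R * (2 * `|tau0| + 1) + 1 :> R by rewrite ltr_wpDl// mulr_ge0// addr_ge0// mulr_ge0.
      apply: (@le_trans _ _ ((n%:R * (2 * `|tau0| + 1) + 1) * `|tau - tau0|)).
        rewrite ler_wpM2r// ler_wpDr// ler_wpM2l//; move: tT; rewrite /T1; lra.
      by rewrite mulrC -ler_pdivlMr// ltW.
    by rewrite ler_norml => /andP[]; lra.
  have k2 : `|dotp (tau *m (gE G w - gE G wc)) b1| <= kap / 4.
    apply: le_trans (dotp_le _ _) _.
    apply: (@le_trans _ _ (n%:R * (n%:R * T1 * (kap / 4 / cE)) * Bb)).
      apply: ler_pM; rewrite ?mulr_ge0// ler_wpM2l//.
      apply: le_trans (mulmx_norm _ _) _; apply: ler_pM; rewrite ?mulr_ge0// ler_wpM2l//.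
    have -> : n%:R * (n%:R * T1 * (kap / 4 / cE)) * Bb = (cE - 1) * (kap / 4 / cE).
      by rewrite /cE addrK; ring.
    by rewrite mulrBl mul1r [cE * _]mulrC divfK ?gt_eqF// gerBl ltW.
  by move: k2; rewrite ler_norml => /andP[]; lra.
- have q3 := quad3_bound b1B z1Z (le_trans byy (_ : _ <= Y)) (le_trans byz (_ : _ <= Y)) (le_trans bzz (_ : _ <= Y)).
  have {}q3 : - quad3 w b1 zeta1 <= M2.
    apply: le_trans (ler_norm _) _; rewrite normrN; apply: q3; rewrite /Y !le_max lexx ?orbT//.
  have BBn : BB <= n%:R * Bb * Bb.
    apply: le_trans (ler_norm _) _; apply: le_trans (dotp_le _ _) _.
    by apply: ler_pM; rewrite ?mulr_ge0// ler_wpM2l.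
  have h5 : - gfz G w <= g1 by apply: le_trans (ler_norm _) _; rewrite normrN.
  have h6 : - gfz G w * BB <= g1 * (n%:R * Bb * Bb).
    apply: ler_pM => //; rewrite oppr_ge0 ltW//; exact: gfz_lt0.
  have h7 : K * (- gfz G w * BB) <= K * (g1 * (n%:R * Bb * Bb)) by rewrite ler_wpM2l.
  have h8 : M2 <= K * M2 by rewrite -[leLHS]mul1r ler_wpM2r.
  rewrite /M; move: h7 h8 q3; clear; move: (n%:R * Bb * Bb) => u; lra.
- move: h sub; clear; move: (quad3 _ _ _) => u; lra.
Qed.

End Contra.

(** * Decrease in z and growth along tangent directions in y *)

Section Tangent.
Context {R : realType} {n : nat}.
Local Notation X := 'rV[R]_n.
Local Notation XYZ := (X * X * R)%type.
Variable G : @gdata R n.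
Implicit Types (x y p q b tau v : X) (t z : R) (w : XYZ).

Lemma ball_segment (V : normedModType R) (w k c : V) (D s : R) : 0 <= s <= 1 ->
  `|w - c| < D -> `|w + k - c| < D -> `|w + s *: k - c| < D.
Proof.
move=> /andP[s0 s1] h1 h2.
have -> : w + s *: k - c = (1 - s) *: (w - c) + s *: (w + k - c).
  by rewrite [w + k - c]addrAC (scalerDr s) addrA -scalerDl subrK scale1r addrAC.
apply: le_lt_trans (ler_normD _ _) _; rewrite !normrZ (ger0_norm s0) ger0_norm ?subr_ge0//.
have [->|s00] := eqVneq s 0; first by rewrite subr0 mul1r mul0r addr0.
have : s * `|w + k - c| < s * D by rewrite ltr_pM2l// lt_neqAle eq_sym s00.
have : (1 - s) * `|w - c| <= (1 - s) * D by rewrite ler_wpM2l ?subr_ge0// ltW.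
lra.
Qed.

Lemma gf_mono wc (D c : R) : (forall w, `|w - wc| < D -> dom G w /\ gfz G w <= - c) ->
  forall x y z h, 0 <= h -> `|(x, y, z) - wc| < D -> `|(x, y, z + h) - wc| < D ->
    gf G (x, y, z + h) <= gf G (x, y, z) - c * h.
Proof.
move=> H x y z h h0 w1 w2; set w := (x, y, z); pose k : XYZ := (0, 0, h).
have E : (x, y, z + h) = w + k by congr (_, _, _) => /=; rewrite addr0.
rewrite E in w2 *.
have P s : 0 <= s <= 1 -> dom G (w + s *: k) /\ gfz G (w + s *: k) <= - c.
  by move=> s01; apply: H; exact: ball_segment.
have [s s01] := gf_mvt (fun s s01 => (P s s01).1).
rewrite /k jet1E !dotp0r !add0r -/k => Es.
have := ler_wpM2r h0 (P s s01).2; rewrite -Es; lra.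
Qed.

(** Along (0, d, q.d) the derivative of g is [gPhi q . d]; it vanishes at [w'], where q = Q, and is
    Lipschitz, so g can only grow quadratically in [d]. *)
Lemma gf_tangent wc (D C2 C3 Qm : R) (xs y' y : X) (z' : R) :
  (forall w, `|w - wc| < D -> dom G w) ->
  (forall w w', `|w - wc| < D -> `|w' - wc| < D -> `|gfy G w - gfy G w'| <= C2 * `|w - w'|) ->
  (forall w w', `|w - wc| < D -> `|w' - wc| < D -> `|gfz G w - gfz G w'| <= C3 * `|w - w'|) ->
  0 <= C2 -> 0 <= C3 ->
  let w' := (xs, y', z') in let d := y - y' in
  `|gQ G w'| <= Qm -> `|w' - wc| < D -> `|(xs, y, z' + dotp (gQ G w') d) - wc| < D ->
  gf G (xs, y, z' + dotp (gQ G w') d) <= gf G w' + n%:R * ((C2 + C3 * Qm) * (1 + n%:R * Qm)) * dotp d d.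
Proof.
move=> HD H2 H3 C20 C30 w' d qQ w1 w2; set q := gQ G w' in qQ w2 *.
have Qm0 : 0 <= Qm := le_trans (normr_ge0 _) qQ.
pose k : XYZ := (0, d, dotp q d).
have E : (xs, y, z' + dotp q d) = w' + k.
  by congr (_, _, _) => /=; rewrite ?addr0// /d addrC subrK.
rewrite E in w2 *.
have P s : 0 <= s <= 1 -> `|w' + s *: k - wc| < D by move=> s01; exact: ball_segment.
have [s s01] := gf_mvt (fun s s01 => HD _ (P s s01)).
rewrite {2}/k jet1E dotp0r add0r -dotpZl -dotpDl => Es.
rewrite -lerBlDl Es; apply: le_trans (ler_norm _) _; apply: le_trans (dotp_le _ _) _.
have kd : `|k| <= (1 + n%:R * Qm) * `|d|.
  rewrite norm3E /= normr0 (max_r (normr_ge0 d)) ge_max; apply/andP; split.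
    by rewrite mulrDl mul1r lerDl mulr_ge0// mulr_ge0.
  apply: le_trans (dotp_le _ _) _; rewrite ler_wpM2r//.
  by apply: le_trans (_ : n%:R * Qm <= _); rewrite ?ler_wpM2l// lerDr.
set ws := w' + s *: k.
have sk : `|ws - w'| <= `|k|.
  by rewrite /ws addrC addKr normrZ ger0_norm; [rewrite ler_piMl//; case/andP: s01|case/andP: s01].
have ph : `|gfy G ws + gfz G ws *: q| <= (C2 + C3 * Qm) * `|k|.
  have -> : gfy G ws + gfz G ws *: q = (gfy G ws - gfy G w') + (gfz G ws - gfz G w') *: q.
    have := (gPhi_eq0 q (HD _ w1)).2 erefl; rewrite /gPhi => h.
    rewrite -[LHS]subr0 -h; move: (gfy G ws) (gfy G w') (gfz G ws) (gfz G w') => *.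
    by apply/rowP => i; rewrite !mxE; ring.
  apply: le_trans (ler_normD _ _) _; rewrite mulrDl; apply: lerD.
    by apply: le_trans (H2 _ _ (P s s01) w1) _; rewrite ler_wpM2l.
  rewrite normrZ mulrAC; apply: ler_pM => //.
  by apply: le_trans (H3 _ _ (P s s01) w1) _; rewrite ler_wpM2l.
apply: (@le_trans _ _ (n%:R * ((C2 + C3 * Qm) * ((1 + n%:R * Qm) * `|d|)) * `|d|)).
  rewrite ler_wpM2r// ler_wpM2l//; apply: le_trans ph _.
  by rewrite ler_wpM2l// addr_ge0// mulr_ge0.
have -> : n%:R * ((C2 + C3 * Qm) * ((1 + n%:R * Qm) * `|d|)) * `|d| =
  n%:R * ((C2 + C3 * Qm) * (1 + n%:R * Qm)) * (`|d| * `|d|) by ring.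
rewrite ler_wpM2l ?norm_le_dotp//.
by rewrite !(mulr_ge0, addr_ge0).
Qed.

End Tangent.

(** * Comparison along good curves *)

Section Curve.
Context {R : realType} {n : nat}.
Local Notation X := 'rV[R]_n.
Local Notation XYZ := (X * X * R)%type.
Variable G : @gdata R n.
Implicit Types (x y p q b tau v : X) (t z : R) (w : XYZ).

(* [(x, Y, Z)] at [(x, t, p + eta)], where [t] and [p] are the value and the
   gradient of [g(., yb, zb)] at [x]. *)
Definition gW (yb : X) (zb : R) x (eta : X) : XYZ :=
  xget (0, 0, 0) [set w | gsol G x (gf G (x, yb, zb)) (gfx G (x, yb, zb) + eta) w].

Lemma gW_eq yb zb x eta w :
  gsol G x (gf G (x, yb, zb)) (gfx G (x, yb, zb) + eta) w -> gW yb zb x eta = w.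
Proof.
move=> h; apply: gsol_unique (h).
exact: (@xgetPex _ (0, 0, 0) [set w | gsol G x (gf G (x, yb, zb)) (gfx G (x, yb, zb) + eta) w] (ex_intro _ w h)).
Qed.

Definition Fq yb zb x tau eta : R := dotp (tau *m gfxx G (gW yb zb x eta)) tau.

(** A neighbourhood of the segment from 0 to [eta1]: the gradient differences met at contacts are
    only close to a point of the segment, since base point and contact move along the curve. *)
Definition tube (rho : R) (eta1 eta : X) : Prop :=
  exists2 s : R, 0 <= s <= 1 & `|eta - s *: eta1| <= rho.

(* [c] is a C^1, piecewise quadratic curve with velocity [T] issued from [xs]
   whose acceleration [- v] is up to [del] minus a subgradient of the convex
   function [eta |-> A(x, u, p + eta) T . T] on the hyperplane orthogonal to [T]. *)
Record good_curve (xs yb : X) (zb : R) (tau0 eta1 : X) (r V del rho : R)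
    (c T v : R -> X) : Prop := GoodCurve {
  gc_0 : c 0 = xs;
  gc_T0 : T 0 = tau0;
  gc_right : forall t, 0 <= t < r -> exists2 s0 : R, 0 < s0 & forall s, 0 <= s < s0 ->
    c (t + s) = c t + s *: T t - (s * s / 2) *: v t;
  gc_left : forall t, 0 < t <= r -> exists2 s0 : R, 0 < s0 & exists v', forall s, 0 <= s < s0 ->
    c (t - s) = c t - s *: T t - (s * s / 2) *: v';
  gc_lip : forall t t', 0 <= t <= r -> 0 <= t' <= r -> `|c t - c t'| <= V * `|t - t'|;
  gc_T : forall t, 0 <= t <= r -> `|T t - tau0| <= V * t;
  gc_c : forall t, 0 <= t <= r -> `|c t - xs - t *: tau0| <= V * t * t;
  gc_sub : forall t, 0 <= t < r -> forall eta, tube rho eta1 eta -> dotp eta (T t) = 0 ->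
    - del <= Fq yb zb (c t) (T t) eta - Fq yb zb (c t) (T t) 0 - dotp (v t) eta }.

Lemma norm_base (x x' y : X) (z : R) : `|(x, y, z) - (x', y, z)| = `|x - x'|.
Proof. by rewrite norm3E /= !subrr !normr0 !max_l. Qed.

(** In time, the expansions to the right and to the left have opposite velocities, and different
    accelerations do no harm at first order. In y, the choice [b = gPhi qt w] turns the first order
    inequality into [|b|^2 <= 0]. *)
Lemma curve_critical (yb yt tau v v' : X) (zb zt K : R) (c : R -> X) (qt : X) (t0 s0 s1 : R) (xt : X) :
  let w := (xt, yt, zt) in let w' := (xt, yb, zb) in
  dom G w -> dom G w' -> 0 < s0 -> gf G w = gf G w' ->
  (forall s, 0 <= s < s0 -> c (t0 + s) = xt + s *: tau - (s * s / 2) *: v) ->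
  (forall s, 0 <= s < s0 -> c (t0 - s) = xt - s *: tau - (s * s / 2) *: v') ->
  (forall s, 0 <= s < s0 -> gf G (c (t0 + s), yt, zt) <= gf G (c (t0 + s), yb, zb)) ->
  (forall s, 0 <= s < s0 -> gf G (c (t0 - s), yt, zt) <= gf G (c (t0 - s), yb, zb)) ->
  (forall b, exists2 s1 : R, 0 < s1 & forall s, 0 <= s < s1 ->
     gf G (xt, yt + s *: b, zt + s * dotp qt b + s * s * (K * dotp b b)) <= gf G w') ->
  dotp (gfx G w - gfx G w') tau = 0 /\ gQ G w = qt.
Proof.
move=> w w' Gw Gw' s00 e0 Hr Hl Fr Fl Fy; split.
  have P (y : X) (z s : R) (u1 u2 : X) : (xt, y, z) + s *: (u1, 0, 0) + (s * s) *: (- (2^-1 *: u2), 0, 0)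
     = (xt + s *: u1 - (s * s / 2) *: u2, y, z) :> XYZ.
    congr (_, _, _) => /=.
    - by rewrite scalerN scalerA.
    - by rewrite !scaler0 !addr0.
    - by rewrite !scaler0 !addr0.
  have h1 := @first_order_le R n G w w' (tau, 0, 0) (- (2^-1 *: v), 0, 0) (tau, 0, 0) (- (2^-1 *: v), 0, 0) s0 Gw Gw' s00 e0.
  have {}h1 := h1 (fun s ss => eq_rect_r (fun a => gf G a <= _) (eq_rect_r (fun a => _ <= gf G a)
     (eq_rect _ (fun x => gf G (x, yt, zt) <= gf G (x, yb, zb)) (Fr s ss) _ (Hr s ss)) (P yb zb s tau v)) (P yt zt s tau v)).
  have Hl' s : 0 <= s < s0 -> c (t0 - s) = xt + s *: (- tau) - (s * s / 2) *: v' by move=> /Hl ->; rewrite scalerN.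
  have h2 := @first_order_le R n G w w' (- tau, 0, 0) (- (2^-1 *: v'), 0, 0) (- tau, 0, 0) (- (2^-1 *: v'), 0, 0) s0 Gw Gw' s00 e0.
  have {}h2 := h2 (fun s ss => eq_rect_r (fun a => gf G a <= _) (eq_rect_r (fun a => _ <= gf G a)
     (eq_rect _ (fun x => gf G (x, yt, zt) <= gf G (x, yb, zb)) (Fl s ss) _ (Hl' s ss)) (P yb zb s (- tau) v')) (P yt zt s (- tau) v')).
  move: h1 h2; rewrite !jet1E !dotp0r !mulr0 !addr0 !dotpNr dotpBl lerN2 => h1 h2.
  by apply/eqP; rewrite subr_eq0 eq_le h1 h2.
pose b := gPhi G qt w.
apply/(gPhi_eq0 qt Gw); apply: dotp_eq0; apply/eqP; rewrite eq_le dotp_ge0 andbT.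
have [s2 s20 Fb] := Fy b.
have := @first_order_le R n G w w' (0, b, dotp qt b) (0, 0, K * dotp b b) 0 0 s2 Gw Gw' s20 e0.
have PP s : 0 <= s < s2 -> gf G (w + s *: (0, b, dotp qt b) + (s * s) *: (0, 0, K * dotp b b)) <= gf G (w' + s *: 0 + (s * s) *: 0).
  move=> /Fb; rewrite !scaler0 !addr0; congr (gf G _ <= _); congr (_, _, _) => /=.
  - by rewrite !scaler0 !addr0.
  - by rewrite scaler0 addr0.
move=> /(_ PP).
have -> : jet1 G w' 0 = 0 by rewrite -(scale0r (0 : XYZ)) jet1Z mul0r.
by rewrite jet1E dotp0r add0r -dotpZl -dotpDl.
Qed.

End Curve.

Section CurveLemma.
Context {R : realType} {n : nat}.
Local Notation X := 'rV[R]_n.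
Local Notation XYZ := (X * X * R)%type.
Variable G : @gdata R n.
Implicit Types (x y b tau : X) (t z : R) (w : XYZ).

(* A max principle over a compact [K]: the least shift [a] for which [f a <= 0] on [K]
   is attained. *)
Lemma touching_shift (V : normedModType R) (K : set V) (f : R -> V -> R) (alpha C1 C2 : R) (p0 : V) :
  compact K -> K p0 -> 0 <= alpha ->
  (forall a (p p' : V), 0 <= a <= alpha -> K p -> K p' -> `|f a p - f a p'| <= C1 * `|p - p'|) ->
  (forall a a' (p : V), 0 <= a <= alpha -> 0 <= a' <= alpha -> K p -> `|f a p - f a' p| <= C2 * `|a - a'|) ->
  0 <= f 0 p0 -> (forall p : V, K p -> f alpha p <= 0) ->
  exists2 a, 0 <= a <= alpha & exists2 p, K p & f a p = 0 /\ forall p' : V, K p' -> f a p' <= 0.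
Proof.
move=> cK Kp0 al0 H1 H2 f0 fal.
have EV a : exists p : V, 0 <= a <= alpha -> K p /\ forall p' : V, K p' -> f a p' <= f a p.
  have [a01|na] := pselect (0 <= a <= alpha); last by exists p0.
  have [||p Kp pmin] := @compact_min R V K (fun p => - f a p) _ cK.
  - by exists p0.
  - move=> p Kp e e0; pose C := `|C1| + 1; have C0 : 0 < C by rewrite /C ltr_wpDl.
    exists (e / C); first by rewrite divr_gt0.
    move=> p' Kp' pp'; rewrite -opprD normrN.
    apply: le_lt_trans (H1 a p' p a01 Kp' Kp) _.
    rewrite ltr_pdivlMr// mulrC in pp'; apply: le_lt_trans pp'.
    by rewrite ler_wpM2r// (le_trans (ler_norm _))// lerDl.
  by exists p => _; split => // p' /pmin; rewrite lerN2.
pose P a := proj1_sig (cid (EV a)).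
have HP a : 0 <= a <= alpha -> K (P a) /\ forall p' : V, K p' -> f a p' <= f a (P a) := proj2_sig (cid (EV a)).
pose M a := f a (P a).
have lipM a a' : 0 <= a <= alpha -> 0 <= a' <= alpha -> `|M a - M a'| <= C2 * `|a - a'|.
  move=> h h'; have [K1 m1] := HP a h; have [K2 m2] := HP a' h'.
  have := H2 a a' (P a) h h' K1; have := H2 a a' (P a') h h' K2.
  have := m1 _ K2; have := m2 _ K1; rewrite /M !ler_norml.
  move: (f a (P a)) (f a (P a')) (f a' (P a)) (f a' (P a')) (C2 * _) => f1 f2 f3 f4 u k1 k2.
  by move=> /andP[k3 k4] /andP[k5 k6]; apply/andP; split; lra.
have h00 : 0 <= (0 : R) <= alpha by rewrite lexx.
have hal : 0 <= alpha <= alpha by rewrite lexx al0.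
have M0 : 0 <= M 0 by apply: le_trans f0 _; exact: (HP 0 h00).2.
have Mal : M alpha <= 0 by apply: fal; exact: (HP alpha hal).1.
have [||a ai Ma] := @IVT R M 0 alpha 0 al0.
- apply: within_normP => a; rewrite /= in_itv /= => ai e e0.
  pose C := `|C2| + 1; have C0 : 0 < C by rewrite /C ltr_wpDl.
  exists (e / C); first by rewrite divr_gt0.
  move=> a'; rewrite /= in_itv /= => ai' aa'; apply: le_lt_trans (lipM a' a ai' ai) _.
  rewrite ltr_pdivlMr// mulrC in aa'; apply: le_lt_trans aa'.
  by rewrite ler_wpM2r// (le_trans (ler_norm _))// lerDl.
- by rewrite ge_min Mal orbT le_max M0.
rewrite in_itv /= in ai; have [Kp mp] := HP a ai.
exists a => //; exists (P a) => //; split => //.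
by move=> p' /mp; rewrite -/(M a) Ma.
Qed.

Lemma dotp_sq_lip (d d' : X) (e : R) : `|d| <= e -> `|d'| <= e ->
  `|dotp d d - dotp d' d'| <= n%:R * 2 * e * `|d - d'|.
Proof.
move=> h h'; have -> : dotp d d - dotp d' d' = dotp (d - d') (d + d').
  by rewrite dotpBl !dotpDr (dotpC d' d); ring.
apply: le_trans (dotp_le _ _) _; rewrite mulrAC ler_wpM2r// -mulrA ler_wpM2l//.
by apply: le_trans (ler_normD _ _) _; lra.
Qed.

Lemma below_tangent_arith (A A0 A1 B B0 N D1 D4 cz kd a cd : R) : A - A0 <= D1 * N -> - (D4 * N) <= B - B0 ->
  A0 <= A1 - cz * (kd + a) -> A1 <= B0 + cd -> cd <= cz / 2 * kd ->
  A - B <= - (cz / 2 * kd) - cz * a + (D1 + D4) * N.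
Proof. lra. Qed.

Lemma top_shift_arith (cz kd be E : R) : 0 <= cz * kd -> E <= cz * be / 4 -> 0 < cz * be ->
  - (cz / 2 * kd) - cz * be + E <= 0.
Proof. lra. Qed.

Lemma start_arith (cz kd a : R) : 0 <= cz * kd -> 0 < cz * a ->
  0 <= - (cz / 2 * kd) - cz * a + 0 -> False.
Proof. lra. Qed.

Lemma boundary_arith (cz kd be a E : R) : cz * be <= cz * kd -> E <= cz * be / 4 -> 0 < cz * a -> 0 < cz * be ->
  0 <= - (cz / 2 * kd) - cz * a + E -> False.
Proof. lra. Qed.

(** If the comparison fails at [t1] by more than [m], shifting the paraboloid family by a suitable
    [a] makes it touch g(., yb, zb) along the curve from below. The constants force the touching
    point away from the boundary of [S] on which it would be useless, and there the second order
    test is contradictory. *)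
Lemma curve_core (xs yb yc tau0 eta1 y' : X) (zb zc z' rho V D cz C1 C4 Qm CC K e1 beta rr m del r1 t1 : R)
    (c T v : R -> X) :
  let wc := (xs, yc, zc) in let wb := (xs, yb, zb) in let w' := (xs, y', z') in
  let q := gQ G w' in let L := 1 + n%:R * Qm in
  (forall w, `|w - wc| < D -> dom G w /\ gfz G w <= - cz) ->
  (forall w, `|w - wc| < D -> `|gfx G w - gfx G wc| <= rho / 2) ->
  (forall w w', `|w - wc| < D -> `|w' - wc| < D -> `|gf G w - gf G w'| <= C1 * `|w - w'|) ->
  (forall x, `|x - xs| <= rr -> dom G (x, yb, zb)) ->
  (forall x, `|x - xs| <= rr -> `|gfx G (x, yb, zb) - gfx G wb| <= rho / 2) ->
  (forall x x', `|x - xs| <= rr -> `|x' - xs| <= rr ->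
     `|gf G (x, yb, zb) - gf G (x', yb, zb)| <= C4 * `|x - x'|) ->
  (forall y, `|y - y'| <= e1 -> gf G (xs, y, z' + dotp q (y - y')) <= gf G w' + CC * dotp (y - y') (y - y')) ->
  (exists2 s : R, 0 <= s <= 1 & gfx G wc - gfx G wb = s *: eta1) ->
  0 < D -> 0 < cz -> 0 < C1 -> 0 < C4 -> 0 < K -> 0 < e1 -> e1 <= 1 -> 0 < V -> 0 < rr -> 0 < m ->
  `|y' - yc| < D / 8 -> `|z' - zc| < D / 8 -> L * e1 <= D / 8 -> `|q| <= Qm ->
  n%:R * (K * (e1 * e1)) <= D / 8 -> 0 < beta <= D / 8 -> 2 * CC <= K * cz -> beta <= K * (e1 * e1) ->
  rr <= D / 8 -> (C1 + C4) * rr <= cz * beta / 4 -> C1 * (L * e1) <= m / 2 -> V * r1 <= rr ->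
  gf G w' = gf G wb -> dotp (gfx G w' - gfx G wb) tau0 = 0 ->
  (forall (xt yt tau v : X) (zt : R),
    let w := (xt, yt, zt) in let w' := (xt, yb, zb) in
    `|w - wc| < D -> dom G w' -> `|tau - tau0| < D ->
    gf G w = gf G w' -> dotp (gfx G w - gfx G w') tau = 0 ->
    - del <= dotp (tau *m gfxx G w) tau - dotp (tau *m gfxx G w') tau - dotp v (gfx G w - gfx G w') ->
    (forall b, exists2 s0 : R, 0 < s0 & forall s, 0 <= s < s0 ->
       gf G (xt + s *: tau - (s * s / 2) *: v, yt + s *: b,
             zt + s * dotp (gQ G w) b + s * s * (K * dotp b b))
       <= gf G (xt + s *: tau - (s * s / 2) *: v, yb, zb)) -> False) ->
  good_curve G xs yb zb tau0 eta1 r1 V del rho c T v ->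
  0 <= t1 < r1 -> gf G (c t1, y', z') < gf G (c t1, yb, zb) - m -> False.
Proof.
move=> wc wb w' q L hD hx hf hb hbx hbf htan [sc sc01 etac].
move=> D0 cz0 C10 C40 K0 e10 e11 V0 rr0 m0 y'c z'c Le qQ Ke2 /andP[beta0 betaD] Kcz Ke rrD rrc C1e Vr ew etaw Hdel GC.
move=> /andP[t10 t1r] bad.
have Qm0 : 0 <= Qm := le_trans (normr_ge0 _) qQ.
have c0 := gc_0 GC.
have r10 : 0 <= r1 by exact: le_trans t10 (ltW t1r).
have cxs t : 0 <= t <= r1 -> `|c t - xs| <= V * t.
  move=> /andP[ta tb]; have := gc_lip GC (t := t) (t' := 0); rewrite ta tb lexx r10 c0 subr0 (ger0_norm ta).
  by apply.
have crr t : 0 <= t <= r1 -> `|c t - xs| <= rr.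
  move=> tt; apply: le_trans (cxs _ tt) _; apply: le_trans Vr; rewrite ler_wpM2l ?(ltW V0)//.
  by case/andP: tt.
have t1rr : 0 <= t1 <= r1 by rewrite t10 ltW.
have sub1 t : 0 <= t <= t1 -> 0 <= t <= r1.
  by move=> /andP[-> /le_trans]; apply; exact: ltW.
(* The slope [q] compensates g to first order in y. Since g decreases in z, the term in [K] pushes g
   down away from [y'] and beats the quadratic growth of g along the tangent. *)
pose zK y := z' + dotp q (y - y') + K * dotp (y - y') (y - y').
pose f (a : R) (p : R * X) := gf G (c p.1, p.2, zK p.2 + a) - gf G (c p.1, yb, zb).
have Kd y : `|y - y'| <= e1 -> K * dotp (y - y') (y - y') <= D / 8.
  move=> ye; apply: le_trans Ke2; rewrite mulrCA ler_wpM2l ?(ltW K0)//.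
  apply: le_trans (ler_norm _) _; apply: le_trans (dotp_le _ _) _.
  by rewrite -mulrA ler_wpM2l//; apply: ler_pM.
have Kd0 y : 0 <= K * dotp (y - y') (y - y') by rewrite mulr_ge0 ?(ltW K0)// dotp_ge0.
have qd y : `|y - y'| <= e1 -> `|y - y'| + `|dotp q (y - y')| <= D / 8.
  move=> ye; apply: le_trans Le; rewrite mulrDl mul1r; apply: lerD => //.
  apply: le_trans (dotp_le _ _) _; apply: ler_pM => //.
  by rewrite ler_wpM2l.
have reg x y (h : R) : `|x - xs| <= rr -> `|y - y'| <= e1 -> 0 <= h <= D / 4 ->
    `|(x, y, z' + dotp q (y - y') + h) - wc| < D.
  move=> xr ye /andP[h0 h1]; have qy := qd _ ye.
  have yn : 0 <= `|y - y'| by [].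
  apply/norm3_lt; split => /=.
  - by apply: le_lt_trans xr _; apply: le_lt_trans rrD _; move: D0; clear; lra.
  - rewrite -(subrKA y'); apply: le_lt_trans (ler_normD _ _) _.
    have := normr_ge0 (dotp q (y - y')); move: qy y'c D0; clear; lra.
  - have -> : z' + dotp q (y - y') + h - zc = (z' - zc) + (dotp q (y - y') + h) by ring.
    apply: le_lt_trans (ler_normD _ _) _; apply: le_lt_trans (lerD (lexx _) (ler_normD _ _)) _.
    rewrite (ger0_norm h0); move: z'c qy yn h1 D0; clear; lra.
have regK x y (a : R) : `|x - xs| <= rr -> `|y - y'| <= e1 -> 0 <= a <= beta ->
    `|(x, y, zK y + a) - wc| < D.
  move=> xr ye /andP[a0 a1]; rewrite /zK -[z' + _ + _ + a]addrA; apply: reg => //.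
  by rewrite addr_ge0//=; have := Kd _ ye; move: a1 betaD; clear; lra.
have xs0 : `|xs - xs| <= rr by rewrite subrr normr0 ltW.
have mono x y (h : R) : `|x - xs| <= rr -> `|y - y'| <= e1 -> 0 <= h <= D / 4 ->
   gf G (x, y, z' + dotp q (y - y') + h) <= gf G (x, y, z' + dotp q (y - y')) - cz * h.
  move=> xr ye h01; apply: (gf_mono hD); first by case/andP: h01.
    by rewrite -[z' + _]addr0; apply: reg => //; rewrite lexx divr_ge0// ltW.
  exact: reg.
have fb a t y : 0 <= a <= beta -> 0 <= t <= t1 -> `|y - y'| <= e1 ->
   f a (t, y) <= - (cz / 2 * (K * dotp (y - y') (y - y'))) - cz * a + (C1 + C4) * `|c t - xs|.
  move=> ai ti ye; have tr := crr _ (sub1 _ ti).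
  have h1 := hf _ _ (regK _ _ _ tr ye ai) (regK _ _ _ xs0 ye ai).
  rewrite norm_base in h1.
  have h2 := hbf _ _ tr xs0; rewrite -/wb in h2.
  have h3 := mono xs y (K * dotp (y - y') (y - y') + a) xs0 ye.
  have h4 := htan _ ye.
  have h5 : 0 <= K * dotp (y - y') (y - y') + a <= D / 4.
    case/andP: ai => a0 a1; rewrite addr_ge0//=; have := Kd _ ye; move: a1 betaD; clear; lra.
  have {}h3 := h3 h5.
  have h6 : CC * dotp (y - y') (y - y') <= cz / 2 * (K * dotp (y - y') (y - y')).
    rewrite mulrA ler_wpM2r ?dotp_ge0//; move: Kcz; clear; lra.
  have ez : zK y + a = z' + dotp q (y - y') + (K * dotp (y - y') (y - y') + a) by rewrite /zK addrA.
  rewrite /f /= ez; rewrite ez in h1.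
  rewrite ew in h4; move: h1 h2; rewrite !ler_norml => /andP[_ h1] /andP[h2 _].
  exact: below_tangent_arith h1 h2 h3 h4 h6.
pose Lam := C1 * (V + 1 + n%:R * Qm + K * (n%:R * 2 * e1)) + C4 * V.
pose S : set (R * X) := [set p | 0 <= p.1 <= t1 /\ `|p.2 - y'| <= e1].
have cS : compact S.
  have -> : S = `[0, t1]%classic `*` [set y | `|y - y'| <= e1].
    by apply/seteqP; split => p /=; rewrite in_itv.
  by apply: compact_setX; [exact: segment_compact|exact: compact_rV_ball].
have fS a p p' : 0 <= a <= beta -> S p -> S p' -> `|f a p - f a p'| <= Lam * `|p - p'|.
  case: p p' => [t y] [s y2] ai [/= ti ye] [/= si ye2].
  have [tr sr] := (crr _ (sub1 _ ti), crr _ (sub1 _ si)).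
  set N := `|(t, y) - (s, y2)|.
  have N1 : `|t - s| <= N by rewrite /N norm2E /= le_max lexx.
  have N2 : `|y - y2| <= N by rewrite /N norm2E /= le_max lexx orbT.
  have N0 : 0 <= N := le_trans (normr_ge0 _) N1.
  have h1 := hf _ _ (regK _ _ _ tr ye ai) (regK _ _ _ sr ye2 ai).
  have h2 := hbf _ _ tr sr.
  have h3 := gc_lip GC (sub1 _ ti) (sub1 _ si).
  have {}h3 : `|c t - c s| <= V * N by apply: le_trans h3 _; rewrite ler_wpM2l// ltW.
  have h4 : `|dotp (y - y') (y - y') - dotp (y2 - y') (y2 - y')| <= n%:R * 2 * e1 * N.
    apply: le_trans (dotp_sq_lip ye ye2) _; rewrite opprB addrA subrK.
    by rewrite ler_wpM2l// mulr_ge0// ?(ltW e10)// mulr_ge0.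
  have h5 : `|dotp q (y - y') - dotp q (y2 - y')| <= n%:R * Qm * N.
    rewrite -dotpBr opprB addrA subrK; apply: le_trans (dotp_le _ _) _.
    by apply: ler_pM => //; rewrite ?mulr_ge0// ler_wpM2l.
  have h6 : `|(c t, y, zK y + a) - (c s, y2, zK y2 + a)| <= (V + 1 + n%:R * Qm + K * (n%:R * 2 * e1)) * N.
    have p1 : 0 <= V * N by rewrite mulr_ge0// ltW.
    have p2 : 0 <= n%:R * Qm * N by rewrite !mulr_ge0.
    have p3 : 0 <= K * (n%:R * 2 * e1) * N.
      by rewrite mulr_ge0// mulr_ge0 ?(ltW K0)// mulr_ge0 ?(ltW e10)// mulr_ge0.
    rewrite !mulrDl mul1r; apply/norm3_le; split => /=.
    - apply: le_trans h3 _; move: p1 p2 p3 N0; clear; lra.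
    - apply: le_trans N2 _; move: p1 p2 p3 N0; clear; lra.
    - have -> : zK y + a - (zK y2 + a) = (dotp q (y - y') - dotp q (y2 - y')) +
         K * (dotp (y - y') (y - y') - dotp (y2 - y') (y2 - y')).
        by rewrite /zK; move: (dotp q (y - y')) (dotp q (y2 - y')) (dotp (y - y') (y - y')) (dotp (y2 - y') (y2 - y')); clear=> *; ring.
      apply: le_trans (ler_normD _ _) _; rewrite normrM (gtr0_norm K0).
      have h7 : K * `|dotp (y - y') (y - y') - dotp (y2 - y') (y2 - y')| <= K * (n%:R * 2 * e1) * N.
        by rewrite -mulrA ler_wpM2l// ltW.
      move: h5 h7 p1 N0; clear; lra.
  have -> : f a (t, y) - f a (s, y2) = (gf G (c t, y, zK y + a) - gf G (c s, y2, zK y2 + a))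
     - (gf G (c t, yb, zb) - gf G (c s, yb, zb)).
    by rewrite /f /= !opprD !opprK [LHS]addrACA.
  apply: le_trans (ler_normB _ _) _; rewrite /Lam mulrDl; apply: lerD.
    by apply: le_trans h1 _; rewrite -mulrA ler_wpM2l// ltW.
  by apply: le_trans h2 _; rewrite -mulrA ler_wpM2l// ltW.
have fa a a' p : 0 <= a <= beta -> 0 <= a' <= beta -> S p -> `|f a p - f a' p| <= C1 * `|a - a'|.
  case: p => [t y] ai ai' [/= ti ye]; have tr := crr _ (sub1 _ ti).
  have -> : f a (t, y) - f a' (t, y) = gf G (c t, y, zK y + a) - gf G (c t, y, zK y + a').
    by rewrite /f /= opprB addrA subrK.
  apply: le_trans (hf _ _ (regK _ _ _ tr ye ai) (regK _ _ _ tr ye ai')) _.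
  rewrite ler_wpM2l ?(ltW C10)//; apply/norm3_le; split => /=; rewrite ?subrr ?normr0//.
  by rewrite opprD addrACA subrr add0r.
have yy : `|y' - y'| <= e1 by rewrite subrr normr0 ltW.
have S0 : S (0, y') by split; rewrite /= ?lexx.
have zK' : zK y' = z' by rewrite /zK subrr dotp0r dotp0l mulr0 !addr0.
have f00 : f 0 (0, y') = 0 by rewrite /f /= zK' addr0 c0 -/w' ew subrr.
have bb : 0 <= beta <= beta by rewrite lexx ltW.
have CN t : 0 <= t <= t1 -> (C1 + C4) * `|c t - xs| <= cz * beta / 4.
  by move=> /sub1/crr h; apply: le_trans rrc; rewrite ler_wpM2l// ltW// addr_gt0.
have fal p : S p -> f beta p <= 0.
  case: p => [t y] [/= ti ye]; apply: le_trans (fb _ _ _ bb ti ye) _.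
  exact: top_shift_arith (mulr_ge0 (ltW cz0) (Kd0 y)) (CN _ ti) (mulr_gt0 cz0 beta0).
have f0 : 0 <= f 0 (0, y') by rewrite f00.
have [a0 ai0 [p0 Sp0 [fp0 fmax0]]] := touching_shift cS S0 (ltW beta0) fS fa f0 fal.
(* A touching with room to the right in time and all around in y, together with the two first order
   conditions, is what the test needs: its variations use only [s >= 0]. *)
suff [a [t [y [ai [/andP[tpos tlt] [ye [fty [fmax [eta0 qy]]]]]]]]] : exists a t y, 0 <= a <= beta /\ (0 <= t < t1 /\ (`|y - y'| < e1 /\
   (f a (t, y) = 0 /\ ((forall p, S p -> f a p <= 0) /\
   (dotp (gfx G (c t, y, zK y + a) - gfx G (c t, yb, zb)) (T t) = 0 /\
    gQ G (c t, y, zK y + a) = q + (2 * K) *: (y - y')))))).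
  have ti : 0 <= t <= t1 by rewrite tpos ltW.
  have tir : 0 <= t < r1 by rewrite tpos (lt_trans tlt).
  have ye' := ltW ye; have tr := crr _ (sub1 _ ti).
  have wD := regK _ _ _ tr ye' ai.
  have [Gw _] := hD _ wD; have Gb := hb _ tr.
  have ewt : gf G (c t, y, zK y + a) = gf G (c t, yb, zb) by apply/eqP; rewrite -subr_eq0 -/(f a (t, y)) fty.
  have TD : `|T t - tau0| < D.
    apply: le_lt_trans (gc_T GC (sub1 _ ti)) _; apply: (@le_lt_trans _ _ (D / 8)); last by move: D0; clear; lra.
    apply: le_trans rrD; apply: le_trans Vr; rewrite ler_wpM2l ?(ltW V0)// ltW//.
    exact: lt_trans tlt t1r.
  apply: (Hdel (c t) y (T t) (v t) (zK y + a)) => //.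
  (* Half of [rho] pays for the distance of the contact to [wc], the other half for the motion of
     the base point. *)
  - have tb : tube rho eta1 (gfx G (c t, y, zK y + a) - gfx G (c t, yb, zb)).
      exists sc => //; rewrite -etac.
      have -> : gfx G (c t, y, zK y + a) - gfx G (c t, yb, zb) - (gfx G wc - gfx G wb) =
        (gfx G (c t, y, zK y + a) - gfx G wc) - (gfx G (c t, yb, zb) - gfx G wb).
        by rewrite !opprD !opprK [LHS]addrACA.
      apply: le_trans (ler_normB _ _) _; have := hx _ wD; have := hbx _ tr; clear; lra.
    have := gc_sub GC tir tb eta0; rewrite /Fq.
    rewrite (@gW_eq R n G yb zb (c t) _ (c t, y, zK y + a)); last by split => //; rewrite [RHS]addrC subrK.
    rewrite (@gW_eq R n G yb zb (c t) 0 (c t, yb, zb)); last by split => //; rewrite addr0.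
    by [].
  - move=> b; have [s0 s00 hs0] := gc_right GC tir.
    pose s1 := Num.min s0 (Num.min (t1 - t) ((e1 - `|y - y'|) / (1 + `|b|))).
    have b1 : 0 < 1 + `|b| by rewrite ltr_wpDr.
    exists s1; first by rewrite !lt_min s00 subr_gt0 tlt divr_gt0// subr_gt0.
    move=> s /andP[sp]; rewrite !lt_min => /and3P[ss0 st sb].
    have hs : 0 <= s < s0 by rewrite sp.
    rewrite -(hs0 _ hs).
    have Sp : S (t + s, y + s *: b).
      split => /=; first by rewrite addr_ge0//= -lerBrDl ltW.
      rewrite addrAC; apply: le_trans (ler_normD _ _) _; rewrite normrZ (ger0_norm sp).
      move: sb; rewrite ltr_pdivlMr// mulrDr mulr1 => sb; move: sb sp; clear; lra.
    have := fmax _ Sp; rewrite /f /= subr_le0.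
    (* Q at the contact is the slope of [zK] at [y], and [zK] is quadratic, so its exact expansion
       is the variation of z prescribed by the test. *)
    have -> // : zK (y + s *: b) + a = zK y + a + s * dotp (gQ G (c t, y, zK y + a)) b + s * s * (K * dotp b b).
    rewrite qy /zK (addrAC y _ (- y')); move: (y - y') => d.
    rewrite !dotpDl !dotpDr !dotpZl !dotpZr (dotpC b d).
    by move: (dotp q d) (dotp q b) (dotp d d) (dotp d b) (dotp b b); clear => *; ring.
have zKs (y b : X) (s : R) : zK (y + s *: b) = zK y + s * dotp (q + (2 * K) *: (y - y')) b + s * s * (K * dotp b b).
  rewrite /zK (addrAC y _ (- y')); move: (y - y') => d.
  rewrite !dotpDl !dotpDr !dotpZl !dotpZr (dotpC b d).
  by move: (dotp q d) (dotp q b) (dotp d d) (dotp d b) (dotp b b); clear => *; ring.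
(* With no shift, the starting point [(0, y')] itself is a touching point. It has no left neighbour
   in time, but the two first order conditions hold there by hypothesis. *)
have [a00|a0n] := eqVneq a0 0.
  exists 0, 0, y'; rewrite zK' addr0 subrr normr0 scaler0 addr0 c0 (gc_T0 GC).
  do ![split => //]; rewrite ?lexx ?(ltW beta0)//.
    rewrite lt_neqAle t10 andbT; apply/eqP => t10'.
    by move: bad; rewrite -t10' c0 -/w' -/wb ew; move: m0; clear; lra.
  by move=> p /fmax0; rewrite a00.
have a0p : 0 < a0 by rewrite lt_neqAle eq_sym a0n; case/andP: ai0.
case: p0 Sp0 fp0 => [t y] [/= ti ye] fty.
exists a0, t, y; have tr := crr _ (sub1 _ ti).
(* At time 0 the tangent estimate leaves at most [- cz a0], which is negative. *)
have kt0 : t != 0.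
  apply/eqP => t00; have := fb _ _ _ ai0 ti ye; rewrite fty t00 c0 subrr normr0 mulr0.
  exact: start_arith (mulr_ge0 (ltW cz0) (Kd0 y)) (mulr_gt0 cz0 a0p).
have tpos : 0 < t by rewrite lt_neqAle eq_sym kt0; case/andP: ti.
(* At [t1] the assumed defect is [m], and varying y within [e1] along the tangent recovers at most
   [m / 2]. *)
have kt1 : t != t1.
  apply/eqP => tt1; move: fty; rewrite /f /= tt1.
  have t1r' := crr _ t1rr.
  have h1 : gf G (c t1, y, zK y + a0) <= gf G (c t1, y, z' + dotp q (y - y')).
    have ez : zK y + a0 = z' + dotp q (y - y') + (K * dotp (y - y') (y - y') + a0) by rewrite /zK addrA.
    have hh : 0 <= K * dotp (y - y') (y - y') + a0 by rewrite addr_ge0// ltW.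
    rewrite ez; apply: le_trans (mono _ _ _ t1r' ye _) _.
      rewrite hh; have := Kd _ ye; case/andP: ai0 => _; move: betaD; clear; lra.
    by rewrite gerBl mulr_ge0// ltW.
  have h2 : gf G (c t1, y, z' + dotp q (y - y')) <= gf G (c t1, y', z') + m / 2.
    have D40 : 0 <= (0 : R) <= D / 4 by rewrite lexx divr_ge0// ltW.
    have r2 := reg _ _ _ t1r' yy D40; have r3 := reg _ _ _ t1r' ye D40.
    rewrite subrr dotp0r !addr0 in r2; rewrite addr0 in r3.
    have := hf _ _ r3 r2; rewrite ler_norml => /andP[_ h].
    rewrite -lerBlDl; apply: le_trans h _; apply: le_trans C1e; rewrite ler_wpM2l ?(ltW C10)//.
    apply/norm3_le; split => /=.
    - by rewrite subrr normr0 mulr_ge0 ?(ltW e10)// addr_ge0// mulr_ge0.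
    - by apply: le_trans ye _; rewrite ler_peMl ?(ltW e10)// lerDl mulr_ge0.
    - rewrite addrC addKr; apply: le_trans (dotp_le _ _) _.
      rewrite mulrDl mul1r; apply: ler_wpDl; first exact: ltW.
      by apply: ler_pM => //; rewrite ler_wpM2l.
  move: h1 h2 bad m0; clear; lra.
have tlt : t < t1 by rewrite lt_neqAle kt1; case/andP: ti.
(* On the sphere of radius [e1] the term in [K] is at least [beta], half of which exceeds what the
   motion of x can contribute. *)
have ylt : `|y - y'| < e1.
  rewrite lt_neqAle ye andbT; apply/eqP => ye1.
  have := fb _ _ _ ai0 ti ye; rewrite fty.
  have h1 : beta <= K * dotp (y - y') (y - y').
    by apply: le_trans Ke _; rewrite ler_wpM2l ?(ltW K0)// -ye1 norm_le_dotp.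
  have h2 : cz * beta <= cz * (K * dotp (y - y') (y - y')) by rewrite ler_wpM2l// ltW.
  exact: boundary_arith h2 (CN _ ti) (mulr_gt0 cz0 a0p) (mulr_gt0 cz0 beta0).
have wD := regK _ _ _ tr ye ai0; have [Gw _] := hD _ wD; have Gb := hb _ tr.
have ewt : gf G (c t, y, zK y + a0) = gf G (c t, yb, zb) by apply/eqP; rewrite -subr_eq0 -/(f a0 (t, y)) fty.
have tir : 0 <= t < r1 by rewrite ltW//= (lt_trans tlt).
have tir' : 0 < t <= r1 by rewrite tpos ltW// (lt_trans tlt).
have [s0 s00 hs0] := gc_right GC tir; have [s2 s20 [v' hs2]] := gc_left GC tir'.
pose s1 := Num.min (Num.min s0 s2) (Num.min (t1 - t) t).
have s10 : 0 < s1 by rewrite !lt_min s00 s20 subr_gt0 tlt.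
have s1P s : 0 <= s < s1 -> [/\ 0 <= s < s0, 0 <= s < s2, 0 <= t + s <= t1 & 0 <= t - s <= t1].
  rewrite !lt_min => /andP[sp /andP[/andP[k1 k2] /andP[k3 k4]]]; rewrite !sp k1 k2; split => //.
    by rewrite addr_ge0 ?(ltW tpos)//= -lerBrDl ltW.
  by rewrite subr_ge0 (ltW k4)/=; apply: le_trans (ltW tlt); rewrite gerBl.
have [|||||e1' e2'] := @curve_critical R n G yb y (T t) (v t) v' zb (zK y + a0) K c (q + (2 * K) *: (y - y')) t s1 0 (c t) Gw Gb s10 ewt.
- by move=> s /s1P[h _ _ _]; exact: hs0.
- by move=> s /s1P[_ h _ _]; exact: hs2.
- by move=> s /s1P[_ _ h _]; have := fmax0 (t + s, y) (conj h ye); rewrite /f /= subr_le0.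
- by move=> s /s1P[_ _ _ h]; have := fmax0 (t - s, y) (conj h ye); rewrite /f /= subr_le0.
- move=> b; have b1 : 0 < 1 + `|b| by rewrite ltr_wpDr.
  exists ((e1 - `|y - y'|) / (1 + `|b|)); first by rewrite divr_gt0// subr_gt0.
  move=> s /andP[sp]; rewrite ltr_pdivlMr// => sb.
  have yb' : `|y + s *: b - y'| <= e1.
    rewrite addrAC; apply: le_trans (ler_normD _ _) _; rewrite normrZ (ger0_norm sp).
    move: sb sp; rewrite mulrDr mulr1; clear; lra.
  have := fmax0 (t, y + s *: b) (conj ti yb'); rewrite /f /= subr_le0 zKs.
  by rewrite (addrAC _ _ a0) (addrAC _ _ a0).
by rewrite tlt (ltW tpos); do ![split => //].
Qed.

(** [r] and [nu] precede the defect [m]: the radius comes from [local_contra], which holds for all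
    [K]. Only the width [e1] of the y-ball, the steepness [K] and the tolerance [del] are adapted to
    [m]. *)
Lemma curve_lemma (xs yb yc tau0 eta1 : X) (zb zc rho V : R) :
  dom G (xs, yb, zb) -> dom G (xs, yc, zc) -> tau0 != 0 -> 0 < rho -> 0 < V ->
  (exists2 s : R, 0 <= s <= 1 & gfx G (xs, yc, zc) - gfx G (xs, yb, zb) = s *: eta1) ->
  exists2 r : R, 0 < r & exists2 nu : R, 0 < nu & forall (y' : X) (z' : R),
    `|y' - yc| < nu -> `|z' - zc| < nu -> gf G (xs, y', z') = gf G (xs, yb, zb) ->
    dotp (gfx G (xs, y', z') - gfx G (xs, yb, zb)) tau0 = 0 ->
    forall m : R, 0 < m -> exists2 del : R, 0 < del & forall r1 (c T v : R -> X), 0 < r1 <= r ->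
      good_curve G xs yb zb tau0 eta1 r1 V del rho c T v ->
      forall t, 0 <= t < r1 -> gf G (c t, yb, zb) - m <= gf G (c t, y', z').
Proof.
set wc := (xs, yc, zc); set wb := (xs, yb, zb) => Gb Gc tau00 rho0 V0 [sc sc01 etac].
have [r0 r00 H0] := local_contra yb zb Gc tau00.
pose cz := - gfz G wc / 2.
have cz0 : 0 < cz by rewrite divr_gt0// oppr_gt0; exact: gfz_lt0.
have near_cz : \forall w \near wc, gfz G w <= - cz.
  have := near_close (cts_gfz Gc) cz0; apply: filterS => w; rewrite ler_norml => /andP[_].
  rewrite /cz; lra.
have rho2 : 0 < rho / 2 by rewrite divr_gt0.
have [d1 d10 D1] := (near_normP _ _).1 (filterI (near_dom Gc) (filterI near_cz
  (filterI (near_bound (cts_gQ Gc)) (near_close (cts_gfx Gc) rho2)))).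
have [C1 C10 [d2 d20 D2]] := gf_lip Gc.
have [C2 C20 [d3 d30 D3]] := gfy_lip Gc.
have [C3 C30 [d4 d40 D4]] := gfz_lip Gc.
have [C4 C40 [d5 d50 D5]] := gf_lip Gb.
have [d6 d60 D6] := (near_normP _ _).1 (filterI (near_dom Gb) (near_close (cts_gfx Gb) rho2)).
pose D := Num.min (Num.min d1 d2) (Num.min (Num.min d3 d4) r0).
have D0 : 0 < D by rewrite !lt_min d10 d20 d30 d40 r00.
have sD (u : R) : u < D -> [/\ u < d1, u < d2, u < d3, u < d4 & u < r0].
  by rewrite !lt_min => /andP[/andP[-> ->] /andP[/andP[-> ->] ->]].
pose Db := Num.min d5 d6; have Db0 : 0 < Db by rewrite lt_min d50.
pose Qm := `|gQ G wc| + 1; have Qm0 : 0 <= Qm by rewrite addr_ge0.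
pose L := 1 + n%:R * Qm.
have L1 : 1 <= L by rewrite lerDl mulr_ge0.
have L0 : 0 < L by exact: lt_le_trans ltr01 L1.
pose CC := n%:R * ((C2 + C3 * Qm) * L).
have CC0 : 0 <= CC by rewrite mulr_ge0// mulr_ge0 ?(ltW L0)// addr_ge0 ?(ltW C20)// mulr_ge0// ltW.
(* The largest shift. The factor [n + 1] is there because [K |y - y'|^2] is bounded by [n K e1^2],
   hence by [2 n beta], which must stay below [D / 8]. *)
pose beta := D / (16 * (n%:R + 1)).
have beta0 : 0 < beta by rewrite divr_gt0// mulr_gt0.
have betan : n%:R * (2 * beta) <= D / 8.
  have -> : n%:R * (2 * beta) = (n%:R / (n%:R + 1)) * (D / 8) by rewrite /beta; field; rewrite gt_eqF.
  by apply: ler_piMl; [rewrite divr_ge0// ltW|rewrite ler_pdivrMr// mul1r lerDl].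
have betaD : beta <= D / 8.
  rewrite /beta invfM mulrA ler_pdivrMr//; have : 0 <= D / 16 * n%:R by rewrite mulr_ge0// divr_ge0// ltW.
  have : 0 < D by []. clear; lra.
pose rr := Num.min (D / 8) (Num.min (Db / 2) (cz * beta / 4 / (C1 + C4))).
have C14 : 0 < C1 + C4 by exact: addr_gt0.
have cb0 : 0 < cz * beta := mulr_gt0 cz0 beta0.
have cb1 : 0 < cz * beta / 4 / (C1 + C4) by apply: divr_gt0 => //; exact: divr_gt0.
have D80 : 0 < D / 8 by exact: divr_gt0.
have Db20 : 0 < Db / 2 by exact: divr_gt0.
have rr0 : 0 < rr by rewrite !lt_min D80 Db20.
have rrD : rr <= D / 8 by rewrite ge_min lexx.
have rrDb : rr < Db by apply: (@le_lt_trans _ _ (Db / 2)); [rewrite !ge_min lexx !orbT|move: Db0; clear; lra].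
have rrc : (C1 + C4) * rr <= cz * beta / 4.
  by rewrite mulrC -ler_pdivlMr// !ge_min lexx !orbT.
exists (rr / V); first by rewrite divr_gt0.
exists (D / 8); first by rewrite divr_gt0.
move=> y' z' y'c z'c ew etaw m m0.
pose w' : XYZ := (xs, y', z').
have w'D : `|w' - wc| < D.
  by apply/norm3_lt; split => /=; [rewrite subrr normr0| |]; move: y'c z'c D0; clear; lra.
have [w'1 w'2 w'3 w'4 w'5] := sD _ w'D.
have [Gw' [_ [qQ _]]] := D1 _ w'1.
(* In turn: the square of [e1] is below [e1], the tangent stays in the ball of radius [D], varying y
   costs at most [m / 2], and [K e1^2] is at most [2 beta]. *)
pose e1 := Num.min (Num.min 1 (D / 8 / L)) (Num.min (m / 2 / (C1 * L)) (beta / (1 + 2 * CC / cz))).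
have u0 : 0 < 1 + 2 * CC / cz by rewrite ltr_wpDr// divr_ge0 ?(ltW cz0)// mulr_ge0.
have e10 : 0 < e1 by rewrite !lt_min ltr01 !divr_gt0// mulr_gt0.
have e1a : e1 <= 1 by rewrite !ge_min lexx.
have e1b : L * e1 <= D / 8 by rewrite mulrC -ler_pdivlMr// !ge_min lexx !orbT.
have e1c : C1 * (L * e1) <= m / 2 by rewrite mulrA mulrC -ler_pdivlMr ?mulr_gt0// !ge_min lexx !orbT.
have e1d : (1 + 2 * CC / cz) * e1 <= beta by rewrite mulrC -ler_pdivlMr// !ge_min lexx !orbT.
(* The second term dominates the tangential growth [CC]; the third makes [K e1^2] at least [beta],
   so that the boundary of the y-ball lies below. *)
pose K := 1 + 2 * CC / cz + beta / (e1 * e1).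
have ee0 : 0 < e1 * e1 by rewrite mulr_gt0.
have be0 : 0 < beta / (e1 * e1) by rewrite divr_gt0.
have K1 : 1 <= K by rewrite /K -addrA lerDl addr_ge0 ?(ltW be0)// divr_ge0 ?(ltW cz0)// mulr_ge0.
have K0 : 0 < K by exact: lt_le_trans ltr01 K1.
have Kcz : 2 * CC <= K * cz.
  have -> : K * cz = (1 + beta / (e1 * e1)) * cz + 2 * CC by rewrite /K; field; rewrite !gt_eqF.
  by rewrite lerDr mulr_ge0 ?(ltW cz0)// addr_ge0// ltW.
have Ke : beta <= K * (e1 * e1).
  have -> : K * (e1 * e1) = (1 + 2 * CC / cz) * (e1 * e1) + beta by rewrite /K mulrDl divfK// gt_eqF.
  by rewrite lerDr mulr_ge0// ltW.
have Ke2 : K * (e1 * e1) <= 2 * beta.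
  have -> : K * (e1 * e1) = (1 + 2 * CC / cz) * e1 * e1 + beta by rewrite /K mulrDl divfK ?gt_eqF// mulrA.
  have : (1 + 2 * CC / cz) * e1 * e1 <= beta * 1 by apply: ler_pM => //; rewrite ?mulr_ge0 ?(ltW e10) ?(ltW u0).
  clear; lra.
have [del del0 Hdel] := H0 K K1.
exists del => // r1 c T v /andP[r10 r1r] GC.
move=> t1 t1I; rewrite leNgt; apply/negP => bad.
have bx x : `|x - xs| <= rr -> `|(x, yb, zb) - wb| < Db.
  by move=> xr; rewrite norm_base; apply: le_lt_trans xr rrDb.
have bx5 x : `|x - xs| <= rr -> `|(x, yb, zb) - wb| < d5.
  by move=> /bx; rewrite lt_min => /andP[].
have bx6 x : `|x - xs| <= rr -> `|(x, yb, zb) - wb| < d6.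
  by move=> /bx; rewrite lt_min => /andP[].
apply: (@curve_core xs yb yc tau0 eta1 y' zb zc z' rho V D cz C1 C4 Qm CC K e1 beta rr m del r1 t1 c T v) => //.
- by move=> w /sD[/D1[? [? _]] _ _ _ _].
- by move=> w /sD[/D1[_ [_ [_ ?]]] _ _ _ _].
- by move=> w w2 /sD[_ h _ _ _] /sD[_ h2 _ _ _]; exact: D2.
- by move=> x /bx6/D6[].
- by move=> x /bx6/D6[].
- by move=> x x' /bx5 h /bx5 h'; apply: le_trans (D5 _ _ h h') _; rewrite norm_base.
- move=> y ye; apply: (@gf_tangent R n G wc D C2 C3 Qm) => //.
  + by move=> w /sD[/D1[? _] _ _ _ _].
  + by move=> w w2 /sD[_ _ h _ _] /sD[_ _ h2 _ _]; exact: D3.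
  + by move=> w w2 /sD[_ _ _ h _] /sD[_ _ _ h2 _]; exact: D4.
  + exact: ltW.
  + exact: ltW.
  + have dq : `|dotp (gQ G (xs, y', z')) (y - y')| <= n%:R * Qm * e1.
      by apply: le_trans (dotp_le _ _) _; apply: ler_pM; rewrite ?mulr_ge0// ler_wpM2l.
    have Le : L * e1 = e1 + n%:R * Qm * e1 by rewrite /L mulrDl mul1r.
    have nQe : 0 <= n%:R * Qm * e1 := le_trans (normr_ge0 _) dq.
    rewrite Le in e1b.
    apply/norm3_lt; split => /=; first by rewrite subrr normr0.
      rewrite -(subrKA y'); apply: le_lt_trans (ler_normD _ _) _.
      by move: e1b ye y'c nQe D80; clear; lra.
    rewrite addrAC; apply: le_lt_trans (ler_normD _ _) _.
    by move: e1b ye z'c dq e10 D80; clear; lra.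
- by exists sc.
- apply: le_trans betan; rewrite ler_wpM2l//.
- by rewrite beta0.
- by rewrite mulrC -ler_pdivlMr.
- move=> xt yt tau v2 zt w w2 wD Gx tD.
  have [_ _ _ _ wr] := sD _ wD; have [_ _ _ _ tr] := sD _ tD.
  exact: (@Hdel xt yt tau v2 zt wr Gx tr).
Qed.

End CurveLemma.

(** * Existence of good curves *)

Section Uniform.
Context {R : realType}.

(** A Lebesgue number argument: local radii are combined through compactness, smaller radii being
    allowed by monotonicity. *)
Lemma compact_uniform (V : normedModType R) (K : set V) (P : R -> V -> Prop) :
  compact K -> (forall d d' p, d <= d' -> P d' p -> P d p) ->
  (forall p, K p -> exists2 d : R, 0 < d & forall p', `|p' - p| < d -> P d p') ->
  exists2 d : R, 0 < d & forall p, K p -> P d p.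
Proof.
move=> /compact_near_coveringP cK mono H.
have : \forall d \near 0^'+, K `<=` P d.
  apply: cK => p Kp; have [d d0 D] := H p Kp.
  exists ([set p' | `|p' - p| < d], [set e | e <= d]); last first.
    by move=> [p' e] /= [h1 h2]; apply: mono h2 _; exact: D.
  split => /=; first by apply/near_normP; exists d.
  exact: nbhs_right_le.
move=> h; near (0 : R)^'+ => d; exists d; first by near: d; exact: nbhs_right_gt.
have : K `<=` P d by near: d.
exact.
Unshelve. all: by end_near. Qed.

Lemma compact_unif_cts (V W : normedModType R) (K : set V) (f : V -> W) :
  compact K -> (forall p, K p -> {for p, continuous f}) ->
  forall e : R, 0 < e -> exists2 d : R, 0 < d & forall p p', K p -> `|p' - p| < d -> `|f p' - f p| < e.
Proof.
move=> cK cf e e0.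
have e2 : 0 < e / 2 by rewrite divr_gt0.
pose P (d : R) p := forall p', `|p' - p| < d -> `|f p' - f p| < e.
have [|p Kp|d d0 D] := @compact_uniform V K P cK.
- by move=> d d' p dd' h p' pd; apply: h; exact: lt_le_trans pd dd'.
- have /cvg_normP/(_ _ e2)[d d0 D] := cf p Kp.
  exists (d / 2); first by rewrite divr_gt0.
  move=> p1 p1d p2 p2d.
  have h1 : `|f p1 - f p| < e / 2 by apply: D; move: p1d d0; clear; lra.
  have h2 : `|f p2 - f p| < e / 2.
    by apply: D; rewrite -(subrKA p1); apply: le_lt_trans (ler_normD _ _) _; move: p1d p2d; clear; lra.
  rewrite -(subrKA (f p)); apply: le_lt_trans (ler_normD _ _) _; rewrite (distrC (f p)).
  by move: h1 h2; clear; lra.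
- by exists d => // p p' Kp; exact: D.
Qed.

Lemma compact_bound (V : normedModType R) (K : set V) (f : V -> R) :
  compact K -> (forall p, K p -> {for p, continuous f}) ->
  exists2 M : R, 0 <= M & forall p, K p -> `|f p| <= M.
Proof.
move=> cK cf; have [K0|nK] := pselect (K !=set0); last first.
  by exists 0 => // p Kp; case: nK; exists p.
have [|c Kc cmin] := @compact_min R V K (fun p => - `|f p|) K0 cK.
  move=> a Ka e e0; have /cvg_normP/(_ e e0)[d d0 D] := cf a Ka.
  exists d => // x Kx /D; apply: le_lt_trans; rewrite -opprD normrN.
  exact: ler_dist_dist.
by exists `|f c| => // p /cmin; rewrite lerN2.
Qed.

Lemma cts_sum (V : normedModType R) (I : Type) (r : seq I) (f : I -> V -> R) (p : V) :
  (forall i, {for p, continuous (f i)}) -> {for p, continuous (fun x => \sum_(i <- r) f i x)}.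
Proof.
move=> H; elim: r => [|i r IH].
  have -> : (fun x => \sum_(i <- [::]) f i x) = cst 0 by apply/funext => x; rewrite big_nil.
  exact: cvg_cst.
have -> : (fun x => \sum_(j <- i :: r) f j x) = (fun x => f i x + \sum_(j <- r) f j x).
  by apply/funext => x; rewrite big_cons.
apply: cvgD; [exact: H|exact: IH].
Qed.

End Uniform.

Section Region.
Context {R : realType} {n : nat}.
Local Notation X := 'rV[R]_n.
Local Notation XYZ := (X * X * R)%type.
Variable G : @gdata R n.
Implicit Types (x y b tau eta : X) (t z : R) (w : XYZ).

Lemma tube_compact (rho : R) eta1 : compact (tube rho eta1).
Proof.
have -> : tube rho eta1 = (fun p : R * X => p.1 *: eta1 + p.2) @` (`[0, 1]%classic `*` [set v | `|v - 0| <= rho]).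
  apply/seteqP; split => [eta [s s01 h]|_ [[s v] [/= s01 h] <-]].
    by exists (s, eta - s *: eta1); [split => //=; rewrite ?in_itv// subr0|rewrite /= addrC subrK].
  by exists s; [rewrite /= in_itv in s01|rewrite addrAC subrr add0r; rewrite subr0 in h].
apply: continuous_compact; last by apply: compact_setX; [exact: segment_compact|exact: compact_rV_ball].
apply: continuous_subspaceT => p; apply: cvgD; last exact: cvg_snd.
by apply: cvgZr_tmp; exact: cvg_fst.
Qed.

Lemma tube_norm (rho : R) eta1 eta : tube rho eta1 eta -> `|eta| <= `|eta1| + rho.
Proof.
move=> [s /andP[s0 s1] h]; rewrite -[eta](subrK (s *: eta1)) addrC.
apply: le_trans (ler_normD _ _) _; apply: lerD => //.
by rewrite normrZ (ger0_norm s0) ler_piMl.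
Qed.

Lemma tube_convex (rho s : R) eta1 eta zeta : tube rho eta1 eta -> `|zeta| <= rho -> 0 <= s <= 1 ->
  tube rho eta1 ((1 - s) *: zeta + s *: eta).
Proof.
move=> [r /andP[r0 r1] h] hz /andP[s0 s1]; exists (s * r).
  by rewrite mulr_ge0//= (le_trans _ r1)// ler_piMl.
rewrite -scalerA -addrA -scalerBr; apply: le_trans (ler_normD _ _) _.
rewrite !normrZ (ger0_norm s0) ger0_norm ?subr_ge0//.
have : (1 - s) * `|zeta| <= (1 - s) * rho by rewrite ler_wpM2l ?subr_ge0.
have : s * `|eta - r *: eta1| <= s * rho by rewrite ler_wpM2l.
lra.
Qed.

Lemma tube_small (rho : R) eta1 zeta : `|zeta| <= rho -> tube rho eta1 zeta.
Proof. by move=> h; exists 0; rewrite ?lexx ?ler01// scale0r subr0. Qed.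

Lemma gW_cts yb zb x eta w : dom G (x, yb, zb) ->
  gsol G x (gf G (x, yb, zb)) (gfx G (x, yb, zb) + eta) w ->
  forall e : R, 0 < e -> exists2 d : R, 0 < d & forall x' eta', `|x' - x| < d -> `|eta' - eta| < d ->
   [/\ dom G (x', yb, zb), gsol G x' (gf G (x', yb, zb)) (gfx G (x', yb, zb) + eta') (gW G yb zb x' eta')
     & `|gW G yb zb x' eta' - w| < e].
Proof.
move=> Gb [Gw wx ew pw] e e0.
have [d d0 D] := gsol_open Gw e0.
have d2 : 0 < d / 2 by rewrite divr_gt0.
have [d1 d10 D1] := (near_normP _ _).1 (filterI (near_dom Gb) (filterI (near_close (cts_gf Gb) d2) (near_close (cts_gfx Gb) d2))).
exists (Num.min (d / 2) d1); first by rewrite lt_min d2.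
move=> x' eta'; rewrite !lt_min => /andP[x1 x2] /andP[h1 h2].
have [Gb' [c1 c2]] := D1 (x', yb, zb) (eq_ind_r (fun z => z < d1) x2 (norm_base x' x yb zb)).
have [|||w' sw' w'w] := D x' (gf G (x', yb, zb)) (gfx G (x', yb, zb) + eta').
- by rewrite wx; move: x1 d0; clear; lra.
- by rewrite ew; move: c1 d0; clear; lra.
- rewrite pw opprD addrACA; apply: le_lt_trans (ler_normD _ _) _; move: c2 h1; clear; lra.
by rewrite (gW_eq sw').
Qed.

(** Solvability is an open condition in (x, eta), and the segment of gradients is compact: one
    thickness [rho] works for all its points. *)
Lemma region_open yb zb xs eta1 : dom G (xs, yb, zb) ->
  (forall s : R, 0 <= s <= 1 -> exists w, gsol G xs (gf G (xs, yb, zb)) (gfx G (xs, yb, zb) + s *: eta1) w) ->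
  exists2 rho : R, 0 < rho & forall x eta, `|x - xs| <= rho -> tube rho eta1 eta ->
    dom G (x, yb, zb) /\ gsol G x (gf G (x, yb, zb)) (gfx G (x, yb, zb) + eta) (gW G yb zb x eta).
Proof.
move=> Gb H.
pose P (d : R) (s : R) := forall x eta, `|x - xs| < d -> `|eta - s *: eta1| < d ->
  dom G (x, yb, zb) /\ gsol G x (gf G (x, yb, zb)) (gfx G (x, yb, zb) + eta) (gW G yb zb x eta).
have [|s|d d0 D] := @compact_uniform R R^o `[0, 1]%classic P (@segment_compact _ _ _).
- by move=> d d' s dd h x eta xd ed; apply: h; [exact: lt_le_trans xd dd|exact: lt_le_trans ed dd].
- rewrite /= in_itv /= => /H[w sw]; have [d d0 D] := gW_cts Gb sw ltr01.
  pose M := 2 * (1 + `|eta1|); have M0 : 0 < M by rewrite mulr_gt0// ltr_wpDr.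
  exists (d / M); first by rewrite divr_gt0.
  have dM : d / M <= d / 2.
    by rewrite ler_pdivrMr// /M mulrA divfK ?pnatr_eq0// ler_peMr// ?lerDl// ltW.
  move=> s' ss' x eta xd ed.
  have [||? ? _] // := D x eta; first by apply: lt_le_trans xd _; move: dM d0; clear; lra.
  have -> : eta - s *: eta1 = (eta - s' *: eta1) + (s' - s) *: eta1 by rewrite scalerBl addrA subrK.
  apply: le_lt_trans (ler_normD _ _) _; rewrite normrZ.
  have h1 : `|s' - s| * `|eta1| <= d / M * `|eta1| by rewrite ler_wpM2r// ltW.
  have h2 : d / M * (1 + `|eta1|) = d / 2.
    by rewrite /M invfM; field; rewrite gt_eqF// ltr_wpDr.
  by move: h1 h2 ed d0; rewrite mulrDr mulr1; clear; lra.
exists (d / 2); first by rewrite divr_gt0.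
move=> x eta xd [s s01 h]; apply: (D s); rewrite /= ?in_itv//; by move: xd h d0; clear; lra.
Qed.

Lemma Fq_cts yb zb x tau eta : dom G (x, yb, zb) ->
  (exists w, gsol G x (gf G (x, yb, zb)) (gfx G (x, yb, zb) + eta) w) ->
  {for (x, tau, eta), continuous (fun p : X * X * X => Fq G yb zb p.1.1 p.1.2 p.2)}.
Proof.
move=> Gb [w sw]; have wE := gW_eq sw; have [Gw _ _ _] := sw.
have cW : {for (x, tau, eta), continuous (fun p : X * X * X => gW G yb zb p.1.1 p.2)}.
  apply/cvg_normP => e e0 /=; rewrite wE; have [d d0 D] := gW_cts Gb sw e0.
  exists d => // -[[x' tau'] eta'] /=.
  move=> h; have [h1 _ h3] : [/\ `|x' - x| < d, `|tau' - tau| < d & `|eta' - eta| < d].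
    by move: h; rewrite norm2E norm2E /= !gt_max => /andP[/andP[]].
  by have [_ _] := D x' eta' h1 h3.
have cF : {for (x, tau, eta), continuous (fun p : X * X * X => gfxx G (gW G yb zb p.1.1 p.2))}.
  have h := jet_cxx (gjet G) Gw; rewrite -wE in h.
  exact: (continuous_comp cW h).
have cc i j : {for (x, tau, eta), continuous (fun p : X * X * X => gfxx G (gW G yb zb p.1.1 p.2) i j)}.
  move: cF => /cvg_normP h; apply/cvg_normP => e /h[d d0 D]; exists d => // p /D; apply: le_lt_trans.
  by have := coord_le_mx (gfxx G (gW G yb zb p.1.1 p.2) - gfxx G (gW G yb zb (x, tau, eta).1.1 (x, tau, eta).2)) i j; rewrite !mxE.
have ct i : {for (x, tau, eta), continuous (fun p : X * X * X => p.1.2 0 i)}.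
  apply/cvg_normP => e e0; exists e => // p; apply: le_lt_trans.
  have := coord_le_norm (p.1.2 - tau) i; rewrite !mxE => /le_trans; apply.
  by rewrite norm2E norm2E /= !le_max lexx orbT.
have -> : (fun p : X * X * X => Fq G yb zb p.1.1 p.1.2 p.2) =
  (fun p => \sum_j (\sum_i p.1.2 0 i * gfxx G (gW G yb zb p.1.1 p.2) i j) * p.1.2 0 j).
  by apply/funext => p; rewrite /Fq dotpE; apply: eq_bigr => j _; rewrite mxE.
apply: cts_sum => j.
have cj : {for (x, tau, eta), continuous (fun p : X * X * X => \sum_i p.1.2 0 i * gfxx G (gW G yb zb p.1.1 p.2) i j)}.
  by apply: cts_sum => i; apply: cvgM; [exact: ct|exact: cc].
by apply: cvgM; [exact: cj|exact: ct].
Qed.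

End Region.

(** * Approximate subgradients on a hyperplane *)

Section Node.
Context {R : realType} {n : nat}.
Local Notation X := 'rV[R]_n.
Local Notation XYZ := (X * X * R)%type.
Variable G : @gdata R n.
Implicit Types (x y b tau eta v : X) (t z : R) (w : XYZ).

Lemma limit_ge0 (A B s0 : R) : 0 < s0 -> (forall s, 0 < s < s0 -> 0 <= A + s * B) -> 0 <= A.
Proof.
move=> s00 H; apply/ler_addgt0Pl => e e0.
pose s := Num.min (s0 / 2) (e / (`|B| + 1)).
have sp : 0 < s by rewrite lt_min !divr_gt0.
have ss : s < s0 by apply: (@le_lt_trans _ _ (s0 / 2)); [rewrite ge_min lexx|move: s00; clear; lra].
have sB : s * B <= e.
  apply: le_trans (ler_norm _) _; rewrite normrM (gtr0_norm sp).
  apply: (@le_trans _ _ (s * (`|B| + 1))); first by rewrite ler_wpM2l ?(ltW sp)// lerDl.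
  by rewrite -ler_pdivlMr// ge_min lexx orbT.
have := H s; rewrite sp ss => /(_ isT); move: sB; clear; lra.
Qed.

(* Moreau regularisation: [v] is the slope, at its minimiser, of the convex
   function plus a steep quadratic. *)
Lemma node_subgradient (yb xs x tau eta1 : X) (zb rho M d e : R) :
  0 < rho -> 0 <= M -> 0 < d -> 0 < e <= 1 ->
  (forall eta, tube rho eta1 eta ->
     dom G (x, yb, zb) /\ gsol G x (gf G (x, yb, zb)) (gfx G (x, yb, zb) + eta) (gW G yb zb x eta)) ->
  (forall eta, tube rho eta1 eta -> `|Fq G yb zb x tau eta| <= M) ->
  (forall eta, `|eta| < d -> Fq G yb zb x tau 0 - e <= Fq G yb zb x tau eta) ->
  exists2 v, `|v| <= (2 * M + 1) / rho & forall eta, tube rho eta1 eta -> dotp eta tau = 0 ->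
    - e <= Fq G yb zb x tau eta - Fq G yb zb x tau 0 - dotp v eta.
Proof.
move=> rho0 M0 d0 /andP[e0 e1] Hs HM Hd; set F := Fq G yb zb x tau in HM Hd *.
pose C : set X := [set zeta | `|zeta - 0| <= rho /\ dotp zeta tau = 0].
have cC : compact C.
  have -> : C = [set zeta | `|zeta - 0| <= rho] `&` [set zeta | dotp zeta tau = 0] by [].
  apply: compact_closedI; first exact: compact_rV_ball.
  have -> : [set zeta | dotp zeta tau = 0] = (fun zeta : X => dotp zeta tau) @^-1` [set 0] by [].
  apply: preimage_closed; last exact: closed_eq.
  move=> zeta _; apply/cvg_normP => ep ep0.
  pose k := n%:R * `|tau| + 1; have k0 : 0 < k by rewrite ltr_wpDl// mulr_ge0.
  exists (ep / k); first by rewrite divr_gt0.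
  move=> z' h; rewrite -dotpBl; apply: le_lt_trans (dotp_le _ _) _.
  rewrite ltr_pdivlMr// in h; apply: le_lt_trans h.
  by rewrite mulrAC [leRHS]mulrC ler_wpM2r// lerDl.
have C0 : C 0 by split; rewrite ?subrr ?normr0 ?dotp0l// ltW.
have tC zeta : C zeta -> tube rho eta1 zeta by move=> [h _]; apply: tube_small; rewrite subr0 in h.
pose e2 := Num.min (rho / 2) (d / 2).
have e20 : 0 < e2 by rewrite lt_min !divr_gt0.
(* Comparison with 0 gives [mu |zh|^2 <= 2 M]; this [mu] thus places the minimiser within [e2],
   inside the small ball and where the convex function loses at most [e]. *)
pose mu := (2 * M + 1) / (e2 * e2).
have mu0 : 0 < mu by rewrite divr_gt0 ?mulr_gt0// ltr_wpDl// mulr_ge0.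
have [|zh Czh zmin] := @compact_min R X C (fun zeta => F zeta + mu * dotp zeta zeta) (ex_intro _ 0 C0) cC.
  move=> a Ca ep ep0.
  have [Gb sw] := Hs _ (tC _ Ca).
  have c1 := @Fq_cts R n G yb zb x tau a Gb (ex_intro _ _ sw).
  have ep2 : 0 < ep / 2 by rewrite divr_gt0.
  have [d1 d10 D1] := (cvg_normP _ _).1 c1 _ ep2.
  pose k := mu * (n%:R * 2 * rho) + 1.
  have k0 : 0 < k by rewrite ltr_wpDl// mulr_ge0 ?(ltW mu0)// mulr_ge0 ?(ltW rho0)// mulr_ge0.
  exists (Num.min d1 (ep / 2 / k)); first by rewrite lt_min d10 divr_gt0.
  move=> z' Cz'; rewrite lt_min => /andP[z1 z2].
  have h1 : `|F z' - F a| < ep / 2.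
    apply: (D1 (x, tau, z')).
    by rewrite norm2E norm2E /= !subrr !normr0 maxxx gt_max d10.
  have h2 : `|mu * dotp z' z' - mu * dotp a a| <= ep / 2.
    rewrite -mulrBr normrM (gtr0_norm mu0).
    apply: (@le_trans _ _ (k * `|z' - a|)); last by rewrite mulrC -ler_pdivlMr// ltW.
    apply: (@le_trans _ _ (mu * (n%:R * 2 * rho * `|z' - a|))).
      rewrite ler_wpM2l ?(ltW mu0)//.
      have [r1 _] := Cz'; have [r2 _] := Ca; rewrite !subr0 in r1 r2.
      have -> : dotp z' z' - dotp a a = dotp (z' - a) (z' + a).
        by rewrite dotpBl !dotpDr (dotpC a z'); move: (dotp z' z') (dotp a a) (dotp z' a) => u1 u2 u3; ring.
      apply: le_trans (dotp_le _ _) _; rewrite mulrAC ler_wpM2r// -mulrA ler_wpM2l//.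
      by apply: le_trans (ler_normD _ _) _; move: r1 r2; clear; lra.
    by rewrite mulrA ler_wpM2r// lerDl.
  rewrite opprD addrACA; apply: le_lt_trans (ler_normD _ _) _; move: h1 h2; clear; lra.
have [rzh zht] := Czh; rewrite subr0 in rzh.
have zz0 := dotp_ge0 zh.
have hM0 := HM _ (tC _ C0); have hMz := HM _ (tC _ Czh).
have zh2 : `|zh| < rho /\ `|zh| < d.
  have h1 := zmin _ C0; rewrite dotp0l mulr0 addr0 in h1.
  have h2 : mu * dotp zh zh <= 2 * M.
    move: hM0 hMz h1; rewrite !ler_norml => /andP[_ k1] /andP[k2 _]; clear -k1 k2; lra.
  have h3 : dotp zh zh < e2 * e2.
    rewrite -(ltr_pM2l mu0) /mu divfK ?gt_eqF ?mulr_gt0//; apply: le_lt_trans h2 _; clear; lra.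
  have h4 : `|zh| < e2.
    rewrite ltNge; apply/negP => h5; have := norm_le_dotp zh.
    rewrite leNgt => /negP; apply; apply: lt_le_trans h3 _.
    by apply: ler_pM => //; exact: ltW.
  by split; apply: lt_trans h4 _; rewrite /e2 gt_min; apply/orP; [left|right]; [move: rho0|move: d0]; clear; lra.
have [zrho zd] := zh2.
pose v := - (2 * mu) *: zh.
have sub eta : tube rho eta1 eta -> dotp eta tau = 0 -> - e <= F eta - F 0 - dotp v eta.
  move=> te eta0.
  (* First order optimality: convexity compares [F] at [zh + s (eta - zh)] with its values at [zh]
     and [eta], and only the part linear in [s] survives as [s] tends to 0. The point stays
     admissible because [|zh| < rho] strictly. *)
  have k1 : 0 <= (F eta - F zh + 2 * mu * dotp zh (eta - zh)).
    pose s0 := Num.min 1 ((rho - `|zh|) / (`|eta - zh| + 1)).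
    have s00 : 0 < s0 by rewrite lt_min ltr01 divr_gt0// subr_gt0.
    apply: (@limit_ge0 _ (mu * dotp (eta - zh) (eta - zh)) s0 s00) => s /andP[sp].
    rewrite lt_min => /andP[s1 s2].
    have s01 : 0 <= s <= 1 by rewrite !ltW.
    pose zs := (1 - s) *: zh + s *: eta.
    have zsE : zs = zh + s *: (eta - zh) by rewrite /zs scalerBl scale1r scalerBr -addrA [- _ + _]addrC.
    have Czs : C zs.
      split; last by rewrite /zs dotpDl !dotpZl zht eta0 !mulr0 addr0.
      rewrite subr0 zsE; apply: le_trans (ler_normD _ _) _; rewrite normrZ (gtr0_norm sp).
      rewrite ltr_pdivlMr// mulrDr mulr1 in s2; move: s2 sp; clear; lra.
    have [Gb sh] := Hs _ (tC _ Czh); have [_ se] := Hs _ te; have [_ ss] := Hs _ (tC _ Czs).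
    set u := gf G (x, yb, zb) in sh se ss; set pb := gfx G (x, yb, zb) in sh se ss.
    have comb (r : R) : (1 - r) *: (pb + zh) + r *: (pb + eta) = pb + ((1 - r) *: zh + r *: eta).
      by rewrite !scalerDr addrACA -scalerDl subrK scale1r.
    have := @gA3w R n G tau x u (pb + zh) (pb + eta) _ _ s _ _ (gW G yb zb x zs) s01 sh se _.
    rewrite comb -/zs => /(_ _ _ ss).
    have a1 : forall r : R, 0 <= r <= 1 -> exists w, Sol (dom G) (gf G) (gfx G) x u ((1 - r) *: (pb + zh) + r *: (pb + eta)) w.
      move=> r r01; rewrite comb; exists (gW G yb zb x ((1 - r) *: zh + r *: eta)).
      by have [_ hr] := Hs _ (tube_convex te rzh r01).
    have a2 : dotp (pb + eta - (pb + zh)) tau = 0.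
      by rewrite opprD addrACA subrr add0r dotpBl eta0 zht subrr.
    move=> /(_ a1 a2); rewrite -!/(Fq G yb zb x tau _) -/F => cv.
    have mz := zmin _ Czs.
    have ez : dotp zs zs = dotp zh zh + s * (2 * dotp zh (eta - zh)) + s * s * dotp (eta - zh) (eta - zh).
      rewrite zsE; move: (eta - zh) => k; rewrite !dotpDl !dotpDr !dotpZl !dotpZr (dotpC k zh).
      by move: (dotp zh zh) (dotp zh k) (dotp k k) => u1 u2 u3; ring.
    rewrite ez in mz.
    rewrite -(pmulr_rge0 _ sp).
    move: mz cv; move: (F zs) (F zh) (F eta) (dotp zh zh) (dotp zh (eta - zh)) (dotp (eta - zh) (eta - zh)).
    move=> f1 f2 f3 u1 u2 u3; clear; lra.
  have k2 := Hd _ zd.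
  rewrite /v dotpZl; rewrite dotpBr in k1.
  have := mulr_ge0 (ltW mu0) zz0; move: k1 k2; rewrite -/F.
  move: (F zh) (F eta) (F 0) (dotp zh eta) (dotp zh zh) => f1 f2 f3 u1 u2; clear; lra.
exists v => //.
rewrite ler_pdivlMr//.
have [->|v0] := eqVneq v 0; first by rewrite normr0 mul0r addr_ge0// mulr_ge0.
have nv : 0 < `|v| by rewrite normr_gt0.
(* [v] is a multiple of [zh], hence orthogonal to [tau]; testing the inequality in its own direction
   at distance [rho] bounds it by the oscillation [2 M] plus [e <= 1]. *)
pose eta := (rho / `|v|) *: v.
have ne : `|eta| = rho.
  by rewrite normrZ ger0_norm ?divr_ge0 ?(ltW rho0)// divfK// gt_eqF.
have te : tube rho eta1 eta by apply: tube_small; rewrite ne.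
have et : dotp eta tau = 0 by rewrite /eta /v !dotpZl zht !mulr0.
have := sub _ te et; have := HM _ te.
have h : `|v| * rho <= dotp v eta.
  rewrite /eta dotpZr mulrC.
  apply: (@le_trans _ _ (rho / `|v| * (`|v| * `|v|))); first by rewrite mulrA divfK// gt_eqF.
  by rewrite ler_wpM2l ?norm_le_dotp// divr_ge0// ltW.
move: h hM0 e1; rewrite -!/(F _) !ler_norml; move: (F eta) (F 0) (dotp v eta) => f1 f2 u1 h /andP[k1 k2] k3 /andP[k4 k5] k6.
move: h k1 k2 k3 k4 k5 k6; clear; lra.
Qed.

End Node.

(** * The Euler scheme *)

Section Exist.
Context {R : realType} {n : nat}.
Local Notation X := 'rV[R]_n.
Local Notation XYZ := (X * X * R)%type.
Variable G : @gdata R n.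
Implicit Types (x y b tau eta : X) (t z : R) (w : XYZ).

(** One Euler step, with constant acceleration [- v1]. The speed bound [V] reproduces itself: up to
    time [1 / 4] the velocity drifts by at most [V / 4], and [V] is more than twice [|tau0|]. *)
Lemma extend_curve (xs yb tau0 eta1 v1 : X) (zb r1 h V V0 del rho : R) (c T v : R -> X) :
  0 <= r1 -> 0 < h -> r1 + h <= 1 / 4 -> 0 <= V0 -> V = 2 * (`|tau0| + V0) + 1 -> `|v1| <= V0 ->
  good_curve G xs yb zb tau0 eta1 r1 V del rho c T v ->
  (forall u, 0 <= u < h -> forall eta, tube rho eta1 eta -> dotp eta (T r1 - u *: v1) = 0 ->
    let x := c r1 + u *: T r1 - (u * u / 2) *: v1 in let tau := T r1 - u *: v1 in
    - del <= Fq G yb zb x tau eta - Fq G yb zb x tau 0 - dotp v1 eta) ->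
  exists c' T' v' : R -> X, good_curve G xs yb zb tau0 eta1 (r1 + h) V del rho c' T' v'.
Proof.
move=> r10 h0 rh V00 VE v1V GC Hnew.
have t00 : 0 <= `|tau0| by [].
have V1 : 0 < V by move: VE V00 t00; clear; lra.
have VV0 : V0 <= V by move: VE V00 t00; clear; lra.
pose pc u := c r1 + u *: T r1 - (u * u / 2) *: v1.
pose c' t := if t <= r1 then c t else pc (t - r1).
pose T' t := if t <= r1 then T t else T r1 - (t - r1) *: v1.
pose v' t := if t < r1 then v t else v1.
have c'1 t : t <= r1 -> c' t = c t by rewrite /c' => ->.
have T'1 t : t <= r1 -> T' t = T t by rewrite /T' => ->.
have pc0 : pc 0 = c r1 by rewrite /pc scale0r !mul0r scale0r subr0 addr0.
have c'2 t : r1 <= t -> c' t = pc (t - r1).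
  rewrite le_eqVlt => /orP[/eqP <-|rt]; first by rewrite c'1// subrr pc0.
  by rewrite /c' leNgt rt.
have T'2 t : r1 <= t -> T' t = T r1 - (t - r1) *: v1.
  rewrite le_eqVlt => /orP[/eqP <-|rt]; first by rewrite T'1// subrr scale0r subr0.
  by rewrite /T' leNgt rt.
have r1r1 : 0 <= r1 <= r1 by rewrite r10 lexx.
have pcE (u s : R) : pc (u + s) = pc u + s *: (T r1 - u *: v1) - (s * s / 2) *: v1.
  by rewrite /pc; apply/rowP => i; rewrite !mxE; field.
have Tr1 := gc_T GC r1r1.
have nT : `|T r1| <= `|tau0| + V * r1.
  by rewrite -[T r1](subrK tau0) addrC; apply: le_trans (ler_normD _ _) _; rewrite lerD2l.
have Vr : V * r1 + V * h <= V / 4.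
  by have := ler_wpM2l (ltW V1) rh; clear; lra.
have V0h : V0 * h <= V * h by exact: ler_wpM2r (ltW h0) _ _ VV0.
have lipp (u s : R) : 0 <= u <= h -> 0 <= s <= h -> `|pc u - pc s| <= V * `|u - s|.
  move=> /andP[u0 u1] /andP[s0 s1].
  have -> : pc u - pc s = (u - s) *: (T r1 - ((u + s) / 2) *: v1).
    by rewrite /pc; apply/rowP => i; rewrite !mxE; field.
  rewrite normrZ mulrC ler_wpM2r//; apply: le_trans (ler_normB _ _) _.
  rewrite normrZ ger0_norm; last by rewrite divr_ge0// addr_ge0.
  have h1 : (u + s) / 2 * `|v1| <= h * V0 by apply: ler_pM => //; [rewrite divr_ge0// addr_ge0|move: u1 s1; clear; lra].
  move: h1 nT V0h Vr VE t00 V00; rewrite [h * V0]mulrC; clear; lra.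
have lip t t' : 0 <= t -> t <= t' -> t' <= r1 + h -> `|c' t - c' t'| <= V * `|t - t'|.
  move=> t0 tt t'r.
  have [t'1|t'1] := leP t' r1.
    have t1 := le_trans tt t'1; rewrite !c'1//; apply: (gc_lip GC); first by rewrite t0.
    by rewrite t'1 (le_trans t0).
  have [t1|t1] := leP r1 t.
    rewrite !c'2 ?(ltW t'1)//; apply: le_trans (lipp _ _ _ _) _.
    - by rewrite subr_ge0 t1 lerBlDl (le_trans tt).
    - by rewrite subr_ge0 (ltW t'1) lerBlDl.
    - by rewrite opprB addrA subrK.
  have a1 : `|c' t - c' r1| <= V * `|t - r1|.
    by rewrite !c'1 ?(ltW t1)//; apply: (gc_lip GC) => //; rewrite t0 ltW.
  have a2 : `|c' r1 - c' t'| <= V * `|r1 - t'|.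
    rewrite !c'2 ?(ltW t'1)//; apply: le_trans (lipp _ _ _ _) _.
    - by rewrite subrr lexx ltW.
    - by rewrite subr_ge0 (ltW t'1) lerBlDl.
    - by rewrite opprB addrA subrK.
  rewrite -(subrKA (c' r1)); apply: le_trans (ler_normD _ _) _.
  apply: le_trans (lerD a1 a2) _; rewrite -mulrDr ler_wpM2l ?(ltW V1)//.
  rewrite !ler0_norm ?subr_le0 ?(ltW t1) ?(ltW t'1)//; clear; lra.
exists c', T', v'; split.
- by rewrite c'1// (gc_0 GC).
- by rewrite T'1// (gc_T0 GC).
- move=> t /andP[t0 tr]; have [t1|t1] := ltP t r1.
    have ti : 0 <= t < r1 by rewrite t0.
    have [s0 s00 hs] := gc_right GC ti.
    exists (Num.min s0 (r1 - t)); first by rewrite lt_min s00 subr_gt0.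
    move=> s /andP[sp]; rewrite lt_min => /andP[s1 s2].
    rewrite c'1; last by rewrite -lerBrDl ltW.
    by rewrite c'1 ?(ltW t1)// T'1 ?(ltW t1)// /v' t1 hs// sp.
  exists 1 => // s /andP[sp _].
  rewrite c'2; last by rewrite (le_trans t1)// lerDl.
  have -> : t + s - r1 = (t - r1) + s by ring.
  by rewrite c'2// T'2// /v' ltNge t1 /= pcE.
- move=> t /andP[t0 tr]; have [t1|t1] := leP t r1.
    have ti : 0 < t <= r1 by rewrite t0.
    have [s0 s00 [w hs]] := gc_left GC ti.
    exists s0 => //; exists w => s ss; have /andP[sp _] := ss.
    by rewrite c'1 ?(le_trans _ t1) ?gerBl// c'1// T'1// hs.
  exists (t - r1); first by rewrite subr_gt0.
  exists v1 => s /andP[sp st].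
  rewrite c'2; last by rewrite lerBrDl -lerBrDr ltW.
  have -> : t - s - r1 = (t - r1) + - s by ring.
  by rewrite (c'2 t) ?(ltW t1)// T'2 ?(ltW t1)// pcE scaleNr mulrNN.
- move=> t t' /andP[t0 t1] /andP[t'0 t'1]; have [tt|tt] := leP t t'; first exact: lip.
  by rewrite distrC (distrC t); apply: lip => //; exact: ltW.
- move=> t /andP[t0 tr]; have [t1|t1] := leP t r1.
    by rewrite T'1//; apply: (gc_T GC); rewrite t0.
  rewrite T'2 ?(ltW t1)// addrAC; apply: le_trans (ler_normB _ _) _.
  rewrite normrZ gtr0_norm ?subr_gt0//.
  have : (t - r1) * `|v1| <= (t - r1) * V by rewrite ler_wpM2l ?subr_ge0 ?(ltW t1)// (le_trans v1V).
  move: Tr1; clear; lra.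
- move=> t /andP[t0 tr]; have [t1|t1] := leP t r1.
    by rewrite c'1//; apply: (gc_c GC); rewrite t0.
  rewrite c'2 ?(ltW t1)//; set u := t - r1; have u0 : 0 < u by rewrite subr_gt0.
  have -> : pc u - xs - t *: tau0 = (c r1 - xs - r1 *: tau0) + (u *: (T r1 - tau0) - (u * u / 2) *: v1).
    have -> : t = r1 + u by rewrite /u addrC subrK.
    by rewrite /pc; apply/rowP => i; rewrite !mxE; ring.
  apply: le_trans (ler_normD _ _) _; apply: le_trans (lerD (gc_c GC r1r1) (ler_normB _ _)) _.
  have uu : 0 <= u * u / 2 by rewrite divr_ge0// mulr_ge0// ltW.
  rewrite normrZ (normrZ (u * u / 2)) (gtr0_norm u0) (ger0_norm uu).
  have h1 : u * `|T r1 - tau0| <= u * (V * r1) by rewrite ler_wpM2l// ltW.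
  have h2 : u * u / 2 * `|v1| <= u * u / 2 * V.
    by rewrite ler_wpM2l// (le_trans v1V).
  have -> : t = r1 + u by rewrite /u addrC subrK.
  have h3 : 0 <= V * u * u by rewrite !mulr_ge0// ltW.
  have h4 : 0 <= V * r1 * u by rewrite !mulr_ge0// ltW.
  move: h1 h2 h3 h4; clear; lra.
- move=> t /andP[t0 tr] eta te; have [t1|t1] := ltP t r1.
    rewrite c'1 ?(ltW t1)// T'1 ?(ltW t1)// /v' t1; apply: (gc_sub GC) => //; by rewrite t0.
  rewrite c'2// T'2// /v' ltNge t1 /=; apply: Hnew => //.
  by rewrite subr_ge0 t1 ltrBlDl.
Qed.

Lemma curve_exists (xs yb tau0 eta1 : X) (zb : R) :
  dom G (xs, yb, zb) -> tau0 != 0 ->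
  (forall s : R, 0 <= s <= 1 -> exists w, gsol G xs (gf G (xs, yb, zb)) (gfx G (xs, yb, zb) + s *: eta1) w) ->
  exists rho V r : R, [/\ 0 < rho, 0 < V, 0 < r & forall del r1 : R, 0 < del -> 0 < r1 <= r ->
    exists c T v, good_curve G xs yb zb tau0 eta1 r1 V del rho c T v].
Proof.
move=> Gb tau00 Hs.
have [rho1 rho10 Hreg] := region_open Gb Hs.
have nn : 0 <= n%:R :> R := ler0n _ _.
have kap0 : 0 < `|tau0| by rewrite normr_gt0.
(* Velocities within [r2] of [tau0] have norm at least [r2], which controls the projection onto
   their orthogonal hyperplane. *)
pose r2 := `|tau0| / 2; have r20 : 0 < r2 by rewrite divr_gt0.
pose KK : set (X * X * X) := ([set v | `|v - xs| <= rho1] `*` [set v | `|v - tau0| <= r2]) `*` tube rho1 eta1.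
have cK : compact KK.
  by apply: compact_setX; [apply: compact_setX; exact: compact_rV_ball|exact: tube_compact].
pose Ff (p : X * X * X) := Fq G yb zb p.1.1 p.1.2 p.2.
have cF p : KK p -> {for p, continuous Ff}.
  case: p => [[x tau] eta] [[/= h1 h2] h3]; have [Gx sx] := Hreg x eta h1 h3.
  exact: (@Fq_cts R n G yb zb x tau eta Gx (ex_intro _ _ sx)).
have [M M0 HM] := compact_bound cK cF.
pose V0 := (2 * M + 1) / rho1; have V00 : 0 < V0 by rewrite divr_gt0// ltr_wpDl// mulr_ge0.
pose V := 2 * (`|tau0| + V0) + 1.
have V1 : 0 < V by rewrite /V ltr_wpDl// mulr_ge0// addr_ge0// ltW.
pose rr := Num.min (1 / 4) (Num.min (rho1 / V) (r2 / V)).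
have rr0 : 0 < rr by rewrite !lt_min !divr_gt0.
(* The tube is halved so that vectors still belong to the tube of radius [rho1] after projection. *)
exists (rho1 / 2), V, rr; split => //; first by rewrite divr_gt0.
move=> del r1 del0 /andP[r10 r1r].
(* Four errors of size [e] add up: one at the node, two from the uniform continuity of [Fq], one
   from replacing [eta] by its projection in [v1 . eta]. *)
pose e := Num.min 1 (del / 4).
have e0 : 0 < e by rewrite lt_min ltr01 divr_gt0.
have e1 : e <= 1 by rewrite ge_min lexx.
have edel : 4 * e <= del by rewrite mulrC -ler_pdivlMr// ge_min lexx orbT.
have [d d0 Hd] := compact_unif_cts cK cF e0.
pose EE := `|eta1| + rho1; have EE0 : 0 < EE by rewrite /EE ltr_wpDl.
(* |eta - eta'| <= C h *)
pose C := n%:R * EE * V0 / r2 * 3 + 1.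
have C0 : 0 < C.
  rewrite /C; apply: ltr_wpDl => //; apply: mulr_ge0 => //; apply: divr_ge0; last exact: ltW.
  exact: mulr_ge0 (mulr_ge0 nn (ltW EE0)) (ltW V00).
pose hm := Num.min (Num.min (d / 2 / V) (d / 2 / C)) (Num.min (rho1 / 2 / C) (e / (n%:R * V0 * C + 1))).
have nvc : 0 < n%:R * V0 * C + 1 by exact: ltr_wpDl (mulr_ge0 (mulr_ge0 nn (ltW V00)) (ltW C0)) ltr01.
have hm0 : 0 < hm by rewrite !lt_min (divr_gt0 _ V1) ?(divr_gt0 _ C0) ?(divr_gt0 _ nvc)// ?divr_gt0.
have [N hN] : exists N : nat, r1 / hm < N%:R by exists (Num.bound (r1 / hm)); apply: archi_boundP; rewrite divr_ge0// ltW.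
have N0 : (0 < N)%N by rewrite -(ltr0n R); apply: lt_trans hN; rewrite divr_gt0.
have N0' : 0 < N%:R :> R by rewrite ltr0n.
pose h := r1 / N%:R; have h0 : 0 < h by rewrite divr_gt0.
have hhm : h < hm by rewrite /h ltr_pdivrMr// mulrC -ltr_pdivrMr.
have [hV hC hrho hnv] : [/\ V * h < d / 2 , C * h < d / 2, C * h <= rho1 / 2 & (n%:R * V0 * C + 1) * h <= e].
  move: hhm; rewrite /hm !lt_min => /andP[/andP[k1 k2] /andP[k3 k4]]; split.
  - by rewrite mulrC -ltr_pdivlMr.
  - by rewrite mulrC -ltr_pdivlMr.
  - by rewrite mulrC -ler_pdivlMr// ltW.
  - by rewrite mulrC -ler_pdivlMr// ltW.
suff: forall k : nat, (k <= N)%N -> exists c T v, good_curve G xs yb zb tau0 eta1 (k%:R * h) V del (rho1 / 2) c T v.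
  by move=> /(_ N (leqnn _)); rewrite /h mulrC divfK// gt_eqF.
elim=> [_|k IH kN].
  rewrite mul0r; exists (fun=> xs), (fun=> tau0), (fun=> 0); split => //.
  - by move=> t /andP[a b]; have := le_lt_trans a b; rewrite ltxx.
  - by move=> t /andP[a b]; have := lt_le_trans a b; rewrite ltxx.
  - by move=> t t' _ _; rewrite subrr normr0 mulr_ge0// ltW.
  - by move=> t /andP[a b]; rewrite subrr normr0 mulr_ge0// ltW.
  - move=> t; rewrite -eq_le => /eqP <-.
    by rewrite scale0r subrr subr0 normr0 !mulr0.
  - by move=> t /andP[a b]; have := le_lt_trans a b; rewrite ltxx.
have [c [T [v GC]]] := IH (ltnW kN).
have rk : k%:R * h + h <= r1.
  have -> : k%:R * h + h = k.+1%:R * h by rewrite -natr1 mulrDl mul1r.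
  by rewrite /h mulrCA ler_piMr ?(ltW r10)// ler_pdivrMr// mul1r ler_nat.
have kh0 : 0 <= k%:R * h by rewrite mulr_ge0// ltW.
set s := k%:R * h in GC rk kh0 *.
have ss : 0 <= s <= s by rewrite lexx kh0.
have [rr1 rr2 rr3] : [/\ rr <= 1 / 4, V * rr <= rho1 & V * rr <= r2].
  split; first by rewrite ge_min lexx.
    by rewrite mulrC -ler_pdivlMr// /rr !ge_min lexx ?orbT.
  by rewrite mulrC -ler_pdivlMr// /rr !ge_min lexx ?orbT.
have sr : s + h <= rr by exact: le_trans rk r1r.
have Vs : V * s <= V * rr by rewrite ler_wpM2l ?(ltW V1)//; move: sr h0; clear; lra.
have xr : `|c s - xs| <= rho1.
  have := gc_lip GC (t := s) (t' := 0) ss; rewrite lexx kh0 (gc_0 GC) subr0 ger0_norm// => /(_ isT) h1.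
  by apply: le_trans h1 (le_trans Vs _).
have Tr : `|T s - tau0| <= r2 by apply: le_trans (gc_T GC ss) (le_trans Vs _).
have KKs eta : tube rho1 eta1 eta -> KK (c s, T s, eta) by move=> te; split; [split|].
have [v1 v1V Hv1] : exists2 v, `|v| <= V0 & forall eta, tube rho1 eta1 eta -> dotp eta (T s) = 0 ->
    - e <= Fq G yb zb (c s) (T s) eta - Fq G yb zb (c s) (T s) 0 - dotp v eta.
  have t0 : tube rho1 eta1 0 by apply: tube_small; rewrite normr0 ltW.
  pose d' := Num.min d rho1; have d'0 : 0 < d' by rewrite lt_min d0.
  apply: (@node_subgradient R n G yb xs (c s) (T s) eta1 zb rho1 M d' e) => //.
  - by rewrite e0.
  - by move=> eta te; exact: Hreg.
  - by move=> eta te; exact: HM (KKs _ te).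
  - move=> eta; rewrite lt_min => /andP[ed er].
    have := Hd (c s, T s, 0) (c s, T s, eta) (KKs _ t0).
    have -> : `|(c s, T s, eta) - (c s, T s, 0)| = `|eta|.
      by rewrite norm2E norm2E /= !subrr !normr0 maxxx subr0 max_r.
    move=> /(_ ed); rewrite /Ff /= ltr_norml => /andP[k1 _]; move: k1; clear; lra.
have -> : k.+1%:R * h = s + h by rewrite -natr1 mulrDl mul1r.
have tT : r2 <= `|T s|.
  have := ler_normB (T s) (T s - tau0).
  have -> : T s - (T s - tau0) = tau0 by rewrite opprB addrC subrK.
  move: Tr; rewrite /r2; clear; lra.
apply: (@extend_curve xs yb tau0 eta1 v1 zb s h V V0 del (rho1 / 2) c T v) => //.
- exact: le_trans sr rr1.
- exact: ltW.
move=> u /andP[u0 uh] eta te etaT; cbv zeta.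
set x := c s + u *: T s - (u * u / 2) *: v1; set tau := T s - u *: v1 in etaT *.
have TT0 : 0 < dotp (T s) (T s).
  by apply: dotp_gt0; rewrite -normr_gt0; exact: lt_le_trans tT.
(* The velocity turns during the step while [v1] is a subgradient for the hyperplane at the node. So
   [eta] is projected onto that hyperplane, at distance at most [C h] as
   [eta . T s = u (eta . v1)]. *)
pose kk := dotp eta (T s) / dotp (T s) (T s).
pose eta' := eta - kk *: T s.
have eta'T : dotp eta' (T s) = 0 by rewrite dotpBl dotpZl divfK ?subrr// gt_eqF.
have dn : `|kk *: T s| <= C * h.
  have e1' : dotp eta (T s) = dotp eta (u *: v1).
    by have := etaT; rewrite /tau dotpBr => /eqP; rewrite subr_eq0 => /eqP.
  have ne : `|eta| <= EE by apply: le_trans (tube_norm te) _; rewrite /EE lerD2l; move: rho10; clear; lra.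
  have h1 : `|dotp eta (T s)| <= n%:R * EE * (V0 * h).
    rewrite e1'; apply: le_trans (dotp_le _ _) _; apply: ler_pM; rewrite ?mulr_ge0// ?ler_wpM2l//.
    by rewrite normrZ ger0_norm// mulrC; apply: ler_pM => //; exact: ltW.
  rewrite normrZ normrM normfV (gtr0_norm TT0) mulrAC ler_pdivrMr//.
  have h2 : `|dotp eta (T s)| * `|T s| <= n%:R * EE * (V0 * h) * `|T s| by rewrite ler_wpM2r.
  apply: le_trans h2 _.
  have h3 : `|T s| * r2 <= dotp (T s) (T s).
    by apply: le_trans (norm_le_dotp _); rewrite ler_wpM2l.
  apply: (@le_trans _ _ (C * h * (`|T s| * r2))); last by rewrite ler_wpM2l// mulr_ge0// ltW.
  have -> : C * h * (`|T s| * r2) = n%:R * EE * (V0 * h) * `|T s| * 3 + h * `|T s| * r2.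
    by rewrite /C; field; rewrite gt_eqF.
  have k1 : 0 <= n%:R * EE * (V0 * h) * `|T s|.
    exact: mulr_ge0 (mulr_ge0 (mulr_ge0 nn (ltW EE0)) (mulr_ge0 (ltW V00) (ltW h0))) (normr_ge0 _).
  have k2 : 0 <= h * `|T s| * r2 by exact: mulr_ge0 (mulr_ge0 (ltW h0) (normr_ge0 _)) (ltW r20).
  by move: k1 k2; clear; lra.
have te' : tube rho1 eta1 eta'.
  have [q q01 hq] := te; exists q => //.
  have -> : eta' - q *: eta1 = (eta - q *: eta1) - kk *: T s by rewrite /eta' addrAC.
  apply: le_trans (ler_normB _ _) _; move: hq dn hrho; clear; lra.
have t0 : tube rho1 eta1 0 by apply: tube_small; rewrite normr0 ltW.
have xd : `|x - c s| < d.
  have -> : x - c s = u *: (T s - (u / 2) *: v1).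
    by rewrite /x; apply/rowP => i; rewrite !mxE; field.
  rewrite normrZ ger0_norm//.
  have nT : `|T s - (u / 2) *: v1| <= V.
    apply: le_trans (ler_normB _ _) _; rewrite normrZ ger0_norm ?divr_ge0//.
    have nTs : `|T s| <= `|tau0| + r2.
      by rewrite -[T s](subrK tau0) addrC; apply: le_trans (ler_normD _ _) _; rewrite lerD2l.
    have u1 : u <= 1 by apply: le_trans (ltW uh) _; move: sr rr1 kh0; clear; lra.
    have h1 : u / 2 * `|v1| <= 1 * V0 by apply: ler_pM => //; [rewrite divr_ge0|move: u1 u0; clear; lra].
    by move: nTs h1 V00 kap0; rewrite /V /r2; clear; lra.
  apply: (@le_lt_trans _ _ (h * V)); first by apply: ler_pM => //; exact: ltW.
  by rewrite mulrC; apply: lt_trans hV _; move: d0; clear; lra.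
have taud : `|tau - T s| < d.
  rewrite /tau addrAC subrr add0r normrN normrZ ger0_norm//.
  apply: (@le_lt_trans _ _ (h * V)); last by rewrite mulrC; apply: lt_trans hV _; move: d0; clear; lra.
  apply: ler_pM => //; first exact: ltW.
  by apply: le_trans v1V _; rewrite /V; move: V00 kap0; clear; lra.
have etad : `|eta - eta'| < d.
  rewrite /eta' opprB addrC subrK; apply: le_lt_trans dn _; apply: lt_trans hC _; move: d0; clear; lra.
have n3 (a1 a2 a3 b1 b2 b3 : X) : `|a1 - b1| < d -> `|a2 - b2| < d -> `|a3 - b3| < d -> `|(a1, a2, a3) - (b1, b2, b3)| < d.
  by move=> k1 k2 k3; rewrite norm2E norm2E /= !gt_max k1 k2 k3.
have dd0 : `|(0 : X) - 0| < d by rewrite subrr normr0.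
have := Hd _ _ (KKs _ te') (n3 _ _ _ _ _ _ xd taud etad).
have := Hd _ _ (KKs _ t0) (n3 _ _ _ _ _ _ xd taud dd0).
have := Hv1 _ te' eta'T.
have hv : `|dotp v1 eta - dotp v1 eta'| <= e.
  rewrite -dotpBr; apply: le_trans (dotp_le _ _) _; rewrite /eta' opprB addrC subrK.
  apply: (@le_trans _ _ (n%:R * V0 * (C * h))); first by apply: ler_pM; rewrite ?mulr_ge0// ler_wpM2l.
  apply: le_trans hnv; have -> : n%:R * V0 * (C * h) = (n%:R * V0 * C + 1) * h - h by ring.
  by rewrite gerBl ltW.
rewrite /Ff /= -/tau; move: hv edel; rewrite !ltr_norml ler_norml.
move: (Fq G yb zb x tau eta) (Fq G yb zb x tau 0) (Fq G yb zb (c s) (T s) eta') (Fq G yb zb (c s) (T s) 0) (dotp v1 eta) (dotp v1 eta').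
move=> f1 f2 f3 f4 u1 u2 /andP[j1 j2] j3 j4 /andP[j5 j6] /andP[j7 j8].
move: j1 j2 j3 j4 j5 j6 j7 j8; clear; lra.
Qed.

End Exist.

(** * Propagation of a contact *)

Section Contact.
Context {R : realType} {n : nat}.
Local Notation X := 'rV[R]_n.
Local Notation XYZ := (X * X * R)%type.
Variable G : @gdata R n.
Implicit Types (x y b tau eta : X) (t z : R) (w : XYZ).

Lemma compact_seq_cluster (V : normedModType R) (K : set V) (f : nat -> V) :
  compact K -> (forall N, K (f N)) ->
  exists2 x, K x & forall (e : R) (M : nat), 0 < e -> exists2 N, (M <= N)%N & `|f N - x| < e.
Proof.
move=> cK Kf; have fK : (f @ \oo) K by exists 0%N => // N _; exact: Kf.
have [x [Kx cx]] := cK (f @ \oo) _ fK; exists x => // e M e0.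
have h1 : (f @ \oo) (f @` [set N | (M <= N)%N]).
  by exists M => // N /= MN; exists N.
have h2 : nbhs x [set v | `|v - x| < e].
  by apply/near_normP; exists e.
by have [v [[N MN <-] vx]] := cx _ _ h1 h2; exists N.
Qed.

Lemma cluster_le (V : normedModType R) (f h : V -> R) (v : nat -> V) (x : V) :
  {for x, continuous f} -> {for x, continuous h} ->
  (forall (e : R) (M : nat), 0 < e -> exists2 N, (M <= N)%N & `|v N - x| < e) ->
  (forall m : R, 0 < m -> exists M : nat, forall N, (M <= N)%N -> f (v N) - m <= h (v N)) ->
  f x <= h x.
Proof.
move=> cf ch Hv Hm; apply/ler_addgt0Pl => e e0.
have e3 : 0 < e / 3 by rewrite divr_gt0.
have /cvg_normP/(_ _ e3)[d1 d10 D1] := cf.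
have /cvg_normP/(_ _ e3)[d2 d20 D2] := ch.
have [M HM] := Hm _ e3.
have [|N MN] := Hv (Num.min d1 d2) M; first by rewrite lt_min d10.
rewrite lt_min => /andP[n1 n2].
have := D1 _ n1; have := D2 _ n2; have := HM _ MN; rewrite !ltr_norml.
move=> k1 /andP[k2 k3] /andP[k4 k5]; move: k1 k2 k3 k4 k5; clear; lra.
Qed.

Lemma two_sided_zero (a : R) : (forall e : R, 0 < e -> exists2 d : R, 0 < d & forall theta : R, `|theta| < d ->
    0 <= theta * a + e * `|theta|) -> a = 0.
Proof.
move=> Hp; apply/eqP; rewrite eq_le; apply/andP; split.
  apply/ler_addgt0Pl => e e0; have [d d00 D] := Hp e e0.
  have d2 : 0 < d / 2 by rewrite divr_gt0.
  have := D (- (d / 2)); rewrite normrN gtr0_norm// => /(_ _)/wrap[].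
    by move: d00; clear; lra.
  by move=> h; rewrite addr0 -(ler_pM2l d2); move: h; clear; lra.
apply/ler_addgt0Pl => e e0; have [d d00 D] := Hp e e0.
have d2 : 0 < d / 2 by rewrite divr_gt0.
have := D (d / 2); rewrite gtr0_norm// => /(_ _)/wrap[].
  by move: d00; clear; lra.
by move=> h; rewrite -(ler_pM2l d2); move: h; clear; lra.
Qed.

Section Level.
Variables (xs yb : X) (zb : R).
Let wb : XYZ := (xs, yb, zb).
Hypothesis Gb : dom G wb.

(** The derivative of Y(xs, u, p) with respect to p in the direction [eta]; that of Z is its product
    with Q. *)
Let ydir eta : X := eta *m (invmx (gE G wb))^T.

(** [gsol_open] gives a nearby solution without a rate. Injectivity of the derivative in (y, z)
    first bounds its distance [k] to [(yb, zb)] by a multiple of [theta], then, used again, the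
    error to first order. *)
Lemma level_curve eta (e : R) : 0 < e -> exists2 d : R, 0 < d & forall theta : R, `|theta| < d ->
  exists y z, gsol G xs (gf G wb) (gfx G wb + theta *: eta) (xs, y, z) /\
    `|y - yb - theta *: ydir eta| <= e * `|theta| /\
    `|z - zb - theta * dotp (gQ G wb) (ydir eta)| <= e * `|theta|.
Proof.
move=> e0; set b0 := ydir eta; set zeta0 := dotp _ _.
have [C C0 HC] := yz_deriv_bound Gb.
have z0 := gfz_neq0 Gb; have Eu := gE_unit Gb.
have E1 : b0 *m (gfxy G wb)^T + zeta0 *: gfxz G wb = eta.
  transitivity (b0 *m (gE G wb)^T); last first.
    by rewrite /b0 /ydir -mulmxA -trmx_mul mulmxV// trmx1 mulmx1.
  have -> : (gE G wb)^T = (gfxy G wb)^T - (gfz G wb)^-1 *: ((gfy G wb)^T *m gfxz G wb).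
    apply/matrixP => i j; rewrite !mxE; congr (_ - _ * _).
    by apply: eq_bigr => k _; rewrite !mxE mulrC.
  rewrite mulmxBr -scalemxAr mulmxA.
  have -> : b0 *m (gfy G wb)^T = (dotp (gfy G wb) b0)%:M.
    by apply/matrixP => i j; rewrite !ord1 dotpC /dotp !mxE eqxx mulr1n; apply: eq_bigr => k _; rewrite mxE.
  by rewrite mul_scalar_mx scalerA /zeta0 /gQ dotpZl mulNr scaleNr.
have E2 : dotp (gfy G wb) b0 + gfz G wb * zeta0 = 0.
  by rewrite (gQP Gb) dotpZl -/zeta0 mulNr addNr.
pose M := `|eta| + 1; have M0 : 0 < M by rewrite /M ltr_wpDl.
pose e1 := Num.min (2 * C)^-1 (e / (C * (2 * C * M))).
have CM : 0 < C * (2 * C * M) by rewrite !mulr_gt0.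
have e10 : 0 < e1 by rewrite lt_min invr_gt0 mulr_gt0//= divr_gt0.
have e1C : C * e1 <= 1 / 2.
  have : e1 <= (2 * C)^-1 by rewrite ge_min lexx.
  rewrite -(ler_pM2l C0) invfM => h; apply: le_trans h _.
  by rewrite mulrCA divff ?gt_eqF// mulr1 mul1r.
have e1M : C * e1 * (2 * C * M) <= e.
  by rewrite mulrAC mulrC -ler_pdivlMr// ge_min lexx orbT.
have J := gjet G.
have [d1 d10 D1] := jet_g J Gb e10; have [d2 d20 D2] := jet_gx J Gb e10.
have [|d3 d30 D3] := @gsol_open R n G wb Gb (Num.min d1 d2); first by rewrite lt_min d10.
exists (d3 / M); first by rewrite divr_gt0.
move=> theta; rewrite ltr_pdivlMr// => th.
have [|||w sw] := D3 xs (gf G wb) (gfx G wb + theta *: eta).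
- by rewrite subrr normr0.
- by rewrite subrr normr0.
- rewrite addrAC subrr add0r normrZ; apply: le_lt_trans th; rewrite ler_wpM2l// /M lerDl//.
have [Gw + gw gxw] := sw; case: w Gw gw gxw sw => [[x y] z] Gw gw gxw sw /= xE; subst x.
rewrite lt_min => /andP[w1 w2].
have wb1 : `|wb - wb| < d1 by rewrite subrr normr0.
have wb2 : `|wb - wb| < d2 by rewrite subrr normr0.
exists y, z; split => //.
have := D1 _ _ w1 wb1; have := D2 _ _ w2 wb2; rewrite gw gxw.
have -> : (xs, y, z) - wb = (0, y - yb, z - zb).
  by apply/pair_equal_spec; split; [apply/pair_equal_spec; split|] => //=; exact: subrr.
rewrite /dvec /lin3 /= mul0mx add0r dotp0r add0r subrr sub0r normrN.
have -> : gfx G wb + theta *: eta - gfx G wb = theta *: eta by rewrite addrAC subrr add0r.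
set k := `|(0, _, _)|; move=> h2 h1.
have kE : k = Num.max `|y - yb| `|z - zb|.
  by rewrite /k norm3E /= normr0 [Num.max 0 _]max_r.
have kb : k <= C * (`|theta| * M + e1 * k).
  have [] := HC (y - yb) (z - zb) (`|theta| * M + e1 * k).
  - have -> : (y - yb) *m (gfxy G wb)^T + (z - zb) *: gfxz G wb =
      theta *: eta - (theta *: eta - ((y - yb) *m (gfxy G wb)^T + (z - zb) *: gfxz G wb)).
      by rewrite subKr.
    apply: le_trans (ler_normB _ _) _; apply: lerD => //.
    by rewrite normrZ ler_wpM2l// /M lerDl.
  - by apply: le_trans h1 _; rewrite lerDr mulr_ge0// ltW.
  by move=> j1 j2; rewrite kE ge_max -kE j1 j2.
have k2 : k <= 2 * C * M * `|theta|.
  have kk : C * e1 * k <= 1 / 2 * k by rewrite ler_wpM2r ?normr_ge0.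
  move: kb kk; clear; lra.
have k3 : C * (e1 * k) <= e * `|theta|.
  rewrite mulrA; apply: le_trans (ler_wpM2l (ltW (mulr_gt0 C0 e10)) k2) _.
  by rewrite mulrA ler_wpM2r.
have [||j1 j2] := HC (y - yb - theta *: b0) (z - zb - theta * zeta0) (e1 * k).
- rewrite mulmxBl -scalemxAl scalerBl -scalerA.
  have -> : (y - yb) *m (gfxy G wb)^T - theta *: (b0 *m (gfxy G wb)^T) +
    ((z - zb) *: gfxz G wb - theta *: (zeta0 *: gfxz G wb)) =
    (y - yb) *m (gfxy G wb)^T + (z - zb) *: gfxz G wb - theta *: eta.
    by rewrite -[in RHS]E1 scalerDr opprD addrACA.
  by rewrite distrC.
- rewrite dotpBr dotpZr mulrBr.
  have -> : dotp (gfy G wb) (y - yb) - theta * dotp (gfy G wb) b0 + (gfz G wb * (z - zb) - gfz G wb * (theta * zeta0)) =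
    dotp (gfy G wb) (y - yb) + gfz G wb * (z - zb) - theta * (dotp (gfy G wb) b0 + gfz G wb * zeta0) by ring.
  by rewrite E2 mulr0 subr0.
by split; [exact: le_trans j1 k3|exact: le_trans j2 k3].
Qed.

(** Moving along the level curve in both directions [theta] and [- theta] is allowed, with equality
    at [theta = 0]; the one-sided comparison at [xt] thus forces the first order term to vanish. *)
Lemma level_orth (xt tau0 eta : X) (nu : R) : dom G (xt, yb, zb) -> 0 < nu ->
  (forall y' z', `|y' - yb| < nu -> `|z' - zb| < nu -> gf G (xs, y', z') = gf G wb ->
    dotp (gfx G (xs, y', z') - gfx G wb) tau0 = 0 -> gf G (xt, yb, zb) <= gf G (xt, y', z')) ->
  dotp eta tau0 = 0 -> dotp (gPhi G (gQ G wb) (xt, yb, zb)) (ydir eta) = 0.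
Proof.
move=> Gt nu0 H et; set wt := (xt, yb, zb); set b0 := ydir eta; set q := gQ G wb.
have -> : dotp (gPhi G q wt) b0 = dotp (gfy G wt) b0 + gfz G wt * dotp q b0.
  by rewrite /gPhi dotpDl dotpZl.
set zeta0 := dotp q b0.
apply: two_sided_zero => e e0.
pose B := `|b0| + `|zeta0| + 1; have B0 : 0 < B by rewrite /B ltr_wpDl// addr_ge0.
pose Y1 := n%:R * `|gfy G wt| + `|gfz G wt| + 1.
have Y0 : 0 < Y1 by rewrite /Y1 ltr_wpDl// addr_ge0// mulr_ge0.
pose e1 := Num.min 1 (e / 2 / Y1); pose e2 := e / 2 / B.
have e10 : 0 < e1 by rewrite lt_min ltr01 !divr_gt0.
have e20 : 0 < e2 by rewrite !divr_gt0.
have e1Y : e1 * Y1 <= e / 2 by rewrite -ler_pdivlMr// ge_min lexx orbT.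
have e11 : e1 <= 1 by rewrite ge_min lexx.
have e2B : e2 * B <= e / 2 by rewrite /e2 divfK// gt_eqF.
have [d1 d10 D1] := level_curve eta e10.
have [d2 d20 D2] := jet_g (gjet G) Gt e20.
pose m := Num.min nu d2; have m0 : 0 < m by rewrite lt_min nu0.
exists (Num.min d1 (m / B)); first by rewrite lt_min d10 divr_gt0.
move=> theta; rewrite lt_min ltr_pdivlMr// => /andP[t1 t2].
have [y' [z' [[Gw _ gw gxw] [hy hz]]]] := D1 _ t1.
have te : e1 * `|theta| <= `|theta| by rewrite ler_piMl.
have ny : `|y' - yb| <= `|theta| * B.
  rewrite -[y' - yb](subrK (theta *: b0)); apply: le_trans (ler_normD _ _) _.
  rewrite normrZ; have : 0 <= `|theta| * `|zeta0| by rewrite mulr_ge0.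
  move: hy te; rewrite -/b0 /B; clear; lra.
have nz : `|z' - zb| <= `|theta| * B.
  rewrite -[z' - zb](subrK (theta * zeta0)); apply: le_trans (ler_normD _ _) _.
  rewrite normrM; have : 0 <= `|theta| * `|b0| by rewrite mulr_ge0.
  move: hz te; rewrite -/b0 -/q -/zeta0 /B; clear; lra.
have [mn md] : m <= nu /\ m <= d2 by rewrite !ge_min !lexx orbT.
have := H y' z'; rewrite gw gxw => /(_ _ _ erefl _)/wrap[].
- by apply: le_lt_trans ny _; exact: lt_le_trans t2 mn.
- by apply: le_lt_trans nz _; exact: lt_le_trans t2 mn.
- by rewrite addrAC subrr add0r dotpZl et mulr0.
move=> hle.
have := D2 (xt, y', z') wt.
have kE : (xt, y', z') - wt = (0, y' - yb, z' - zb).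
  by apply/pair_equal_spec; split; [apply/pair_equal_spec; split|] => //=; exact: subrr.
have nk : `|(xt, y', z') - wt| <= `|theta| * B.
  by rewrite kE norm3E /= normr0 !ge_max ny nz mulr_ge0// ltW.
have n0 : `|wt - wt| < d2 by rewrite subrr normr0.
have n1 : `|(xt, y', z') - wt| < d2 by apply: le_lt_trans nk _; exact: lt_le_trans t2 md.
move=> /(_ n1 n0); set k := `|(xt, y', z') - wt| in nk *; rewrite kE /lin3 /= dotp0r add0r => h.
have h1 : e2 * k <= e / 2 * `|theta|.
  apply: le_trans (ler_wpM2l (ltW e20) nk) _.
  by rewrite mulrCA mulrC ler_wpM2r.
pose ry := y' - yb - theta *: b0; pose rz := z' - zb - theta * zeta0.
have E : dotp (gfy G wt) (y' - yb) + gfz G wt * (z' - zb) =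
  theta * (dotp (gfy G wt) b0 + gfz G wt * zeta0) + (dotp (gfy G wt) ry + gfz G wt * rz).
  by rewrite /ry /rz !dotpBr dotpZr; ring.
have h2 : `|dotp (gfy G wt) ry + gfz G wt * rz| <= e / 2 * `|theta|.
  apply: (@le_trans _ _ ((n%:R * `|gfy G wt| + `|gfz G wt|) * (e1 * `|theta|))).
    apply: le_trans (ler_normD _ _) _; rewrite mulrDl normrM; apply: lerD.
      by apply: le_trans (dotp_le _ _) _; rewrite ler_wpM2l// mulr_ge0.
    by rewrite ler_wpM2l.
  rewrite mulrA ler_wpM2r// mulrC; apply: le_trans e1Y.
  by rewrite ler_wpM2l ?(ltW e10)// /Y1 lerDl.
move: h h1 h2 hle; rewrite E; set A1 := theta * _; set A2 := dotp (gfy G wt) ry + _.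
move: (gf G wt) (gf G (xt, y', z')) => a1 a2; clearbody A1 A2 k; clear.
rewrite !ler_norml => /andP[k1 k2] k3 /andP[k4 k5] k6; lra.
Qed.

End Level.

End Contact.

Section Contact2.
Context {R : realType} {n : nat}.
Local Notation X := 'rV[R]_n.
Local Notation XYZ := (X * X * R)%type.
Variable G : @gdata R n.
Implicit Types (x y b tau eta : X) (t z : R) (w : XYZ).

Lemma cts_base (f : XYZ -> R) x y z : {for (x, y, z), continuous f} ->
  {for x, continuous (fun x' : X => f (x', y, z))}.
Proof.
move=> /cvg_normP H; apply/cvg_normP => e /H[d d0 D]; exists d => // x' xx'.
by apply: D; rewrite norm_base.
Qed.

Lemma good_curve_le (xs yb tau0 eta1 : X) (zb r V del del' rho : R) (c T v : R -> X) : del <= del' ->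
  good_curve G xs yb zb tau0 eta1 r V del rho c T v -> good_curve G xs yb zb tau0 eta1 r V del' rho c T v.
Proof.
move=> dd [h1 h2 h3 h4 h5 h6 h7 h8]; split => // t tr eta te et.
by apply: le_trans (h8 t tr eta te et); rewrite lerN2.
Qed.

(** [tau0 = dq E^-1] is the initial velocity that moves Q along [dq], up to the positive factor
    [- 1 / g_z]. The exact position on the line of Q is recovered from the comparison itself, not
    from the curve. *)
Lemma contact_propagates (xs yb y1 dq : X) (zb z1 : R) :
  let wb := (xs, yb, zb) in let w1 := (xs, y1, z1) in
  dom G wb -> dom G w1 -> gf G w1 = gf G wb ->
  (forall s : R, 0 <= s <= 1 -> exists w, gsol G xs (gf G wb) (gfx G wb + s *: (gfx G w1 - gfx G wb)) w) ->
  dq != 0 -> dotp (gfx G w1 - gfx G wb) (dq *m invmx (gE G wb)) = 0 ->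
  forall e : R, 0 < e -> exists s x, [/\ 0 < s < e, `|x - xs| < e, dom G (x, yb, zb),
    gQ G (x, yb, zb) = gQ G wb + s *: dq & gf G (x, yb, zb) <= gf G (x, y1, z1)].
Proof.
move=> wb w1 Gb G1 g1b Hs dq0; set eta1 := gfx G w1 - gfx G wb in Hs *; set tau0 := dq *m _ => et0 e e0.
have Eu := gE_unit Gb; have nn : 0 <= n%:R :> R := ler0n _ _.
have tE : tau0 *m gE G wb = dq by rewrite /tau0 mulmxKV.
have tau00 : tau0 != 0 by apply: contra_neq dq0 => h; rewrite -tE h mul0mx.
have [rho [V [r0 [rho0 V0 r00 Hc]]]] := curve_exists Gb tau00 Hs.
have s0 : exists2 s : R, 0 <= s <= 1 & gfx G wb - gfx G wb = s *: eta1.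
  by exists 0; rewrite ?lexx ?ler01// scale0r subrr.
have s1 : exists2 s : R, 0 <= s <= 1 & gfx G w1 - gfx G wb = s *: eta1.
  by exists 1; rewrite ?lexx ?ler01// scale1r.
(* The same curves are used twice: near [(yb, zb)], with zero gradient difference, to locate the
   limit point, and at [(y1, z1)] to carry the contact there. *)
have [ra ra0 [nua nua0 Ha]] := curve_lemma Gb Gb tau00 rho0 V0 s0.
have [rb rb0 [nub nub0 Hb]] := curve_lemma Gb G1 tau00 rho0 V0 s1.
pose r := Num.min r0 (Num.min ra rb).
have r10 : 0 < r by rewrite !lt_min r00 ra0.
have [rr0 rra rrb] : [/\ r <= r0, r <= ra & r <= rb] by rewrite /r !ge_min !lexx !orbT.
have [db db0 Db] := open_norm (jet_open (gjet G)) Gb.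
have [d1 d10 D1] := open_norm (jet_open (gjet G)) G1.
have N0 : 0 < `|dq| by rewrite normr_gt0.
pose S := `|tau0| + V; have S0 : 0 < S by rewrite /S ltr_wpDl.
pose e1 := `|dq| / 4 / S; have e10 : 0 < e1 by rewrite !divr_gt0.
have [d2 d20 D2] := gPhi_strict Gb e10.
pose cz := - gfz G wb / 2.
have cz0 : 0 < cz by rewrite divr_gt0// oppr_gt0; exact: gfz_lt0.
have [d3 d30 D3] : exists2 d : R, 0 < d & forall w, `|w - wb| < d -> cz <= - gfz G w.
  have /near_normP[d d0 D] := near_close (cts_gfz Gb) cz0; exists d => // w /D.
  by rewrite ler_norml => /andP[_]; rewrite /cz; clear; lra.
pose K1 := n%:R * V * `|gE G wb| + 1; have K10 : 0 < K1.
  by apply: ltr_wpDl => //; exact: mulr_ge0 (mulr_ge0 nn (ltW V0)) (normr_ge0 _).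
pose DD := Num.min (Num.min e db) (Num.min d1 (Num.min d2 d3)).
have DD0 : 0 < DD by rewrite !lt_min e0 db0 d10 d20.
pose t := Num.min (Num.min (r / 2) 1) (Num.min (DD / 2 / S) (Num.min (`|dq| / 4 / K1) (e * cz / 3))).
have t0 : 0 < t.
  by rewrite !lt_min ltr01 !andbT !divr_gt0//= mulr_gt0.
have [tr t1 tD tK te] : [/\ t < r, t <= 1, S * t < DD, K1 * t <= `|dq| / 4 & 3 * t <= e * cz].
  have [h1 h2 h3] : [/\ t <= r / 2, t <= 1 & t <= DD / 2 / S].
    by rewrite /t !ge_min !lexx !orbT.
  have [h4 h5] : t <= `|dq| / 4 / K1 /\ t <= e * cz / 3 by rewrite /t !ge_min !lexx !orbT.
  split => //.
  - by move: h1 r10; clear; lra.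
  - have : S * t <= DD / 2 by rewrite mulrC -ler_pdivlMr.
    by move: DD0; clear; lra.
  - by rewrite mulrC -ler_pdivlMr.
  - by move: h5; clear; lra.
have /choice[c HcN] : forall N : nat, exists c : R -> X, exists T v : R -> X,
    good_curve G xs yb zb tau0 eta1 r V N.+1%:R^-1 rho c T v.
  by move=> N; apply: Hc; rewrite ?invr_gt0 ?ltr0n// r10.
have t01 : 0 <= t <= r by rewrite !ltW.
have t02 : 0 <= t < r by rewrite ltW.
have cK := @compact_rV_ball R n (xs + t *: tau0) (V * t * t).
(* Only the positions at the fixed time [t] pass to the limit; they stay within [V t^2] of the
   straight motion. *)
have [|xt Kx Hx] := compact_seq_cluster (f := fun N => c N t) cK.
  by move=> N /=; have [T [v GC]] := HcN N; rewrite opprD addrA; exact: (gc_c GC).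
have nx0 : `|xt - xs - t *: tau0| <= V * t * t by move: Kx; rewrite /= opprD addrA.
have nx : `|xt - xs| <= S * t.
  rewrite -[xt - xs](subrK (t *: tau0)); apply: le_trans (ler_normD _ _) _.
  rewrite normrZ (gtr0_norm t0); have h : V * t * t <= V * t.
    by rewrite ler_piMr// mulr_ge0// ltW.
  by move: nx0 h; rewrite /S; clear; lra.
have nxD := le_lt_trans nx tD.
have [xe xb x1 x2 x3] : [/\ `|xt - xs| < e, `|xt - xs| < db, `|xt - xs| < d1, `|xt - xs| < d2 & `|xt - xs| < d3].
  by move: nxD; rewrite /DD !lt_min => /andP[/andP[-> ->] /and3P[-> -> ->]].
have Gt : dom G (xt, yb, zb) by apply: Db; rewrite norm_base.
have Gt1 : dom G (xt, y1, z1) by apply: D1; rewrite norm_base.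
have key y' z' : dom G (xt, y', z') ->
  (forall m : R, 0 < m -> exists2 del : R, 0 < del & forall c T v : R -> X,
    good_curve G xs yb zb tau0 eta1 r V del rho c T v -> gf G (c t, yb, zb) - m <= gf G (c t, y', z')) ->
  gf G (xt, yb, zb) <= gf G (xt, y', z').
  move=> G' Hm.
  apply: (cluster_le (cts_base (cts_gf Gt)) (cts_base (cts_gf G')) Hx) => m m0.
  have [del del0 Hdel] := Hm _ m0.
  have [M hM] : exists M : nat, del^-1 < M%:R by exists (Num.bound del^-1); apply: archi_boundP; rewrite invr_ge0 ltW.
  exists M => N MN; have [T [v GC]] := HcN N.
  apply: Hdel; apply: good_curve_le GC.
  rewrite invf_ple ?posrE ?ltr0n//; apply: le_trans (ltW hM) _.
  by rewrite ler_nat (leq_trans MN).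
have r1a : 0 < r <= ra by rewrite r10.
have r1b : 0 < r <= rb by rewrite r10.
pose nu := Num.min nua db; have nu0 : 0 < nu by rewrite lt_min nua0.
pose Phi := gPhi G (gQ G wb) (xt, yb, zb).
(* Vectors orthogonal to [tau0] annihilate [Phi E^-1], so [Phi] is a multiple [k] of [dq]: the limit
   point lies on the line of Q through [xs] in the direction [dq]. *)
have orth eta : dotp eta tau0 = 0 -> dotp (Phi *m invmx (gE G wb)) eta = 0.
  move=> et; rewrite dotp_mulmx; apply: (level_orth Gb Gt nu0 _ et) => y' z'.
  rewrite !lt_min => /andP[ya yd] /andP[za zd] g' p'.
  apply: key.
    by apply: Db; apply/norm3_lt; split.
  move=> m m0; have [del del0 H] := Ha _ _ ya za g' p' m m0; exists del => // c' T v GC.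
  exact: H r1a GC _ t02.
have [k hk] := dotp_orth_span orth.
have Pk : Phi = k *: dq by rewrite -tE scalemxAl -hk mulmxKV.
have h1 := D2 (xt, yb, zb) wb (gQ G wb).
have {}h1 : `|Phi - (xt - xs) *m gE G wb| <= e1 * `|xt - xs|.
  have P0 : gPhi G (gQ G wb) wb = 0 by apply/gPhi_eq0.
  move: h1; rewrite P0 subr0 /= norm_base !subrr !normr0; apply => //.
(* [Phi] is [(xt - xs) E] up to a small error and [xt - xs] is [t tau0] up to [V t^2]; hence [k] is
   close to [t], in particular positive, and the contact moves forward. *)
have hkt : `|k - t| <= t / 2.
  rewrite -(ler_pM2r N0) -normrZ.
  have -> : (k - t) *: dq = (Phi - (xt - xs) *m gE G wb) + (xt - xs - t *: tau0) *m gE G wb.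
    by rewrite [(xt - xs - _) *m _]mulmxBl -scalemxAl tE addrA subrK scalerBl Pk.
  apply: le_trans (ler_normD _ _) _.
  have j1 : e1 * `|xt - xs| <= `|dq| / 4 * t.
    by rewrite (le_trans (ler_wpM2l (ltW e10) nx))// mulrA /e1 divfK// gt_eqF.
  have j2 : `|(xt - xs - t *: tau0) *m gE G wb| <= `|dq| / 4 * t.
    apply: le_trans (mulmx_norm _ _) _.
    have j3 : n%:R * `|xt - xs - t *: tau0| * `|gE G wb| <= n%:R * (V * t * t) * `|gE G wb|.
      by rewrite ler_wpM2r// ler_wpM2l.
    apply: le_trans j3 _.
    have -> : n%:R * (V * t * t) * `|gE G wb| = (K1 * t - t) * t by rewrite /K1; ring.
    by rewrite ler_wpM2r ?(ltW t0)//; move: tK t0; clear; lra.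
  by move: h1 j1 j2; clear; lra.
have kb : t / 2 <= k /\ k <= 2 * t.
  by move: hkt t0; rewrite ler_norml => /andP[]; clear; split; lra.
have zt := D3 (xt, yb, zb); rewrite norm_base in zt; have {}zt := zt x3.
have zt0 : 0 < - gfz G (xt, yb, zb) by exact: lt_le_trans zt.
exists (k / - gfz G (xt, yb, zb)), xt; split => //.
- apply/andP; split; first by rewrite divr_gt0//; move: kb t0; clear; case; lra.
  rewrite ltr_pdivrMr//; apply: (@lt_le_trans _ _ (e * cz)); last by rewrite ler_wpM2l// ltW.
  by move: kb te t0; clear; case; lra.
- rewrite invrN mulrN scaleNr -[k / _]mulrC -scalerA -Pk /Phi /gPhi.
  rewrite scalerDr scalerA mulVf ?gfz_neq0// scale1r /gQ -/wb scaleNr.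
  by rewrite opprD addrCA subrr addr0.
- apply: key => // m m0.
  have ny1 : `|y1 - y1| < nub by rewrite subrr normr0.
  have nz1 : `|z1 - z1| < nub by rewrite subrr normr0.
  have [del del0 H] := Hb _ _ ny1 nz1 g1b et0 m m0; exists del => // c' T v GC.
  exact: H r1b GC _ t02.
Qed.

End Contact2.

(** * g-segments and heights *)

Section Compactness.
Context {R : realType}.

Lemma compact_sublevel (V : normedModType R) (A : set V) (f : V -> R) : compact A ->
  (forall a, A a -> forall e : R, 0 < e -> exists2 d : R, 0 < d &
     forall x, A x -> `|x - a| < d -> `|f x - f a| < e) ->
  compact [set x | A x /\ f x <= 0].
Proof.
move=> cA Hf; apply: (@subclosed_compact _ _ A) => //; last by move=> x [].
have clA : closed A by apply: compact_closed => //; exact: norm_hausdorff.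
move=> x cx; have Ax : A x.
  by apply: clA; apply: closureS cx => y [].
split => //; rewrite leNgt; apply/negP => fx.
have [d d0 D] := Hf x Ax _ fx.
have [y [[Ay fy] /= yd]] := cx _ ((near_normP x (fun y => `|y - x| < d)).2 (ex_intro2 _ _ d d0 (fun y h => h))).
have := D y Ay yd; rewrite ltr_norml => /andP[h _]; move: h fy; clear; lra.
Qed.

Lemma last_contact (h : R -> R) (t0 : R) : 0 <= t0 <= 1 -> h t0 <= 0 ->
  (forall t, 0 <= t <= 1 -> forall e : R, 0 < e -> exists2 d : R, 0 < d &
     forall t', 0 <= t' <= 1 -> `|t' - t| < d -> `|h t' - h t| < e) ->
  exists t1, [/\ t0 <= t1 <= 1, h t1 <= 0 & forall t, t1 < t <= 1 -> 0 < h t].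
Proof.
move=> t001 ht0 ch.
have cK : compact [set t : R | `[0, 1]%classic t /\ h t <= 0].
  apply: compact_sublevel; first exact: segment_compact.
  move=> t; rewrite /= in_itv /= => t01 e e0; have [d d0 D] := ch t t01 e e0.
  by exists d => // t' /=; rewrite in_itv /=; exact: D.
have [||t1 [t101 ht1] tm] := compact_min (f := fun t : R => - t) _ cK.
- by exists t0; split => //=; rewrite in_itv.
- move=> t _ e e0; exists e => // t' _; by rewrite -opprD normrN.
rewrite /= in_itv /= in t101; have /andP[t10 t11] := t101.
exists t1; split => //.
  by rewrite t11 andbT -lerN2; apply: tm; split => //=; rewrite in_itv.
move=> t /andP[t1t t1']; rewrite ltNge; apply/negP => ht.
have t01 : 0 <= t <= 1 by rewrite t1' (le_trans t10) ?ltW.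
by have := tm t; rewrite lerN2 leNgt t1t /= in_itv /= => /(_ (conj t01 ht)).
Qed.

(** The continuity method: take the least [s] at which [h <= 0] somewhere; just before it [h] is
    positive, so at it [h >= 0], which the last hypothesis upgrades to positivity. *)
Lemma propagate01 (h : R -> R -> R) :
  (forall s t, 0 <= s <= 1 -> 0 <= t <= 1 -> forall e : R, 0 < e -> exists2 d : R, 0 < d &
     forall s' t', 0 <= s' <= 1 -> 0 <= t' <= 1 -> `|s' - s| < d -> `|t' - t| < d -> `|h s' t' - h s t| < e) ->
  (forall t, 0 <= t <= 1 -> 0 < h 0 t) ->
  (forall s, 0 <= s <= 1 -> (forall t, 0 <= t <= 1 -> 0 <= h s t) -> forall t, 0 <= t <= 1 -> 0 < h s t) ->
  forall s t, 0 <= s <= 1 -> 0 <= t <= 1 -> 0 < h s t.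
Proof.
move=> ch h0 hs s t s01 t01; rewrite ltNge; apply/negP => hst.
pose K : set (R * R) := [set v | (`[0, 1]%classic `*` `[0, 1]%classic) v /\ h v.1 v.2 <= 0].
have KE v : K v <-> [/\ 0 <= v.1 <= 1, 0 <= v.2 <= 1 & h v.1 v.2 <= 0].
  by rewrite /K /= !in_itv /=; split; [move=> [[]]|move=> []].
have cK : compact K.
  apply: compact_sublevel; first by apply: compact_setX; exact: segment_compact.
  move=> [a b]; rewrite /= !in_itv /= => -[a01 b01] e e0; have [d d0 D] := ch a b a01 b01 e e0.
  exists d => // -[a' b'] /=; rewrite !in_itv /= => -[a'01 b'01].
  by rewrite norm2E gt_max /= => /andP[]; exact: D.
have [||[s1 t1] /KE /= [s101 t101 h1] smin] := compact_min (f := fun v : R * R => v.1) _ cK.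
- by exists (s, t); apply/KE.
- move=> v _ e e0; exists e => // v' _; by rewrite norm2E gt_max => /andP[].
have s1p : 0 < s1.
  have /andP[s10 _] := s101; rewrite lt_neqAle s10 andbT; apply/eqP => s1E.
  by move: h1; rewrite -s1E leNgt h0.
have hpos (s' t' : R) : 0 <= s' < s1 -> 0 <= t' <= 1 -> 0 < h s' t'.
  move=> /andP[s'0 s's] t'01; rewrite ltNge; apply/negP => h'.
  have : K (s', t') by apply/KE; split => //=; rewrite s'0 (le_trans (ltW s's)); case/andP: s101.
  by move=> /smin /=; rewrite leNgt s's.
have := hs s1 s101 _ t1 t101; rewrite ltNge h1 => /(_ _)/wrap[] // t' t'01.
rewrite leNgt; apply/negP => h'.
have h'0 : 0 < - h s1 t' by rewrite oppr_gt0.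
have [d d0 D] := ch s1 t' s101 t'01 _ h'0.
pose s2 := Num.max 0 (s1 - d / 2).
have s20 : 0 <= s2 by rewrite le_max lexx.
have s21 : s2 < s1 by rewrite gt_max s1p/= gtrBl divr_gt0.
have s22 : s1 - d / 2 <= s2 by rewrite le_max lexx orbT.
have i1 : 0 <= s2 <= 1 by rewrite s20 (le_trans (ltW s21)); case/andP: s101.
have i2 : 0 <= s2 < s1 by rewrite s20.
have := D s2 t' i1 t'01; rewrite subrr normr0 => /(_ _ d0)/wrap[].
  by rewrite ltr0_norm ?subr_lt0//; move: s22 d0; clear; lra.
rewrite ltr_norml => /andP[_ k]; have := hpos s2 t' i2 t'01; move: k; clear; lra.
Qed.

End Compactness.

(** * Heights relative to y0 and g-segments *)

Section Setting.
Context {R : realType} {n : nat}.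
Local Notation X := 'rV[R]_n.
Local Notation XYZ := (X * X * R)%type.
Variable G : @gdata R n.

Lemma gf_decr_z (x y : X) (z1 z2 : R) : (forall z, z1 <= z <= z2 -> dom G (x, y, z)) -> z1 < z2 ->
  gf G (x, y, z2) < gf G (x, y, z1).
Proof.
move=> GI z12; pose w : XYZ := (x, y, z1); pose k : XYZ := (0, 0, z2 - z1).
have wk (s : R) : w + s *: k = (x, y, z1 + s * (z2 - z1)).
  by apply/pair_equal_spec; split; [apply/pair_equal_spec; split|] => //=; rewrite scaler0 addr0.
have Gs (s : R) : 0 <= s <= 1 -> dom G (w + s *: k).
  move=> /andP[s0 s1]; rewrite wk; apply: GI.
  have h1 : 0 <= s * (z2 - z1) by rewrite mulr_ge0// subr_ge0 ltW.
  have h2 : s * (z2 - z1) <= z2 - z1 by rewrite ler_piMl// subr_ge0 ltW.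
  by apply/andP; split; move: h1 h2; clear; lra.
have [s s01] := gf_mvt Gs.
have -> : w + k = (x, y, z2) by rewrite -[k]scale1r wk mul1r addrC subrK.
rewrite /k jet1E !dotp0r !add0r => E; rewrite -subr_lt0 E.
by rewrite pmulr_llt0 ?subr_gt0// gfz_lt0//; exact: Gs.
Qed.

(** What remains of the hypotheses once [y0] is fixed. [st_conv] is (i) at the heights attained by
    [phi]; the last clause of [st_supp] is (ii) for the gradients of g(., y0, phi xs) and of a local
    support. *)
Record setting (Omega : set X) (u : X -> R) (y0 : X) (phi : X -> R) : Prop := Setting {
  st_open : open Omega;
  st_conn : connected Omega;
  st_cts : forall x, Omega x -> {for x, continuous u};
  st_dom : forall x x', Omega x -> Omega x' -> dom G (x, y0, phi x');
  st_phi : forall x, Omega x -> gf G (x, y0, phi x) = u x;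
  st_conv : forall a b c (t : R), Omega a -> Omega b -> Omega c -> 0 <= t <= 1 ->
    exists2 x, Omega x & gQ G (x, y0, phi c) =
      (1 - t) *: gQ G (a, y0, phi c) + t *: gQ G (b, y0, phi c);
  st_int : forall x y z1 z2 z, dom G (x, y, z1) -> dom G (x, y, z2) -> z1 <= z <= z2 -> dom G (x, y, z);
  st_supp : forall xs, Omega xs -> exists y1 z1,
    [/\ dom G (xs, y1, z1), gf G (xs, y1, z1) = u xs,
        exists2 d : R, 0 < d & forall x, `|x - xs| < d -> gf G (x, y1, z1) <= u x
      & forall s : R, 0 <= s <= 1 -> exists w, gsol G xs (u xs)
          (gfx G (xs, y0, phi xs) + s *: (gfx G (xs, y1, z1) - gfx G (xs, y0, phi xs))) w] }.

Variables (Omega : set X) (u : X -> R) (y0 : X) (phi : X -> R).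
Hypothesis st : setting Omega u y0 phi.
Implicit Types (x a b c : X) (z t : R).

Lemma gf_decr x y (z1 z2 : R) : dom G (x, y, z1) -> dom G (x, y, z2) -> z1 < z2 ->
  gf G (x, y, z2) < gf G (x, y, z1).
Proof. by move=> G1 G2; apply: gf_decr_z => z; exact: (st_int st G1 G2). Qed.

(** An implicit function argument for a merely continuous [u]: g at the heights [phi x + e'] and
    [phi x - e'] lies strictly on either side of [u x], which persists nearby and traps [phi]. *)
Lemma phi_cts x : Omega x -> forall e : R, 0 < e -> exists2 d : R, 0 < d &
  forall x', `|x' - x| < d -> Omega x' /\ `|phi x' - phi x| < e.
Proof.
move=> Ox e e0; have Gx := st_dom st Ox Ox; have oG := jet_open (gjet G).
have [r r0 Dr] := open_norm oG Gx.
pose e' := Num.min e r / 2; have m0 : 0 < Num.min e r by rewrite lt_min e0.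
have e'0 : 0 < e' by rewrite divr_gt0.
have [me mr] : Num.min e r <= e /\ Num.min e r <= r by rewrite !ge_min !lexx orbT.
have e'e : e' < e by move: me m0; rewrite /e'; lra.
have e'r : e' < r by move: mr m0; rewrite /e'; lra.
have nz (z : R) : `|(x, y0, z) - (x, y0, phi x)| = `|z - phi x|.
  by rewrite norm3E /= !subrr !normr0 maxxx max_r.
have Gp : dom G (x, y0, phi x + e').
  by apply: Dr; rewrite nz addrAC subrr add0r gtr0_norm.
have Gm : dom G (x, y0, phi x - e').
  by apply: Dr; rewrite nz addrAC subrr add0r normrN gtr0_norm.
have lp := gf_decr Gx Gp; rewrite ltrDl (st_phi st Ox) in lp; have {}lp := lp e'0.
have lm := gf_decr Gm Gx; rewrite gtrBl (st_phi st Ox) in lm; have {}lm := lm e'0.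
have ep : 0 < (u x - gf G (x, y0, phi x + e')) / 2 by rewrite divr_gt0// subr_gt0.
have em : 0 < (gf G (x, y0, phi x - e') - u x) / 2 by rewrite divr_gt0// subr_gt0.
have /cvg_normP/(_ _ ep)[d1 d10 D1] := st_cts st Ox.
have /cvg_normP/(_ _ em)[d2 d20 D2] := st_cts st Ox.
have /cvg_normP/(_ _ ep)[d3 d30 D3] := cts_base (cts_gf Gp).
have /cvg_normP/(_ _ em)[d4 d40 D4] := cts_base (cts_gf Gm).
have [d5 d50 D5] := open_norm oG Gp.
have [d6 d60 D6] := open_norm oG Gm.
have [d7 d70 D7] := open_norm (st_open st) Ox.
exists (Num.min (Num.min (Num.min d1 d2) (Num.min d3 d4)) (Num.min (Num.min d5 d6) d7)).
  by rewrite !lt_min d10 d20 d30 d40 d50 d60.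
move=> x'; rewrite !lt_min => /andP[/andP[/andP[/D1 k1 /D2 k2] /andP[/D3 k3 /D4 k4]] /andP[/andP[x5 x6] /D7 Ox']].
split => //.
have Gp' : dom G (x', y0, phi x + e') by apply: D5; rewrite norm_base.
have Gm' : dom G (x', y0, phi x - e') by apply: D6; rewrite norm_base.
have Gx' := st_dom st Ox' Ox'; have ux' := st_phi st Ox'.
have hp : gf G (x', y0, phi x + e') < u x'.
  by move: k1 k3; rewrite !ltr_norml => /andP[j1 _] /andP[_ j2]; move: j1 j2; lra.
have hm : u x' < gf G (x', y0, phi x - e').
  by move: k2 k4; rewrite !ltr_norml => /andP[_ j1] /andP[j2 _]; move: j1 j2; lra.
have b1 : phi x' <= phi x + e'.
  rewrite leNgt; apply/negP => /(gf_decr Gp' Gx'); rewrite ux' => h.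
  by have := lt_trans h hp; rewrite ltxx.
have b2 : phi x - e' <= phi x'.
  rewrite leNgt; apply/negP => /(gf_decr Gx' Gm'); rewrite ux' => h.
  by have := lt_trans h hm; rewrite ltxx.
by rewrite ltr_distl; apply/andP; split; [apply: lt_le_trans b2|apply: le_lt_trans b1 _]; rewrite ?ltrD2l ?ltrN2.
Qed.

Definition heights : set R := [set phi c | c in Omega].

(** g-segments are available only at attained heights; this permits the height to be moved
    continuously between two of them. *)
Lemma heights_interval z1 z2 z : heights z1 -> heights z2 -> z1 <= z <= z2 -> heights z.
Proof.
have ci : connected heights.
  apply: connected_continuous_connected (st_conn st) _.
  apply: within_normP => x Ox e e0; have [d d0 D] := phi_cts Ox e0.
  by exists d => // x' _ /D[].
by move=> h1 h2; exact: (connected_intervalP heights).1 ci _ _ h1 h2 z.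
Qed.

(** For ends in [Omega], an attained height and [t] in [0, 1], the point exists by g-convexity and
    is unique by A1*, so the default [a] is not reached. *)
Definition seg a b z t : X :=
  xget a [set x | Omega x /\ gQ G (x, y0, z) = (1 - t) *: gQ G (a, y0, z) + t *: gQ G (b, y0, z)].

Lemma segP a b z t : Omega a -> Omega b -> heights z -> 0 <= t <= 1 ->
  Omega (seg a b z t) /\
  gQ G (seg a b z t, y0, z) = (1 - t) *: gQ G (a, y0, z) + t *: gQ G (b, y0, z).
Proof.
move=> Oa Ob [c Oc <-] t01; have [x Ox Ex] := st_conv st Oa Ob Oc t01.
exact: (@xgetPex _ a [set x | Omega x /\ _] (ex_intro _ x (conj Ox Ex))).
Qed.

Lemma heights_dom x z : Omega x -> heights z -> dom G (x, y0, z).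
Proof. by move=> Ox [c Oc <-]; exact (st_dom st Ox Oc). Qed.

Lemma seg_eq a b z t x : Omega a -> Omega b -> heights z -> 0 <= t <= 1 -> Omega x ->
  gQ G (x, y0, z) = (1 - t) *: gQ G (a, y0, z) + t *: gQ G (b, y0, z) -> seg a b z t = x.
Proof.
move=> Oa Ob Jz t01 Ox Ex; have [Os Es] := segP Oa Ob Jz t01.
apply: (@gQ_inj R n G _ _ y0 z); [exact: heights_dom|exact: heights_dom|].
exact: etrans Es (esym Ex).
Qed.

Lemma seg0 a b z : Omega a -> Omega b -> heights z -> seg a b z 0 = a.
Proof.
move=> Oa Ob Jz; apply: seg_eq => //; first by rewrite lexx ler01.
by rewrite subr0 scale1r scale0r addr0.
Qed.

Lemma seg1 a b z : Omega a -> Omega b -> heights z -> seg a b z 1 = b.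
Proof.
move=> Oa Ob Jz; apply: seg_eq => //; first by rewrite lexx ler01.
by rewrite subrr scale1r scale0r add0r.
Qed.

Lemma seg_id a z t : Omega a -> heights z -> 0 <= t <= 1 -> seg a a z t = a.
Proof. by move=> Oa Jz t01; apply: seg_eq => //; rewrite -scalerDl subrK scale1r. Qed.

(** The point is chosen, so continuity must come from uniqueness: [gQ_open] finds a solution for the
    perturbed data near the old point, openness puts it in [Omega], and injectivity of Q identifies
    it with the chosen one. *)
Lemma seg_cts a b z t : Omega a -> Omega b -> heights z -> 0 <= t <= 1 ->
  forall e : R, 0 < e -> exists2 d : R, 0 < d & forall b' z' t',
    Omega b' -> heights z' -> 0 <= t' <= 1 ->
    `|b' - b| < d -> `|z' - z| < d -> `|t' - t| < d -> `|seg a b' z' t' - seg a b z t| < e.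
Proof.
move=> Oa Ob Jz t01 e e0; have [] := segP Oa Ob Jz t01; set x := seg a b z t => Ox Ex.
have Gx := heights_dom Ox Jz; have Ga := heights_dom Oa Jz; have Gb := heights_dom Ob Jz.
have [r r0 Dr] := open_norm (st_open st) Ox.
have m0 : 0 < Num.min e r by rewrite lt_min e0.
have [d1 d10 D1] := gQ_open Gx m0.
have d3 : 0 < d1 / 3 by rewrite divr_gt0.
have /cvg_normP/(_ _ d3)[da da0 Da] := cts_gQ Ga.
have /cvg_normP/(_ _ d3)[db db0 Db] := cts_gQ Gb.
set qa := gQ G (a, y0, z) in Ex Da *; set qb := gQ G (b, y0, z) in Ex Db *.
pose M := `|qb - qa| + 1; have M0 : 0 < M by rewrite /M ltr_wpDl.
exists (Num.min (Num.min d1 da) (Num.min db (d1 / 3 / M))).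
  by rewrite !lt_min d10 da0 db0 divr_gt0.
move=> b' z' t' Ob' Jz' t'01; rewrite !lt_min => /andP[/andP[_ _] /andP[b3 _]].
move=> /andP[/andP[z1 z2] /andP[z3 _]] /andP[_ /andP[_ t4]].
rewrite ltr_pdivlMr// in t4.
have ha : `|gQ G (a, y0, z') - qa| < d1 / 3.
  by apply: Da; apply/norm3_lt; rewrite /= !subrr !normr0.
have hb : `|gQ G (b', y0, z') - qb| < d1 / 3.
  by apply: Db; apply/norm3_lt; rewrite /= !subrr !normr0.
set qa' := gQ G (a, y0, z') in ha *; set qb' := gQ G (b', y0, z') in hb *.
have /andP[t'0 t'1] := t'01.
have hq : `|(1 - t') *: qa' + t' *: qb' - gQ G (x, y0, z)| < d1.
  rewrite Ex.
  have -> : (1 - t') *: qa' + t' *: qb' - ((1 - t) *: qa + t *: qb) =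
    (1 - t') *: (qa' - qa) + t' *: (qb' - qb) + (t' - t) *: (qb - qa).
    by apply/rowP => i; rewrite !mxE; ring.
  apply: le_lt_trans (ler_normD _ _) _; apply: le_lt_trans (lerD (ler_normD _ _) (lexx _)) _.
  rewrite !normrZ (ger0_norm t'0) ger0_norm ?subr_ge0//.
  have j1 : (1 - t') * `|qa' - qa| <= `|qa' - qa| by rewrite ler_piMl// gerBl.
  have j2 : t' * `|qb' - qb| <= `|qb' - qb| by rewrite ler_piMl.
  have j3 : `|t' - t| * `|qb - qa| <= `|t' - t| * M by rewrite ler_wpM2l// /M lerDl.
  by move: j1 j2 j3 ha hb t4; lra.
have [x' [xx Gx' Ex']] := D1 z' _ z1 hq.
move: xx; rewrite lt_min => /andP[xe xr].
by rewrite (seg_eq Oa Ob' Jz' t'01 (Dr _ xr) Ex').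
Qed.

Lemma phi_seg_cts a b z t : Omega a -> Omega b -> heights z -> 0 <= t <= 1 ->
  forall e : R, 0 < e -> exists2 d : R, 0 < d & forall b' z' t',
    Omega b' -> heights z' -> 0 <= t' <= 1 ->
    `|b' - b| < d -> `|z' - z| < d -> `|t' - t| < d ->
    `|phi (seg a b' z' t') - phi (seg a b z t)| < e.
Proof.
move=> Oa Ob Jz t01 e e0; have [Os _] := segP Oa Ob Jz t01.
have [d d0 D] := phi_cts Os e0; have [d' d'0 D'] := seg_cts Oa Ob Jz t01 d0.
by exists d' => // b' z' t' Ob' Jz' t'01 h1 h2 h3; have [] := D _ (D' _ _ _ Ob' Jz' t'01 h1 h2 h3).
Qed.

End Setting.

(** * From local to global supports *)

Section Segments.
Context {R : realType} {n : nat}.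
Local Notation X := 'rV[R]_n.
Local Notation XYZ := (X * X * R)%type.
Variable G : @gdata R n.
Implicit Types (x a b c : X) (z t : R).

(** The derivative of Q in x is [- E / g_z], so its inverse sends [dq] to [- g_z dq E^-1]. *)
Lemma gQ_inverse_deriv (xs yb dq : X) (zb : R) : dom G (xs, yb, zb) ->
  forall e : R, 0 < e -> exists2 d : R, 0 < d & forall x (tau : R), `|x - xs| < d -> `|tau| < d ->
    gQ G (x, yb, zb) = gQ G (xs, yb, zb) + tau *: dq ->
    `|x - xs + (tau * gfz G (xs, yb, zb)) *: (dq *m invmx (gE G (xs, yb, zb)))| <= e * `|tau|.
Proof.
set wb := (xs, yb, zb) => Gb e e0; have Eu := gE_unit Gb; rewrite -/(gE G wb) in Eu.
set N := invmx (gE G wb); set dir := dq *m N.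
pose C := n%:R * `|N| + 1; have C0 : 0 < C by rewrite /C ltr_wpDl// mulr_ge0.
pose B := `|gfz G wb *: dir| + 1; have B0 : 0 < B by rewrite /B ltr_wpDl.
pose e1 := Num.min (1 / 2 / C) (e / (2 * B) / C).
have e10 : 0 < e1 by rewrite lt_min !divr_gt0// mulr_gt0.
have e1h : C * e1 <= 1 / 2 by rewrite mulrC -ler_pdivlMr// /e1 ge_min lexx.
have e1e : C * e1 <= e / (2 * B) by rewrite mulrC -ler_pdivlMr// /e1 ge_min lexx orbT.
have [d1 d10 D1] := gPhi_strict Gb e10.
have [d2 d20 D2] := open_norm (jet_open (gjet G)) Gb.
pose M := `|dq| + 1; have M0 : 0 < M by rewrite /M ltr_wpDl.
exists (Num.min (Num.min d1 d2) (d1 / M)); first by rewrite !lt_min d10 d20 divr_gt0.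
move=> x tau; rewrite !lt_min => /andP[/andP[x1 x2] _] /andP[_ t1] qx.
rewrite ltr_pdivlMr// in t1.
have Gx : dom G (x, yb, zb) by apply: D2; rewrite norm_base.
set v := _ + _.
have h := D1 (x, yb, zb) wb (gQ G (x, yb, zb)).
have P1 : gPhi G (gQ G (x, yb, zb)) (x, yb, zb) = 0 by apply/gPhi_eq0.
have P2 : gPhi G (gQ G (x, yb, zb)) wb = (tau * gfz G wb) *: dq.
  have /(gPhi_eq0 (gQ G wb) Gb) : gQ G wb = gQ G wb by [].
  by rewrite /gPhi qx scalerDr addrA => ->; rewrite add0r scalerA mulrC.
have vE : v *m gE G wb = (x - xs) *m gE G wb + (tau * gfz G wb) *: dq.
  by rewrite /v mulmxDl -scalemxAl /dir mulmxKV.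
have {}h : `|v *m gE G wb| <= e1 * `|x - xs|.
  move: h; rewrite P1 P2 sub0r -opprD normrN [(tau * _) *: _ + _]addrC -vE; apply => //.
  - by rewrite norm_base.
  - by rewrite subrr normr0.
  - rewrite qx addrAC subrr add0r normrZ; apply: le_lt_trans t1.
    by rewrite ler_wpM2l// /M lerDl.
have hv : `|v| <= C * e1 * `|x - xs|.
  rewrite -[v](mulmxK Eu) -/N; apply: le_trans (mulmx_norm _ _) _.
  rewrite mulrAC -[leRHS]mulrA; apply: ler_pM; rewrite ?mulr_ge0//.
  by rewrite /C lerDl.
have hx : `|x - xs| <= `|v| + `|tau| * B.
  have -> : x - xs = v - tau *: (gfz G wb *: dir) by rewrite /v scalerA addrK.
  apply: le_trans (ler_normB _ _) _; rewrite lerD2l normrZ ler_wpM2l// /B lerDl//.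
have hx2 : `|x - xs| <= 2 * B * `|tau|.
  have : C * e1 * `|x - xs| <= 1 / 2 * `|x - xs| by rewrite ler_wpM2r.
  move: hv hx; clear; lra.
apply: le_trans hv _; apply: (@le_trans _ _ (e / (2 * B) * (2 * B * `|tau|))).
  by apply: ler_pM => //; exact: mulr_ge0 (ltW C0) (ltW e10).
by rewrite mulrA divfK// gt_eqF// mulr_gt0.
Qed.

(** Along the path the difference of the two functions has an interior extremum at [xs]. The path
    need not be differentiable a priori; its first order behaviour is read off from Q. *)
Lemma path_orth (xs yb y1 dq : X) (zb z1 : R) (sig : R -> X) :
  let wb := (xs, yb, zb) in let w1 := (xs, y1, z1) in
  dom G wb -> dom G w1 -> gf G w1 = gf G wb ->
  (forall e : R, 0 < e -> exists2 d : R, 0 < d & forall tau : R, `|tau| < d ->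
     [/\ `|sig tau - xs| < e, gQ G (sig tau, yb, zb) = gQ G wb + tau *: dq
       & gf G (sig tau, y1, z1) <= gf G (sig tau, yb, zb)]) ->
  dotp (gfx G w1 - gfx G wb) (dq *m invmx (gE G wb)) = 0.
Proof.
move=> wb w1 Gb G1 g1b Hs; set eta1 := gfx G w1 - gfx G wb; set dir := dq *m _.
have z0 := gfz_neq0 Gb; have nn : 0 <= n%:R :> R := ler0n _ _.
suff: gfz G wb * dotp eta1 dir = 0 by move/eqP; rewrite mulf_eq0 (negbTE z0) => /eqP.
apply: two_sided_zero => e e0.
pose B := `|gfz G wb *: dir| + 1; have B0 : 0 < B by rewrite /B ltr_wpDl.
pose M := 2 * B + n%:R * `|eta1|.
have M0 : 0 < M by apply: ltr_pwDl; [rewrite mulr_gt0|exact: mulr_ge0].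
pose e1 := Num.min 1 (e / M).
have e10 : 0 < e1 by rewrite lt_min ltr01 divr_gt0.
have e11 : e1 <= 1 by rewrite ge_min lexx.
have e1M : e1 * M <= e by rewrite -ler_pdivlMr// ge_min lexx orbT.
have [d1 d10 D1] := jet_g (gjet G) Gb e10.
have [d2 d20 D2] := jet_g (gjet G) G1 e10.
have [d3 d30 D3] := gQ_inverse_deriv dq Gb e10.
have [|d4 d40 D4] := Hs (Num.min d1 (Num.min d2 d3)); first by rewrite !lt_min d10 d20.
exists (Num.min d3 d4); first by rewrite lt_min d30.
move=> tau; rewrite lt_min => /andP[t3 /D4[]]; set x := sig tau.
rewrite !lt_min => /and3P[x1 x2 x3] qx gx.
have := D3 _ _ x3 t3 qx; rewrite -/wb -/dir; set v := _ + _ => hv.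
have xE : x - xs = v - tau *: (gfz G wb *: dir) by rewrite /v scalerA addrK.
have nx : `|x - xs| <= B * `|tau|.
  rewrite xE; apply: le_trans (ler_normB _ _) _; rewrite normrZ /B.
  have : e1 * `|tau| <= `|tau| by rewrite ler_piMl.
  by move: hv; clear; lra.
have b1 : `|(x, yb, zb) - wb| < d1 by rewrite norm_base.
have b2 : `|(x, y1, z1) - w1| < d2 by rewrite norm_base.
have b10 : `|wb - wb| < d1 by rewrite subrr normr0.
have b20 : `|w1 - w1| < d2 by rewrite subrr normr0.
have kE (y : X) (z : R) : (x, y, z) - (xs, y, z) = (x - xs, 0, 0).
  by apply/pair_equal_spec; split; [apply/pair_equal_spec; split|] => //=; exact: subrr.
have := D1 _ _ b1 b10; have := D2 _ _ b2 b20.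
rewrite !norm_base !kE /lin3 /= !dotp0r !mulr0 !addr0 g1b => k2 k1.
have h1 : e1 * `|x - xs| <= e1 * B * `|tau| by rewrite -mulrA ler_wpM2l// ltW.
have E : dotp (gfx G w1) (x - xs) - dotp (gfx G wb) (x - xs) = dotp eta1 v - tau * (gfz G wb * dotp eta1 dir).
  by rewrite -dotpBl -/eta1 xE dotpBr !dotpZr.
have h2 : `|dotp eta1 v| <= n%:R * `|eta1| * (e1 * `|tau|).
  by apply: le_trans (dotp_le _ _) _; rewrite ler_wpM2l// mulr_ge0.
have h3 : e1 * M * `|tau| <= e * `|tau| by rewrite ler_wpM2r.
have {}h3 : 2 * (e1 * B * `|tau|) + n%:R * `|eta1| * (e1 * `|tau|) <= e * `|tau|.
  by apply: le_trans h3; rewrite /M le_eqVlt; apply/orP; left; apply/eqP; ring.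
move: k1 k2 h1 h2 h3 E gx.
move: (e1 * `|x - xs|) (e1 * B * `|tau|) (n%:R * `|eta1| * _) (dotp eta1 v) (e * `|tau|) (tau * _) => a1 a2 a3 a4 a5 a6.
move: (dotp _ (x - xs)) (dotp _ (x - xs)) (gf G (x, yb, zb)) (gf G (x, y1, z1)) (gf G wb) => a7 a8 a9 a10 a11.
rewrite !ler_norml; clear => /andP[j1 j2] /andP[j3 j4] j5 /andP[j6 j7]; lra.
Qed.

Variables (Omega : set X) (u : X -> R) (y0 : X) (phi : X -> R).
Hypothesis st : setting G Omega u y0 phi.

Let sg := seg G Omega y0.

Lemma segment_contact a b z : Omega a -> Omega b -> heights Omega phi z ->
  (forall t, 0 <= t <= 1 -> z <= phi (sg a b z t)) ->
  (exists2 t, 0 < t < 1 & phi (sg a b z t) <= z) -> phi b = z.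
Proof.
move=> Oa Ob Jz Hge [t0 /andP[t00 t01] ht0].
have [t1 []] : exists t1, [/\ t0 <= t1 <= 1, phi (sg a b z t1) - z <= 0
    & forall t, t1 < t <= 1 -> 0 < phi (sg a b z t) - z].
  apply: (@last_contact R (fun t => phi (sg a b z t) - z) t0).
  - by rewrite !ltW.
  - by rewrite subr_le0.
  - move=> t tI e e0; have [d d0 D] := phi_seg_cts st Oa Ob Jz tI e0.
    exists d => // t' t'I td; have -> : phi (sg a b z t') - z - (phi (sg a b z t) - z) =
      phi (sg a b z t') - phi (sg a b z t) by ring.
    by apply: D => //; rewrite subrr normr0.
rewrite subr_le0 => /andP[t0t1 t1le] ht1 Hlast.
have t10 := lt_le_trans t00 t0t1.
have t1I : 0 <= t1 <= 1 by rewrite ltW.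
have pz : phi (sg a b z t1) = z by apply/eqP; rewrite eq_le ht1 Hge.
move: t1le; rewrite le_eqVlt => /orP[/eqP t1E|t11].
  by rewrite -[LHS](congr1 phi (seg1 st Oa Ob Jz)) -/sg -t1E.
have [Os Es] := segP st Oa Ob Jz t1I; rewrite -/sg in Os Es; move: pz Os Es.
set xs := sg a b z t1 => pz Os Es.
have [y1 [z1 [G1 g1u [r r0 Hr] tube1]]] := st_supp st Os.
have Gb := heights_dom st Os Jz.
rewrite pz in tube1; have ub := st_phi st Os; rewrite pz in ub.
set qa := gQ G (a, y0, z) in Es *; set qb := gQ G (b, y0, z) in Es *.
have [dq0|dq0] := eqVneq (qb - qa) 0.
  have ab : a = b.
    apply: (@gQ_inj R n G _ _ y0 z); [exact: (heights_dom st)|exact: (heights_dom st)|].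
    by apply/esym/eqP; rewrite -subr_eq0; apply/eqP.
  by rewrite -pz /xs -ab /sg (seg_id st).
have [rO rO0 DO] := open_norm (st_open st) Os.
have qE (s : R) : (1 - (t1 + s)) *: qa + (t1 + s) *: qb = gQ G (xs, y0, z) + s *: (qb - qa).
  by rewrite Es; apply/rowP => i; rewrite !mxE; ring.
pose tm := Num.min t1 (1 - t1); have tm0 : 0 < tm by rewrite lt_min t10 subr_gt0.
have tmI (s : R) : `|s| < tm -> 0 <= t1 + s <= 1.
  rewrite lt_min !ltr_norml => /andP[/andP[k1 k2] /andP[k3 k4]].
  by apply/andP; split; [move: k1|move: k4]; lra.
have le_phi x : Omega x -> z <= phi x -> u x <= gf G (x, y0, z).
  move=> Ox; rewrite -(st_phi st Ox) le_eqVlt => /orP[/eqP <-//|zp].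
  by apply/ltW/(gf_decr st) => //; [exact: (heights_dom st)|exact: (st_dom st)].
have orth : dotp (gfx G (xs, y1, z1) - gfx G (xs, y0, z)) ((qb - qa) *m invmx (gE G (xs, y0, z))) = 0.
  apply: (@path_orth xs y0 y1 _ z z1 (fun tau => sg a b z (t1 + tau))) => //; first by rewrite g1u.
  move=> e e0; have m0 : 0 < Num.min e r by rewrite lt_min e0.
  have [d d0 D] := seg_cts st Oa Ob Jz t1I m0.
  exists (Num.min d tm); first by rewrite lt_min d0.
  move=> tau; rewrite lt_min => /andP[td /tmI tI]; have [Osx Esx] := segP st Oa Ob Jz tI.
  have := D b z (t1 + tau) Ob Jz tI; rewrite !subrr !normr0 addrAC subrr add0r => /(_ d0 d0 td).
  rewrite lt_min => /andP[xe xr]; split => //; first by rewrite Esx qE.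
  by apply: le_trans (Hr _ xr) _; apply: le_phi => //; exact: Hge.
rewrite -ub in tube1.
have m0 : 0 < Num.min (Num.min r rO) (1 - t1) by rewrite !lt_min r0 rO0 subr_gt0.
have [s [x [/andP[s0]]]] := contact_propagates Gb G1 (etrans g1u (esym ub)) tube1 dq0 orth m0.
rewrite !lt_min => /andP[_ st1] /andP[/andP[xr xO] _] Gx qx gx.
have tI : 0 <= t1 + s <= 1.
  by apply/andP; split; [rewrite addr_ge0// ltW|move: st1; lra].
have xE : sg a b z (t1 + s) = x by apply: (seg_eq st) => //; [exact: DO|rewrite qx -qE].
have tl : t1 < t1 + s <= 1 by rewrite ltrDl s0; case/andP: tI.
have := Hlast _ tl; rewrite xE subr_gt0 => zp.
have Ox := DO _ xO.
(* Beyond the last contact [phi x > z], so [u x < g(x, y0, z)]; but the propagated contact gives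
   [g(x, y0, z) <= g(x, y1, z1) <= u x]. *)
have := gf_decr st Gx (st_dom st Ox Ox) zp; rewrite (st_phi st Ox).
by move=> /lt_le_trans /(_ gx) /lt_le_trans /(_ (Hr _ xr)); rewrite ltxx.
Qed.

(** As the parameter varies, a first contact would be at an interior point of a g-segment, since
    both ends are kept strictly above; [segment_contact] would carry it to the end [bb s]. *)
Lemma segments_above a (bb : R -> X) (zz : R -> R) : Omega a ->
  (forall s, 0 <= s <= 1 -> [/\ Omega (bb s), heights Omega phi (zz s), zz s < phi a & zz s < phi (bb s)]) ->
  (forall s, 0 <= s <= 1 -> forall e : R, 0 < e -> exists2 d : R, 0 < d & forall s', 0 <= s' <= 1 -> `|s' - s| < d ->
     `|bb s' - bb s| < e /\ `|zz s' - zz s| < e) ->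
  (forall t, 0 <= t <= 1 -> zz 0 < phi (sg a (bb 0) (zz 0) t)) ->
  forall s t, 0 <= s <= 1 -> 0 <= t <= 1 -> zz s < phi (sg a (bb s) (zz s) t).
Proof.
move=> Oa Hb Hc H0 s t sI tI; rewrite -subr_gt0.
apply: (@propagate01 R (fun s t => phi (sg a (bb s) (zz s) t) - zz s)) => //.
- move=> {sI tI}{}s {}t sI tI e e0; have [Ob Jz _ _] := Hb s sI.
  have e2 : 0 < e / 2 by rewrite divr_gt0.
  have [d1 d10 D1] := phi_seg_cts st Oa Ob Jz tI e2.
  have m0 : 0 < Num.min d1 (e / 2) by rewrite lt_min d10.
  have [d2 d20 D2] := Hc s sI _ m0.
  exists (Num.min d1 d2); first by rewrite lt_min d10.
  move=> s' t' s'I t'I; rewrite !lt_min => /andP[_ s2] /andP[t1 _].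
  have [] := D2 s' s'I s2; rewrite !lt_min => /andP[b1 _] /andP[z1 z2].
  have [Ob' Jz' _ _] := Hb s' s'I.
  have := D1 _ _ _ Ob' Jz' t'I b1 z1 t1; move: z2; rewrite !ltr_norml => /andP[k1 k2] /andP[k3 k4].
  by apply/andP; split; move: k1 k2 k3 k4; rewrite /sg; lra.
- by move=> t' t'I; rewrite subr_gt0 H0.
- move=> {sI tI}{}s sI Hge {}t tI; have [Ob Jz za zb] := Hb s sI.
  rewrite lt_neqAle Hge// andbT eq_sym subr_eq0; apply/eqP => ht.
  have [t0|t0] := eqVneq t 0.
    by move: za; rewrite -ht t0 /sg (seg0 st)// ltxx.
  have [t1|t1] := eqVneq t 1.
    by move: zb; rewrite -{1}ht t1 /sg (seg1 st)// ltxx.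
  have tI' : 0 < t < 1 by have /andP[? ?] := tI; rewrite !lt_neqAle eq_sym t0 t1; apply/andP.
  have := segment_contact Oa Ob Jz _ (ex_intro2 _ _ t tI' _); rewrite ht lexx => E.
  have := zb; rewrite E ?ltxx// => t' t'I.
  by rewrite -subr_ge0 Hge.
Qed.

Theorem support_global x0 : Omega x0 ->
  (exists2 d : R, 0 < d & forall x, `|x - x0| < d -> phi x <= phi x0) ->
  forall x, Omega x -> phi x <= phi x0.
Proof.
move=> O0 [d0 d00 Hd0] x1 O1; rewrite leNgt; apply/negP => x01.
have J0 : heights Omega phi (phi x0) by exists x0.
have I0 : 0 <= (0 : R) <= 1 by rewrite lexx ler01.
have I1 : 0 <= (1 : R) <= 1 by rewrite lexx ler01.
pose gam s := sg x0 x1 (phi x0) s.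
have Og s : 0 <= s <= 1 -> Omega (gam s) by move=> /(segP st O0 O1 J0)[].
have [||sm] := compact_min (f := fun s : R => phi (gam s)) _ (@segment_compact R 0 1).
- by exists 0; rewrite /= in_itv.
- move=> s; rewrite /= in_itv /= => sI e e0; have [d dd D] := phi_seg_cts st O0 O1 J0 sI e0.
  exists d => // s' s'I sd; apply: D => //; rewrite ?subrr ?normr0//.
rewrite /= in_itv /= => smI smin.
have {}smin s : 0 <= s <= 1 -> phi (gam sm) <= phi (gam s) by move=> sI; apply: smin; rewrite in_itv.
have g0 : gam 0 = x0 by exact: (seg0 st).
have g1 : gam 1 = x1 by exact: (seg1 st).
have Oc := Og _ smI; set c := gam sm in smin Oc *.
have [[x2 O2 x2c]|Hc] := pselect (exists2 x, Omega x & phi x < phi c); last first.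
  have all_c x : Omega x -> phi x = phi c.
    move=> Ox; have Jc : heights Omega phi (phi c) by exists c.
    have Gc := heights_dom st Oc Jc.
    have [r r0 Dr] := open_norm (st_open st) Oc.
    have [d dd D] := gQ_open Gc r0.
    set qc := gQ G (c, y0, phi c) in D *; set qx := gQ G (x, y0, phi c).
    pose M := `|qx - qc| + 1; have M0 : 0 < M by rewrite /M ltr_wpDl.
    (* The g-segment from [x] to the minimum point [c] is prolonged a little beyond [c], to a point
       [a] of [Omega]. Then [c] is interior to the g-segment from [a] to [x], at parameter
       [ep / (1 + ep)]. *)
    pose ep := d / 2 / M; have ep0 : 0 < ep by rewrite !divr_gt0.
    have epd : `|- ep *: (qx - qc)| < d.
      rewrite scaleNr normrN normrZ gtr0_norm//.
      have : ep * `|qx - qc| <= ep * M by rewrite ler_wpM2l ?(ltW ep0)// /M lerDl.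
      have : ep * M = d / 2 by rewrite /ep divfK// gt_eqF.
      by move: dd; lra.
    have [||a [aO Ga qa]] := D (phi c) (qc + - ep *: (qx - qc)).
    + by rewrite subrr normr0.
    + by rewrite addrAC subrr add0r.
    have {aO}Oa := Dr _ aO.
    pose tc := ep / (1 + ep); have ep1 : 0 < 1 + ep by rewrite ltr_wpDl.
    have tc1 : 0 < tc < 1.
      by rewrite divr_gt0//= ltr_pdivrMr// mul1r ltrDr.
    have tcI : 0 <= tc <= 1 by case/andP: tc1 => ? ?; rewrite !ltW.
    apply: (segment_contact Oa Ox Jc).
    + move=> t tI; have [Ot _] := segP st Oa Ox Jc tI; rewrite leNgt; apply/negP => h.
      by apply: Hc; exists (sg a x (phi c) t).
    + exists tc => //; suff -> : sg a x (phi c) tc = c by [].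
      apply: (seg_eq st) => //; rewrite qa -/qx -/qc /tc.
      have ne : 1 + ep != 0 by rewrite gt_eqF.
      by clearbody ep qx qc; apply/rowP => i; rewrite !mxE; field.
  by move: x01; rewrite (all_c x0 O0) (all_c x1 O1) ltxx.
have J2 : heights Omega phi (phi x2) by exists x2.
have x20 : phi x2 < phi x0 by apply: lt_le_trans x2c _; rewrite -g0; exact: smin.
have stage1 t : 0 <= t <= 1 -> phi x2 < phi (sg x0 x1 (phi x2) t).
  move=> tI; rewrite -g1.
  apply: (@segments_above x0 gam (fun=> phi x2)) => //.
  - by move=> s sI; split => //; [exact: Og|apply: lt_le_trans x2c _; exact: smin].
  - move=> s sI e e0; have [d dd D] := seg_cts st O0 O1 J0 sI e0.
    exists d => // s' s'I sd; rewrite subrr normr0; split => //.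
    by apply: D => //; rewrite subrr normr0.
  - by move=> t' t'I; rewrite g0 /sg (seg_id st).
have stage2 z t : phi x2 < z < phi x0 -> 0 <= t <= 1 -> z < phi (sg x0 x1 z t).
  move=> /andP[z2 z0] tI; pose zz s := phi x2 + s * (z - phi x2).
  have z1 : zz 1 = z by rewrite /zz mul1r addrC subrK.
  rewrite -z1; apply: (@segments_above x0 (fun=> x1) zz) => //.
  - move=> s /andP[s0 s1].
    have h1 : 0 <= s * (z - phi x2) by rewrite mulr_ge0// subr_ge0 ltW.
    have h2 : s * (z - phi x2) <= z - phi x2 by rewrite ler_piMl// subr_ge0 ltW.
    have zs0 : zz s < phi x0 by rewrite /zz; move: h2 z0; lra.
    split => //; last exact: lt_trans x01.
    apply: (heights_interval st J2 J0); rewrite (ltW zs0) andbT /zz; move: h1; lra.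
  - move=> s sI e e0; have M0 : 0 < z - phi x2 by rewrite subr_gt0.
    exists (e / (z - phi x2)); first by rewrite divr_gt0.
    move=> s' s'I; rewrite ltr_pdivlMr// => sd; rewrite subrr normr0; split => //.
    have -> : zz s' - zz s = (s' - s) * (z - phi x2) by rewrite /zz; ring.
    by rewrite normrM (gtr0_norm M0).
  - by move=> t' t'I; rewrite /zz mul0r addr0; exact: stage1.
have lim t : 0 <= t <= 1 -> phi x0 <= phi (gam t).
  move=> tI; apply/ler_addgt0Pl => e e0.
  have e2 : 0 < e / 2 by rewrite divr_gt0.
  have [d dd D] := phi_seg_cts st O0 O1 J0 tI e2.
  (* A height strictly between [phi x2] and [phi x0], as the start [x0] must stay strictly above it,
     and close enough to [phi x0] for continuity. *)
  pose z := Num.max ((phi x2 + phi x0) / 2) (phi x0 - Num.min d e / 2).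
  have m0 : 0 < Num.min d e by rewrite lt_min dd.
  have [md me] : Num.min d e <= d /\ Num.min d e <= e by rewrite !ge_min !lexx orbT.
  have z2 : phi x2 < z by rewrite lt_max; apply/orP; left; move: x20; lra.
  have z0 : z < phi x0 by rewrite gt_max; apply/andP; split; [move: x20; lra|move: m0; lra].
  have zd : phi x0 - Num.min d e / 2 <= z by rewrite le_max lexx orbT.
  have zI : phi x2 < z < phi x0 by rewrite z2.
  have Jz : heights Omega phi z by apply: (heights_interval st J2 J0); rewrite !ltW.
  have h := stage2 z t zI tI.
  have := D x1 z t O1 Jz tI; rewrite !subrr !normr0 => /(_ dd _ dd)/wrap[].
    by rewrite ltr0_norm ?subr_lt0//; move: zd md m0; lra.
  by rewrite /gam ltr_norml => /andP[_ k]; move: k h zd me; rewrite /sg; lra.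
have [dt dt0 Dt] := seg_cts st O0 O1 J0 I0 d00.
pose t := Num.min (dt / 2) (1 / 2).
have t0 : 0 < t by rewrite lt_min !divr_gt0.
have t1 : t < 1 by apply: (@le_lt_trans _ _ (1 / 2)); [rewrite ge_min lexx orbT|lra].
have td : t < dt by apply: (@le_lt_trans _ _ (dt / 2)); [rewrite ge_min lexx|move: dt0; lra].
have tI : 0 < t < 1 by rewrite t0.
have tI' : 0 <= t <= 1 by rewrite !ltW.
have E : phi x1 = phi x0.
  apply: (segment_contact O0 O1 J0 lim); exists t => //.
  apply: Hd0; have := Dt x1 (phi x0) t O1 J0 tI'; rewrite !subrr !normr0 subr0 (gtr0_norm t0) (seg0 st)//.
  by apply.
by move: x01; rewrite E ltxx.
Qed.

End Segments.

(** * The concrete generating function *)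

Section Instance.
Context {R : realType} {n : nat}.
Local Notation X := 'rV[R]_n.
Local Notation XYZ := (X * X * R)%type.
Implicit Types (Gamma : set XYZ) (g : XYZ -> R) (x y p q : X) (t z : R) (w : XYZ) (Omega : set X) (u : X -> R).

Lemma convex_set_comb (A : set X) (a b : X) t : @convex_set R X A -> A a -> A b -> 0 <= t <= 1 ->
  A ((1 - t) *: a + t *: b).
Proof.
move=> cA Aa Ab /andP[t0 t1].
(* [conv] gives the weight [t] to its first point, hence the exchanged ends. *)
have := @cA b a (Itv01 t0 t1) (mem_set Ab) (mem_set Aa); rewrite inE.
have -> : conv (Itv01 t0 t1) (b : convex_lmodType X) a = t *: b + (1 - t) *: a by [].
by rewrite addrC.
Qed.

Lemma det_unitmx (M : 'M[R]_n) : \det M != 0 -> M \in unitmx.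
Proof. by rewrite unitmxE unitfE. Qed.

Lemma UU_Sol Gamma g x t p : UU Gamma g x t p <-> exists w, Sol Gamma g (g_x g) x t p w.
Proof.
split; first by move=> [y [z [Gw gw pw]]]; exists (x, y, z).
by move=> [[[x' y] z] [Gw /= xE gw pw]]; subst x'; exists y, z.
Qed.

Lemma Sol_YZ Gamma g x t p w : condA1 Gamma g ->
  Sol Gamma g (g_x g) x t p w -> YZ Gamma g x t p = (w.1.2, w.2).
Proof.
move=> hA1 S; have [yz [_ U]] := hA1 x t p ((UU_Sol Gamma g x t p).2 (ex_intro _ w S)).
have h : YZ_spec Gamma g x t p (w.1.2, w.2).
  by case: w S => [[x' y] z] [Gw /= xE gw pw]; subst x'.
have h2 : YZ_spec Gamma g x t p (YZ Gamma g x t p) by exact: (xgetPex (0, 0) (ex_intro _ _ h)).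
exact: (etrans (esym (U _ h2)) (U _ h)).
Qed.

Lemma Sol_A Gamma g x t p w : condA1 Gamma g ->
  Sol Gamma g (g_x g) x t p w -> A Gamma g x t p = g_xx g w.
Proof.
move=> hA1 S; rewrite /A /Y /Z (Sol_YZ hA1 S) /=.
by case: w S => [[x' y] z] [_ /= xE _ _]; subst x'.
Qed.

Lemma gdata_exists Gamma g : generating_function Gamma g -> condA1 Gamma g -> condA2 Gamma g ->
  condA1star Gamma g -> condA3w Gamma g ->
  exists G : @gdata R n, [/\ dom G = Gamma, gf G = g, gfx G = g_x g & gQ G = Q g].
Proof.
move=> [[oG _ _] _ C2g gz0] hA1 hA2 hA1s hA3w.
have su x t p w w' : Sol Gamma g (g_x g) x t p w -> Sol Gamma g (g_x g) x t p w' -> w = w'.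
  move=> S S'; have [e1 e2] := etrans (esym (Sol_YZ hA1 S)) (Sol_YZ hA1 S').
  case: w w' S S' e1 e2 => [[x1 y1] z1] [[x2 y2] z2] [_ /= <- _ _] [_ /= <- _ _].
  by move=> <- <-.
have Qi x x' y z : Gamma (x, y, z) -> Gamma (x', y, z) -> Q g (x, y, z) = Q g (x', y, z) -> x = x'.
  by move=> h h'; exact (@hA1s y z x x' (mem_set h) (mem_set h')).
have A3 (xi x : X) (t : R) (p q : X) :
    (forall s : R, 0 <= s <= 1 -> exists w, Sol Gamma g (g_x g) x t ((1 - s) *: p + s *: q) w) ->
    dotp (q - p) xi = 0 ->
    forall (s : R) wp wq ws, 0 <= s <= 1 -> Sol Gamma g (g_x g) x t p wp ->
      Sol Gamma g (g_x g) x t q wq -> Sol Gamma g (g_x g) x t ((1 - s) *: p + s *: q) ws ->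
      dotp (xi *m g_xx g ws) xi <=
        (1 - s) * dotp (xi *m g_xx g wp) xi + s * dotp (xi *m g_xx g wq) xi.
  move=> H orth s wp wq ws /andP[s0 s1] Sp Sq Ss.
  have hseg : segment p q `<=` UU Gamma g x t.
    by move=> r [s' /=]; rewrite in_itv /= => s'I <-; apply/UU_Sol; exact: H.
  have pin : p \in segment p q.
    by rewrite inE; exists 0; [rewrite /= in_itv /= lexx ler01|rewrite subr0 scale1r scale0r addr0].
  have qin : q \in segment p q.
    by rewrite inE; exists 1; [rewrite /= in_itv /= lexx ler01|rewrite subrr scale1r scale0r add0r].
  have cE : conv (Itv01 s0 s1) (q : convex_lmodType X) p = (1 - s) *: p + s *: q.
    transitivity (s *: q + (1 - s) *: p); [by []|exact: addrC].
  have := hA3w xi x t p q hseg orth (Itv01 s0 s1) q p qin pin; rewrite cE convRE /=.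
  move: (Sol_A hA1 Sp) (Sol_A hA1 Sq) (Sol_A hA1 Ss).
  generalize (A Gamma g x t p) (A Gamma g x t q) (A Gamma g x t ((1 - s) *: p + s *: q)).
  generalize (g_xx g wp) (g_xx g wq) (g_xx g ws).
  by move=> M1 M2 M3 _ _ _ -> -> ->; rewrite addrC.
exists (GData (concrete_jet oG C2g) gz0 (fun w Gw => det_unitmx (hA2 w Gw)) su Qi A3).
by split.
Qed.

(** Through this the [y] of any local support belongs to [Sigma], which is what (i) and (ii) are
    about. *)
Lemma support_subgradient (G : @gdata R n) u (xs y1 : X) (z1 : R) : dom G (xs, y1, z1) ->
  u xs = gf G (xs, y1, z1) -> (\forall x \near xs, gf G (x, y1, z1) <= u x) ->
  subdifferential u xs (gfx G (xs, y1, z1)).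
Proof.
move=> G1 u1 Hu; set p := gfx G _.
exists (fun x => gf G (x, y1, z1) - gf G (xs, y1, z1) - dotp p (x - xs)).
  apply/esym/littleoE => e e0; apply: (near_normP xs _).2.
  have [d d0 D] := jet_g (gjet G) G1 e0; exists d => // x xd.
  have b1 : `|(x, y1, z1) - (xs, y1, z1)| < d by rewrite norm_base.
  have b2 : `|(xs, y1, z1) - (xs, y1, z1)| < d by rewrite subrr normr0.
  have := D _ _ b1 b2; rewrite norm_base /lin3 /= !subrr !dotp0r mulr0 !addr0.
  by [].
apply: filterS Hu => x; rewrite u1; set a := gf G (xs, y1, z1); set b := gf G (x, y1, z1).
by have -> : a + dotp p (x - xs) + (b - a - dotp p (x - xs)) = b by ring.
Qed.

End Instance.

Unset Implicit Arguments.

Theorem theorem3p2 (R : realType) (n : nat)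
  (Gamma : set ('rV[R]_n * 'rV[R]_n * R)) (g : 'rV[R]_n * 'rV[R]_n * R -> R)
  (Omega : set 'rV[R]_n) (u : 'rV[R]_n -> R)
  (hg : generating_function Gamma g)
  (hA1 : condA1 Gamma g) (hA2 : condA2 Gamma g)
  (hA1star : condA1star Gamma g) (hA3w : condA3w Gamma g)
  (hOmega : domain Omega)
  (hu : {within closure Omega, continuous u})
  (hloc : locally_g_convex Gamma g u Omega)
  (hUU : forall x, Omega x -> subdifferential u x `<=` UU Gamma g x (u x))
  (hGamma_star : forall x y, closure Omega x -> Sigma Gamma g u Omega y ->
     Gamma_star Gamma g (x, y, u x))
  (hi : forall y z, Sigma Gamma g u Omega y ->
     [set gstar Gamma g x y (u x) | x in closure Omega] z ->
     g_convex_set Gamma g Omega y z)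
  (hii : sub_gstar_convex Gamma g u Omega (Sigma Gamma g u Omega)) :
  g_convex Gamma g u Omega.
Proof.

have [_ hint _ _] := hg.
have [G [GE gE gxE QE]] := gdata_exists hg hA1 hA2 hA1star hA3w.
subst Gamma g.
have Gint x y z1 z2 z : dom G (x, y, z1) -> dom G (x, y, z2) -> z1 <= z <= z2 -> dom G (x, y, z).
  by move=> h1 h2; exact ((hint x y).2 z1 z2 h1 h2 z).
have decr x y z1 z2 : dom G (x, y, z1) -> dom G (x, y, z2) -> z1 < z2 -> gf G (x, y, z2) < gf G (x, y, z1).
  by move=> h1 h2; apply: gf_decr_z => z; exact (Gint x y z1 z2 z h1 h2).
have gstarP x y t : Gamma_star (dom G) (gf G) (x, y, t) ->
    dom G (x, y, gstar (dom G) (gf G) x y t) /\ gf G (x, y, gstar (dom G) (gf G) x y t) = t.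
  move=> [[[x' y'] z] /= Gw [xE yE tE]]; subst x' y'.
  exact: (@xgetPex _ 0 [set z | dom G (x, y, z) /\ gf G (x, y, z) = t] (ex_intro _ z (conj Gw tE))).
have gstarE x y z t : dom G (x, y, z) -> gf G (x, y, z) = t -> gstar (dom G) (gf G) x y t = z.
  move=> h e; have [h' e'] : dom G (x, y, gstar (dom G) (gf G) x y t) /\ gf G (x, y, gstar (dom G) (gf G) x y t) = t.
    by apply: gstarP; exists (x, y, z) => //=; rewrite e.
  have [lt|lt|//] := ltgtP (gstar (dom G) (gf G) x y t) z.
    by have := decr _ _ _ _ h' h lt; rewrite e e' ltxx.
  by have := decr _ _ _ _ h h' lt; rewrite e e' ltxx.
have [oO cO _] := hOmega.
have clO x : Omega x -> closure Omega x by exact: subset_closure.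
have [uc hsupp] := hloc.
have suppS xs N y1 z1 : Omega xs -> nbhs xs N -> (forall x, N x -> dom G (x, y1, z1)) ->
    u xs = gf G (xs, y1, z1) -> (forall x, N x -> gf G (x, y1, z1) <= u x) ->
    Sigma (dom G) (gf G) u Omega y1.
  move=> Os nN Nd us Nu; have Ns := nbhs_singleton nN; have G1 := Nd _ Ns.
  exists xs => //; exists (gfx G (xs, y1, z1)).
    by apply: support_subgradient => //; exact: filterS nN.
  have S : Sol (dom G) (gf G) (g_x (gf G)) xs (u xs) (gfx G (xs, y1, z1)) (xs, y1, z1).
    by split => //; rewrite gxE.
  by rewrite /Y (Sol_YZ hA1 S).
split; first exact: uc.
move=> x0 O0; have [N0 [nN0 _ [y0 [z0 [Nd us Nu]]]]] := hsupp x0 O0.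
have Sy0 := suppS x0 N0 y0 z0 O0 nN0 Nd us Nu.
pose phi x := gstar (dom G) (gf G) x y0 (u x).
have phiP x : Omega x -> dom G (x, y0, phi x) /\ gf G (x, y0, phi x) = u x.
  by move=> Ox; apply: gstarP; apply: hGamma_star => //; exact: clO.
have gcv x : Omega x -> g_convex_set (dom G) (gf G) Omega y0 (phi x).
  by move=> Ox; apply: hi => //; exists x => //; exact: clO.
have st : setting G Omega u y0 phi.
  split => //.
  - move=> x Ox; apply/cvg_normP => e e0.
    have /subspace_continuousP/(_ x Ox)/cvgrPdist_lt/(_ e e0) := uc.
    rewrite near_withinE => /near_normP[d d0 D].
    have [r r0 Dr] := open_norm oO Ox.
    exists (Num.min d r); first by rewrite lt_min d0.
    move=> x'; rewrite lt_min => /andP[h1 /Dr h2].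
    by rewrite distrC; exact (D x' h1 h2).
  - by move=> x x' Ox Ox'; have [h _] := gcv x' Ox'; exact: h.
  - by move=> x /phiP[].
  - move=> a b c t Oa Ob Oc tI; have [_ h] := gcv c Oc; rewrite QE.
    have [||x Ox E] := convex_set_comb h _ _ tI (a := Q (gf G) (a, y0, phi c)) (b := Q (gf G) (b, y0, phi c)).
    + by exists a.
    + by exists b.
    + by exists x.
  - move=> xs Os; have [N1 [nN1 _ [y1 [z1 [Nd1 us1 Nu1]]]]] := hsupp xs Os.
    have Sy1 := suppS xs N1 y1 z1 Os nN1 Nd1 us1 Nu1.
    have G1 := Nd1 _ (nbhs_singleton nN1); have [Gp gp] := phiP xs Os.
    exists y1, z1; split => //.
      by have /near_normP[d d0 D] := nN1; exists d => // x /D; exact: Nu1.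
    move=> s sI; have [_ hull] := hii xs Os.
    have [w Sw] : exists w, Sol (dom G) (gf G) (g_x (gf G)) xs (u xs)
        (gfx G (xs, y0, phi xs) + s *: (gfx G (xs, y1, z1) - gfx G (xs, y0, phi xs))) w.
      (* Both gradients are values of [P] at points of [Sigma], so their segment lies in every
         convex set containing these values. *)
      apply/UU_Sol; apply: hull => B [cB sB].
      have -> : gfx G (xs, y0, phi xs) + s *: (gfx G (xs, y1, z1) - gfx G (xs, y0, phi xs)) =
          (1 - s) *: gfx G (xs, y0, phi xs) + s *: gfx G (xs, y1, z1).
        by rewrite scalerBr scalerBl scale1r addrA addrAC.
      apply: convex_set_comb => //; apply: sB.
      + by exists y0 => //; rewrite /P gxE.
      + by exists y1 => //; rewrite /P gxE (gstarE xs y1 z1 (u xs) G1 (esym us1)).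
    by exists w; move: Sw; rewrite -gxE.
have phi0 : phi x0 = z0 by apply: gstarE => //; exact: Nd (nbhs_singleton nN0).
(* The local support in terms of heights: [phi x > z0] would give [u x < g(x, y0, z0)], as g
   decreases in z. *)
have near0 : exists2 d : R, 0 < d & forall x, `|x - x0| < d -> phi x <= phi x0.
  have [r r0 Dr] := open_norm oO O0.
  have /near_normP[d d0 D] := nN0; exists (Num.min d r); first by rewrite lt_min d0.
  move=> x; rewrite lt_min => /andP[/D Nx /Dr Ox]; have [Gx gx] := phiP x Ox.
  rewrite phi0 leNgt; apply/negP => lt.
  by have := decr _ _ _ _ (Nd x Nx) Gx lt; rewrite gx ltNge Nu.
have H := support_global st O0 near0.
exists y0, z0; split => //; first by move=> x Ox; rewrite -phi0; exact (st_dom st Ox O0).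
move=> x Ox; have [Gx gx] := phiP x Ox; have := H x Ox; rewrite phi0 -gx le_eqVlt => /orP[/eqP -> //|lt].
by apply/ltW/decr => //; rewrite -phi0; exact (st_dom st Ox O0).
Qed.
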